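(* Let $\varphi(s)=s+s_0$, where $s_0\in\mathbb{C}$, $\operatorname{Re}s_0\ge 0$ and $s_0\ne 0$. Then the spectrum and essential spectrum of the composition operator $C_\varphi$ on the Zen space $A^2_\nu$ coincide and equal (a) $\mathbb{T}$ if $s_0\in i\mathbb{R}$; (b) $\{e^{-s_0t}:t\ge 0\}\cup\{0\}$ if $s_0\in\mathbb{C}_+$.
   Context: $\mathbb{C}_+=\{z\in\mathbb{C}:\operatorname{Re}z>0\}$ is the right half-plane and $\mathbb{T}$ is the unit circle. Let $\nu$ be a positive regular Borel measure on $[0,\infty)$ satisfying the doubling condition $\sup_{t>0}\nu[0,2t)/\nu[0,t)<\infty$. The Zen space $A^2_\nu$ consists of all analytic $F:\mathbb{C}_+\to\mathbb{C}$ such that $$\|F\|^2=\sup_{\epsilon>0}\int_{\overline{\mathbb{C}_+}}|F(s+\epsilon)|^2\,d\nu(x)\,dy<\infty ,\qquad s=x+iy .$$ The weight corresponding to $\nu$ is $w(t)=2\pi\int_0^\infty e^{-2rt}\,d\nu(r)$ for $t>0$ (the integral being over $[0,\infty)$). The Laplace transform is an isometric isomorphism from $L^2(0,\infty,w(t)\,dt)$ onto $A^2_\nu$. The composition operator is $C_\varphi f=f\circ\varphi$. The essential spectrum is the set of $\lambda\in\mathbb{C}$ such that $C_\varphi-\lambda I$ is not Fredholm (the spectrum in the Calkin algebra). *)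

(* Defs.v *)
From HB Require Import structures.
From mathcomp Require Import all_boot all_order all_algebra complex.
From mathcomp Require Import all_classical all_reals all_analysis.
From mathcomp Require Import measurable_realfun ring lra.

Set Implicit Arguments.
Unset Strict Implicit.
Unset Printing Implicit Defensive.

Import Order.TTheory GRing.Theory Num.Theory.
Import numFieldNormedType.Exports.

Local Open Scope classical_set_scope.
Local Open Scope complex_scope.
Local Open Scope ring_scope.

Section operators.
Context {K : numFieldType} {E : normedModType K}.
Implicit Types (A : set E) (T : {linear E -> E}).

Definition invertible_op (f : E -> E) : Prop :=
  exists S : {linear E -> E}, [/\ continuous S, cancel f S & cancel S f].

Definition spectrum T : set K :=
  [set l | ~ invertible_op (fun x => T x - l *: x)].

Definition lin_span (s : seq E) : set E :=
  [set x | exists c : 'I_(size s) -> K, x = \sum_(i < size s) c i *: s`_i].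

Definition finite_dim A : Prop := exists s : seq E, A `<=` lin_span s.

Definition finite_codim A : Prop := exists s : seq E,
  forall x, exists y z, [/\ A y, lin_span s z & x = y + z].

Definition fredholm (f : E -> E) : Prop :=
  [/\ finite_dim (f @^-1` [set 0]), closed (range f) & finite_codim (range f)].

Definition essential_spectrum T : set K :=
  [set l | ~ fredholm (fun x => T x - l *: x)].

End operators.

Section zen_definitions.
Context {R : realType}.

Definition regular_borel (mu : set (measurableTypeR R) -> \bar R) : Prop :=
  [/\ forall C : set R, compact C -> (mu C < +oo)%E,
      forall A : set (measurableTypeR R), measurable A ->
        mu A = ereal_inf [set mu U | U in [set U : set R | open U /\ A `<=` U]]
    & forall A : set (measurableTypeR R), measurable A ->
        mu A = ereal_sup [set mu C | C in [set C : set R | compact C /\ C `<=` A]]].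

(* In \bar R one has 0 / 0 = 0, so positivity of the denominators, implicit in
   the quotient, has to be required separately. *)
Definition doubling (mu : set (measurableTypeR R) -> \bar R) : Prop :=
  (forall t : R, 0 < t -> (0 < mu `[0%R, t[%classic)%E) /\
  (ereal_sup [set (mu `[0%R, (2 * t)%R[%classic / mu `[0%R, t[%classic)%E
             | t in [set t : R | (0 < t)%R]] < +oo)%E.

(* A measure on [0, +oo[ is a measure on the line that does not charge
   ]-oo, 0[. *)
Record zenMeasure := ZenMeasure {
  zen_measure :> {measure set (measurableTypeR R) -> \bar R};
  zen_support : zen_measure `]-oo, 0%R[%classic = 0%E;
  zen_regular : regular_borel zen_measure;
  zen_doubling : doubling zen_measure }.

Definition cexp (z : R[i]) : R[i] :=
  (expR (complex.Re z))%:C * (cos (complex.Im z) +i* sin (complex.Im z)).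

Definition Cplus := {z : R[i] | 0 < complex.Re z}.

Implicit Types F : Cplus -> R[i]^o.

(* Extension by zero; only its values on the open half-plane are ever used. *)
Definition ext0 F (z : R[i]^o) : R[i]^o := oapp F 0 (insub z).

Definition holomorphic F : Prop :=
  forall z : R[i]^o, 0 < complex.Re z -> derivable (ext0 F) z 1.

Definition zen_integral (nu : zenMeasure) F (e : R) : \bar R :=
  (\int[nu \x lebesgue_measure]_(p in `[0%R, +oo[%classic `*` setT)
     ((ComplexField.Normc.normc (ext0 F ((p.1 + e) +i* p.2))) ^+ 2)%:E)%E.

Definition zen_sqnorm (nu : zenMeasure) F : \bar R :=
  ereal_sup [set zen_integral nu F e | e in [set e : R | 0 < e]].

Definition zen_pred (nu : zenMeasure) : {pred Cplus -> R[i]^o} :=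
  [pred F | `[< holomorphic F /\ (zen_sqnorm nu F < +oo)%E >]].

Record zenSpace (nu : zenMeasure) := ZenSpace {
  zen_fun :> Cplus -> R[i]^o;
  zen_funP : zen_fun \in zen_pred nu }.

End zen_definitions.
Arguments zenMeasure R : clear implicits.
Arguments Cplus R : clear implicits.

Section zen_theory.
Context {R : realType}.
Local Notation C := (R[i]^o).
Local Notation normc := ComplexField.Normc.normc.
Implicit Types (nu : zenMeasure R) (F G : Cplus R -> C).

Lemma ext0E F (u : Cplus R) : ext0 F (val u) = F u.
Proof. by rewrite /ext0 valK. Qed.

Lemma ext0D F G : ext0 (F + G) = ext0 F + ext0 G.
Proof.
apply/funext => z; rewrite /ext0 /GRing.add /=.
by case: insubP => //= _; rewrite addr0.
Qed.

Lemma ext0Z (a : R[i]) F : ext0 (a *: F) = a \*: ext0 F.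
Proof.
apply/funext => z; rewrite /ext0 /=.
by case: insubP => //= _; rewrite scaler0.
Qed.

Lemma normcE (z : R[i]) : `|z| = (normc z)%:C.
Proof. by []. Qed.

Lemma normc_ge0 (z : R[i]) : 0 <= normc z.
Proof. by rewrite -ler0c -normcE. Qed.

Lemma normcD (x y : R[i]) : normc (x + y) <= normc x + normc y.
Proof. by rewrite -lecR rmorphD /= -!normcE ler_normD. Qed.

Lemma normcB (x y : R[i]) : normc (x - y) = normc (y - x).
Proof. by apply: complexI; rewrite -[LHS]normcE -[RHS]normcE distrC. Qed.

Lemma normc_le_ReIm (z : R[i]) : normc z <= `|complex.Re z| + `|complex.Im z|.
Proof.
case: z => a b /=; rewrite -(@ler_pXn2r _ 2)// ?nnegrE ?sqrtr_ge0 ?addr_ge0//.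
rewrite sqr_sqrtr ?addr_ge0 ?sqr_ge0// sqrrD !real_normK ?num_real//.
by have := mulr_ge0 (normr_ge0 a) (normr_ge0 b); lra.
Qed.

Lemma holomorphic_continuous F (z : C) : holomorphic F -> 0 < complex.Re z ->
  forall d : R, 0 < d -> exists2 r : R, 0 < r & forall w : R[i],
    normc (w - z) < r -> normc (ext0 F w - ext0 F z) < d.
Proof.
move=> hF z0 d d0.
have /derivable1_diffP/differentiable_continuous cF := hF z z0.
have d0C : (0 : R[i]) < d%:C by rewrite ltcR.
have /cvgrPdist_lt/(_ _ d0C) := cF.
move=> /nbhs_ballP[e /= e0 he].
have [er eE] : exists r, e = r%:C.
  by apply/complex_realP; rewrite gtr0_real.
rewrite eE ltcR in e0; exists er => // w wz.
have := he w; rewrite -ball_normE /= eE distrC normcE ltcR => /(_ wz).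
by rewrite distrC normcE ltcR.
Qed.

Lemma open_measurable2 (A : set (R * R)) : open A ->
  measurable (A : set (measurableTypeR R * measurableTypeR R)).
Proof.
move=> oA.
pose box (q : (rat * rat) * (rat * rat)) : set (R * R) :=
  `]ratr q.1.1, ratr q.1.2[%classic `*` `]ratr q.2.1, ratr q.2.2[%classic.
pose F q := if `[< box q `<=` A >] then box q else set0.
have -> : A = \bigcup_q F q.
  apply/seteqP; split => [p Ap|p [q _]]; last first.
    by rewrite /F; case: asboolP => // qA /qA.
  have /nbhs_ballP[e /= e0 he] : nbhs p A by exact: open_nbhs_nbhs.
  have rat_lr (x : R) : exists q : rat * rat,
      [/\ x - e < ratr q.1, ratr q.1 < x, x < ratr q.2 & ratr q.2 < x + e].
    have [q1] : exists q : rat, ratr q \in `]x - e, x[ by apply: rat_in_itvoo; lra.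
    have [q2] : exists q : rat, ratr q \in `]x, x + e[ by apply: rat_in_itvoo; lra.
    by rewrite !in_itv /= => /andP[? ?] /andP[? ?]; exists (q1, q2).
  have [q1 [h1 h2 h3 h4]] := rat_lr p.1.
  have [q2 [k1 k2 k3 k4]] := rat_lr p.2.
  exists (q1, q2) => //; rewrite /F; case: asboolP.
    by move=> _; split => /=; rewrite in_itv/=; apply/andP.
  case; move=> x [] /=; rewrite !in_itv /= => /andP[a1 a2] /andP[b1 b2].
  apply: he; split => /=; rewrite /ball /= ltr_distlC; apply/andP; split; lra.
apply: countable_bigcupT_measurable => //.
move=> q; rewrite /F; case: asboolP => // _.
by apply: measurableX; exact: measurable_itv.
Qed.

Definition half_plane_normc F (e : R) (p : R * R) : R :=
  normc (ext0 F ((p.1 + e) +i* p.2)).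

Lemma half_plane_normc_near F e (p : R * R) (a : R) : holomorphic F ->
  0 < p.1 + e -> a < half_plane_normc F e p ->
  exists2 r : R, 0 < r & forall q : R * R,
    `|q.1 - p.1| < r -> `|q.2 - p.2| < r ->
    0 < q.1 + e /\ a < half_plane_normc F e q.
Proof.
move=> hF p0 ap.
have [|r r0 hr] := @holomorphic_continuous F ((p.1 + e) +i* p.2) hF p0
  (half_plane_normc F e p - a); first by rewrite subr_gt0.
exists (Num.min (r / 2) (p.1 + e)); first by rewrite lt_min divr_gt0.
move=> q; rewrite !lt_min => /andP[qr1 qe] /andP[qr2 _]; split.
  by move: qe; rewrite ltr_distlC => /andP[]; lra.
have /hr : normc (((q.1 + e) +i* q.2) - ((p.1 + e) +i* p.2)) < r.
  apply: (le_lt_trans (normc_le_ReIm _)) => /=.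
  rewrite opprD addrACA subrr addr0.
  by rewrite [ltRHS]splitr ltrD.
move=> h.
have : half_plane_normc F e p <= half_plane_normc F e q +
    normc (ext0 F ((q.1 + e) +i* q.2) - ext0 F ((p.1 + e) +i* p.2)).
  rewrite /half_plane_normc normcB.
  by rewrite (le_trans _ (normcD _ _))// [X in _ <= normc X]addrC subrK.
lra.
Qed.

Local Notation half_space := (`[0%R, +oo[%classic `*` setT :
  set (measurableTypeR R * measurableTypeR R)).

Lemma measurable_half_space : measurable half_space.
Proof. by apply: measurableX => //; exact: measurable_itv. Qed.

Lemma measurable_half_plane_normc F e : holomorphic F -> 0 < e ->
  measurable_fun half_space (half_plane_normc F e).
Proof.
move=> hF e0 mD; apply: (measurability _ (RGenOInfty.measurableE R)) => //.
move=> _ [_ [a ->] <-].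
pose U := [set p : R * R | 0 < p.1 + e /\ a < half_plane_normc F e p].
have -> : half_space `&` half_plane_normc F e @^-1` `]a, +oo[%classic =
          half_space `&` U.
  apply/seteqP; split => p /= [[]]; rewrite !in_itv /= !andbT.
    by move=> p1 _ ap; do !split => //; lra.
  by move=> p1 _ [_ ap].
apply: measurableI => //; apply: open_measurable2.
rewrite openE => p [p0 ap].
have [r r0 hr] := half_plane_normc_near hF p0 ap.
apply/nbhs_ballP; exists r => //= q [/= q1 q2].
by apply: hr; rewrite distrC.
Qed.

Lemma half_plane_normcD F G e p :
  half_plane_normc (F + G) e p <= half_plane_normc F e p + half_plane_normc G e p.
Proof. by rewrite /half_plane_normc ext0D; exact: normcD. Qed.

Lemma half_plane_normcZ (a : R[i]) F e p :
  half_plane_normc (a *: F) e p = normc a * half_plane_normc F e p.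
Proof. by rewrite /half_plane_normc ext0Z ComplexField.Normc.normcM. Qed.

Lemma half_plane_normc_ge0 F e p : 0 <= half_plane_normc F e p.
Proof. exact: normc_ge0. Qed.

Lemma measurable_half_plane_sqr F e : holomorphic F -> 0 < e ->
  measurable_fun half_space (fun p => (half_plane_normc F e p ^+ 2)%:E).
Proof.
move=> hF e0; apply/measurable_EFinP.
by apply: measurable_funX; exact: measurable_half_plane_normc.
Qed.

Lemma zen_integral_ge0 nu F e : (0 <= zen_integral nu F e)%E.
Proof. by apply: integral_ge0 => p _; rewrite lee_fin sqr_ge0. Qed.

Lemma holomorphicD F G : holomorphic F -> holomorphic G -> holomorphic (F + G).
Proof. by move=> hF hG z z0; rewrite ext0D; apply: derivableD; auto. Qed.

Lemma holomorphicZ (a : R[i]) F : holomorphic F -> holomorphic (a *: F).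
Proof. by move=> hF z z0; rewrite ext0Z; apply: derivableZ; auto. Qed.

Lemma zen_integralD nu F G e t : holomorphic F -> holomorphic G -> 0 < e ->
  0 < t -> (zen_integral nu (F + G)%R e <=
    (1 + t)%R%:E * zen_integral nu F e + (1 + t^-1)%R%:E * zen_integral nu G e)%E.
Proof.
move=> hF hG e0 t0.
have t0' : 0 < t^-1 by rewrite invr_gt0.
have mH := measurable_half_space.
have mF := measurable_half_plane_sqr hF e0.
have mG := measurable_half_plane_sqr hG e0.
have mFG := measurable_half_plane_sqr (holomorphicD hF hG) e0.
have sq0 H p : (0 <= (half_plane_normc H e p ^+ 2)%:E)%E.
  by rewrite lee_fin sqr_ge0.
have c1 : 0 <= 1 + t by rewrite addr_ge0 ?ltW.
have c2 : 0 <= 1 + t^-1 by rewrite addr_ge0 ?ltW.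
rewrite -(ge0_integralZl_EFin _ _ _ mF c1)// -(ge0_integralZl_EFin _ _ _ mG c2)//.
rewrite -ge0_integralD//=; first last.
- by apply: measurable_funeM.
- by move=> p _; rewrite mule_ge0// lee_fin.
- by apply: measurable_funeM.
- by move=> p _; rewrite mule_ge0// lee_fin.
apply: ge0_le_integral => //.
- by move=> p _; exact: (sq0 (F + G)).
- by apply: emeasurable_funD; apply: measurable_funeM.
move=> p _; rewrite -!EFinM -EFinD lee_fin.
have := half_plane_normcD F G e p.
have := half_plane_normc_ge0 (F + G) e p.
rewrite -/(half_plane_normc _ _ _).
have x0 := half_plane_normc_ge0 F e p.
have y0 := half_plane_normc_ge0 G e p.
move: (half_plane_normc F e p) (half_plane_normc G e p) x0 y0 => x y x0 y0.
move=> w0 wxy; apply: (@le_trans _ _ ((x + y) ^+ 2)).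
  by rewrite lerXn2r// nnegrE addr_ge0.
rewrite -subr_ge0 (_ : _ - _ = t^-1 * (t * x - y) ^+ 2).
  by rewrite mulr_ge0 ?sqr_ge0 ?ltW.
by field; rewrite gt_eqF.
Qed.

Lemma zen_integralZ nu (a : R[i]) F e : holomorphic F -> 0 < e ->
  zen_integral nu (a *: F) e = ((normc a ^+ 2)%R%:E * zen_integral nu F e)%E.
Proof.
move=> hF e0; rewrite -ge0_integralZl_EFin//; last 4 first.
- exact: measurable_half_space.
- by move=> p _; rewrite lee_fin sqr_ge0.
- exact: measurable_half_plane_sqr.
- exact: sqr_ge0.
apply: eq_integral => p _.
by rewrite -/(half_plane_normc _ _ _) half_plane_normcZ exprMn EFinM.
Qed.

Lemma zen_integral_le nu F e : 0 < e -> (zen_integral nu F e <= zen_sqnorm nu F)%E.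
Proof. by move=> e0; apply: ereal_sup_ubound; exists e. Qed.

Lemma zen_sqnorm_ge0 nu F : (0 <= zen_sqnorm nu F)%E.
Proof. by rewrite (le_trans (zen_integral_ge0 nu F 1))// zen_integral_le. Qed.

Lemma zen_sqnormD nu F G t : holomorphic F -> holomorphic G -> 0 < t ->
  (zen_sqnorm nu (F + G)%R <=
    (1 + t)%R%:E * zen_sqnorm nu F + (1 + t^-1)%R%:E * zen_sqnorm nu G)%E.
Proof.
move=> hF hG t0; apply: ge_ereal_sup => _ [e e0 <-].
have t0' : 0 < t^-1 by rewrite invr_gt0.
apply: (le_trans (zen_integralD _ hF hG e0 t0)).
by apply: leeD; apply: lee_wpmul2l; rewrite ?lee_fin ?zen_integral_le//; lra.
Qed.

Lemma zen_sqnormZ_le nu (a : R[i]) F : holomorphic F ->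
  (zen_sqnorm nu (a *: F)%R <= (normc a ^+ 2)%R%:E * zen_sqnorm nu F)%E.
Proof.
move=> hF; apply: ge_ereal_sup => _ [e e0 <-].
rewrite zen_integralZ//; apply: lee_wpmul2l; last exact: zen_integral_le.
by rewrite lee_fin sqr_ge0.
Qed.

Lemma zen_predP nu F : reflect (holomorphic F /\ (zen_sqnorm nu F < +oo)%E)
  (F \in zen_pred nu).
Proof. exact: asboolP. Qed.

Lemma zen_submod_closed nu : submod_closed (zen_pred nu).
Proof.
split.
  apply/zen_predP.
  have e0 : ext0 (0 : Cplus R -> C) = cst 0.
    by apply/funext => z; rewrite /ext0; case: insubP.
  split; first by move=> z _; rewrite e0; exact: derivable_cst.
  apply: (@le_lt_trans _ _ 0%E); last exact: ltry.
  apply: ge_ereal_sup => _ [e _ <-].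
  rewrite /zen_integral integral0_eq// => p _.
  by rewrite e0 ComplexField.Normc.normc0 expr0n.
move=> a F G /zen_predP[hF fF] /zen_predP[hG fG]; apply/zen_predP.
have haF : holomorphic (a *: F) by exact: holomorphicZ.
split; first exact: holomorphicD.
apply: (le_lt_trans (zen_sqnormD nu haF hG (@ltr01 R))).
have faF : (zen_sqnorm nu (a *: F)%R < +oo)%E.
  apply: (le_lt_trans (zen_sqnormZ_le _ _ hF)).
  by apply: lte_mul_pinfty => //; rewrite lee_fin sqr_ge0.
by apply: lte_add_pinfty; apply: lte_mul_pinfty => //; rewrite lee_fin ?invr1 addr_ge0.
Qed.

HB.instance Definition _ nu := GRing.isSubmodClosed.Build R[i]
  (Cplus R -> C) (zen_pred nu) (zen_submod_closed nu).

HB.instance Definition _ nu := [isSub for @zen_fun R nu].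
HB.instance Definition _ nu := [Choice of zenSpace nu by <:].
HB.instance Definition _ nu := [SubChoice_isSubLmodule of zenSpace nu by <:].

Section zen_norm.
Variable nu : zenMeasure R.
Implicit Types f g : zenSpace nu.

(* Norms take their values in the scalar field, hence the cast to R[i]. *)
Definition zen_norm f : R[i] := (Num.sqrt (fine (zen_sqnorm nu f)))%:C.

Lemma zen_holo f : holomorphic f.
Proof. by have /zen_predP[] := zen_funP f. Qed.
Arguments zen_holo : clear implicits.

Lemma zen_sqnorm_fin f : zen_sqnorm nu f \is a fin_num.
Proof.
by rewrite ge0_fin_numE ?zen_sqnorm_ge0//; have /zen_predP[] := zen_funP f.
Qed.

Lemma fine_zen_sqnorm_ge0 f : 0 <= fine (zen_sqnorm nu f).
Proof. by rewrite fine_ge0// zen_sqnorm_ge0. Qed.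

Lemma zen_norm_eq0 f : zen_norm f = 0 -> f = 0.
Proof.
move=> /complexI/eqP; rewrite sqrtr_eq0 => f0.
apply/val_inj/funext => u; apply/eqP; apply: contraT => fu.
have c0 : 0 < normc (f u).
  by rewrite lt_neqAle normc_ge0 andbT eq_sym; apply: contra_neq fu;
     exact: ComplexField.Normc.eq0_normc.
set c := normc (f u) in c0; pose y := complex.Im (val u).
pose r := complex.Re (val u); have r0 : 0 < r by exact: valP u.
have uE : val u = (0 + r) +i* y by rewrite add0r /r /y; case: (val u).
have [||d d0 hd] := @half_plane_normc_near f r (0, y) (c / 2) (zen_holo f).
- by rewrite add0r.
- by rewrite /half_plane_normc -uE ext0E ltr_pdivrMr// ltr_pMr// ltr1n.
pose B : set (measurableTypeR R * measurableTypeR R) :=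
  `[0%R, d[%classic `*` `]y - d, y + d[%classic.
have mB : measurable B by apply: measurableX; exact: measurable_itv.
have BH : B `<=` half_space.
  by move=> p [/=]; rewrite !in_itv/= => /andP[-> _] _.
have : (((c / 2) ^+ 2)%:E * (nu \x lebesgue_measure)%E B <= 0)%E.
  apply: (@le_trans _ _ (zen_integral nu f r)); last first.
    apply: (le_trans (zen_integral_le _ _ r0)).
    by rewrite -(fineK (zen_sqnorm_fin f)) lee_fin.
  apply: (@le_trans _ _ (\int[nu \x lebesgue_measure]_(p in B)
      (half_plane_normc f r p ^+ 2)%:E)%E); last first.
    apply: ge0_subset_integral => //; first exact: measurable_half_space.
    - by apply: measurable_half_plane_sqr => //; exact: zen_holo.
    - by move=> p _; rewrite lee_fin sqr_ge0.
  rewrite -integral_cst//; apply: ge0_le_integral => //.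
  - by move=> p _; rewrite lee_fin sqr_ge0.
  - apply: measurable_funS (measurable_half_plane_sqr _ r0) => //.
      exact: measurable_half_space.
    exact: zen_holo.
  move=> p [/=]; rewrite !in_itv/= => /andP[p1 p2] p3; rewrite lee_fin.
  rewrite lerXn2r ?nnegrE ?half_plane_normc_ge0 ?divr_ge0 ?normc_ge0//.
  have q1 : `|p.1 - 0| < d by rewrite subr0 ger0_norm.
  have q2 : `|p.2 - y| < d by move: p3; rewrite ltr_distl.
  by have [_ /ltW] := hd p q1 q2.
rewrite leNgt => /negP; case; rewrite mule_gt0// ?lte_fin ?exprn_gt0 ?divr_gt0//.
rewrite product_measure1E//.
rewrite mule_gt0//; first by have [+ _] := zen_doubling nu; exact.
have : (0 < lebesgue_measure [set` `]y - d, y + d[%R])%E.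
  rewrite lebesgue_measure_itv/= lte_fin.
  by case: ifPn => [_|]; rewrite -?EFinD ?lte_fin; lra.
by [].
Qed.

Lemma zen_normZ (a : R[i]) f : zen_norm (a *: f) = `|a| * zen_norm f.
Proof.
rewrite normcE -rmorphM /zen_norm; congr (_%:C).
rewrite -[X in X * _]ger0_norm ?normc_ge0// -sqrtr_sqr -sqrtrM ?sqr_ge0//.
congr Num.sqrt; apply/EFin_inj; rewrite EFinM !fineK ?zen_sqnorm_fin//.
apply/le_anti/andP; split; first exact: zen_sqnormZ_le (zen_holo f).
have [->|a0] := eqVneq a 0.
  by rewrite ComplexField.Normc.normc0 expr0n mul0e zen_sqnorm_ge0.
have na0 : 0 < normc a by rewrite -ltcR -normcE normr_gt0.
have := zen_sqnormZ_le nu a^-1 (zen_holo (a *: f)).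
rewrite [(a^-1 *: _)%R](_ : _ = f :> (_ -> _)); last first.
  by rewrite -[RHS]scale1r -(mulVf a0) -scalerA.
rewrite ComplexField.Normc.normcV exprVn => h.
by rewrite muleC -lee_pdivlMr ?exprn_gt0// muleC.
Qed.

Lemma zen_normD f g : zen_norm (f + g) <= zen_norm f + zen_norm g.
Proof.
have [/zen_norm_eq0 ->|f0] := eqVneq (zen_norm f) 0.
  by rewrite add0r lerDr ler0c sqrtr_ge0.
have [/zen_norm_eq0 ->|g0] := eqVneq (zen_norm g) 0.
  by rewrite addr0 lerDl ler0c sqrtr_ge0.
rewrite /zen_norm -rmorphD lecR.
have af0 : 0 < Num.sqrt (fine (zen_sqnorm nu f)).
  by rewrite lt_neqAle sqrtr_ge0 andbT eq_sym; apply: contra_neq f0 => h;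
     rewrite /zen_norm h.
have ag0 : 0 < Num.sqrt (fine (zen_sqnorm nu g)).
  by rewrite lt_neqAle sqrtr_ge0 andbT eq_sym; apply: contra_neq g0 => h;
     rewrite /zen_norm h.
have := zen_sqnormD nu (zen_holo f) (zen_holo g) (divr_gt0 ag0 af0).
rewrite -(fineK (zen_sqnorm_fin f)) -(fineK (zen_sqnorm_fin g)).
rewrite -[X in (X <= _)%E](fineK (zen_sqnorm_fin (f + g))) -!EFinM -EFinD lee_fin.
move: (sqr_sqrtr (fine_zen_sqnorm_ge0 f)) (sqr_sqrtr (fine_zen_sqnorm_ge0 g)).
move: (sqr_sqrtr (fine_zen_sqnorm_ge0 (f + g))).
have w0 := sqrtr_ge0 (fine (zen_sqnorm nu (f + g))).
move: (Num.sqrt (fine (zen_sqnorm nu f))) (Num.sqrt (fine (zen_sqnorm nu g)))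
  (Num.sqrt (fine (zen_sqnorm nu (f + g)))) af0 ag0 w0 => x z w x0 z0 w0.
move=> <- <- <- h.
have xz0 : 0 <= x + z by apply: addr_ge0; exact: ltW.
rewrite -(@ler_pXn2r _ 2)// ?nnegrE//.
rewrite (le_trans h)// le_eqVlt; apply/orP; left; apply/eqP.
by field; rewrite (gt_eqF x0) (gt_eqF z0).
Qed.

End zen_norm.

HB.instance Definition _ nu := Lmodule_isNormed.Build R[i] (zenSpace nu)
  (@zen_normD nu) (@zen_normZ nu) (@zen_norm_eq0 nu).

Lemma zen_normE nu (f : zenSpace nu) :
  `|f| = (Num.sqrt (fine (zen_sqnorm nu f)))%:C.
Proof. by []. Qed.

Section composition.
Variables (nu : zenMeasure R) (phi : Cplus R -> Cplus R).
Hypothesis phi_zen : forall F, F \in zen_pred nu -> F \o phi \in zen_pred nu.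

Definition comp_op (f : zenSpace nu) : zenSpace nu :=
  ZenSpace (phi_zen (zen_funP f)).

Lemma comp_op_linear : linear comp_op.
Proof. by move=> a f g; apply/val_inj/funext => u. Qed.

HB.instance Definition _ :=
  GRing.isLinear.Build R[i] (zenSpace nu) (zenSpace nu) _ comp_op comp_op_linear.

End composition.

Section translation.
Variable s0 : R[i].
Hypothesis Re_s0 : 0 <= complex.Re s0.

Lemma Re_addC (z w : R[i]) :
  complex.Re (z + w) = complex.Re z + complex.Re w.
Proof. by case: z w => [a b] [c d]. Qed.

Lemma translate_subproof (u : Cplus R) : 0 < complex.Re (val u + s0).
Proof. by rewrite Re_addC ltr_pwDl// (valP u). Qed.

Definition translate (u : Cplus R) : Cplus R :=
  exist _ (val u + s0) (translate_subproof u).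

Lemma ext0_translate F (z : C) : 0 < complex.Re z ->
  ext0 (F \o translate) z = ext0 F (z + s0).
Proof.
move=> z0; have -> : z = val (exist _ z z0 : Cplus R) by [].
by rewrite ext0E /= -ext0E.
Qed.

Lemma holomorphic_translate F : holomorphic F -> holomorphic (F \o translate).
Proof.
move=> hF z z0.
have zs0 : 0 < complex.Re (z + s0) by rewrite Re_addC ltr_pwDl.
apply: (@near_eq_derivable _ _ _ (fun w : C => ext0 F (w + s0))).
  have z0C : (0 : R[i]) < (complex.Re z)%:C by rewrite ltcR.
  apply/nbhs_ballP; exists ((complex.Re z)%:C) => //= w.
  rewrite -ball_normE /= => zw; apply/esym/ext0_translate.
  have := le_lt_trans (normc_ge_Re _) zw; rewrite ltcR.
  rewrite Re_addC (_ : complex.Re (- w) = - complex.Re w); last by case: (w).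
  by rewrite ltr_distlC; lra.
have := hF _ zs0; rewrite /derivable.
rewrite (_ : (fun _ => _) = (fun h : R[i] => h^-1 *:
  (((fun w : C => ext0 F (w + s0)) \o shift z) (h *: (1 : C)) -
   ext0 F (z + s0))))//.
by apply/funext => h /=; rewrite addrA.
Qed.

Lemma lebesgue_measure_translate (b : R) (A : set (measurableTypeR R)) :
  measurable A -> lebesgue_measure ((fun y => y + b) @^-1` A) = lebesgue_measure A.
Proof.
move=> mA.
have mb : measurable_fun setT (fun y : measurableTypeR R => y + b : measurableTypeR R).
  exact: measurable_funD.
rewrite -/(pushforward lebesgue_measure (fun y : measurableTypeR R => y + b : measurableTypeR R) A).
apply/esym/lebesgue_measure_unique => //=.
move=> _ [[x y] _ <-] /=; rewrite /pushforward.
have -> : (fun z => z + b) @^-1` `]x, y]%classic = `]x - b, y - b]%classic.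
  apply/seteqP; split => z /=; rewrite !in_itv /= => /andP[? ?];
    by apply/andP; split; lra.
rewrite !lebesgue_measure_itv /= !lte_fin ltrD2r.
by case: ifP => // _; rewrite -!EFinD; congr EFin; lra.
Qed.

Lemma zen_integral_translate nu F e : holomorphic F -> 0 < e ->
  zen_integral nu (F \o translate) e = zen_integral nu F (e + complex.Re s0).
Proof.
move=> hF e0; have e'0 : 0 < e + complex.Re s0 by rewrite ltr_pwDl.
pose b := complex.Im s0.
pose psi (p : measurableTypeR R * measurableTypeR R) :
  measurableTypeR R * measurableTypeR R := (p.1, p.2 + b).
have mpsi : measurable_fun setT psi.
  by apply/measurable_fun_pair => //=; apply: measurable_funD.
transitivity (\int[nu \x lebesgue_measure]_(p in psi @^-1` half_space)
    ((fun p => (half_plane_normc F (e + complex.Re s0) p ^+ 2)%:E) \o psi) p)%E.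
  have -> : psi @^-1` half_space = half_space by [].
  apply: eq_integral => p; rewrite inE /= => -[]; rewrite in_itv /= andbT => p0 _.
  rewrite ext0_translate /=; last lra.
  rewrite /half_plane_normc /psi /= /b; congr ((normc (ext0 F _) ^+ 2)%:E).
  by case: (s0) => x y /=; apply/eqP; rewrite eq_complex /= addrA !eqxx.
have g0 : {in half_space, forall p,
    (0 <= (half_plane_normc F (e + complex.Re s0) p ^+ 2)%:E)%E}.
  by move=> p _; rewrite lee_fin sqr_ge0.
have := ge0_integral_pushforward mpsi (nu \x lebesgue_measure)%E
  measurable_half_space (measurable_half_plane_sqr hF e'0) g0.
move=> <-.
apply: eq_measure_integral => A mA _.
rewrite /pushforward /= /product_measure1; apply: eq_integral => x _ /=.
rewrite -[RHS](lebesgue_measure_translate b); last exact: measurable_xsection.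
by congr lebesgue_measure; apply/seteqP; split => y;
  rewrite /xsection /= !inE.
Qed.

Lemma zen_sqnorm_translate nu F : holomorphic F ->
  (zen_sqnorm nu (F \o translate) <= zen_sqnorm nu F)%E.
Proof.
move=> hF; apply: ge_ereal_sup => _ [e e0 <-].
by rewrite zen_integral_translate// zen_integral_le// ltr_pwDl.
Qed.

Lemma translate_zen nu F : F \in zen_pred nu -> F \o translate \in zen_pred nu.
Proof.
move=> /zen_predP[hF fF]; apply/zen_predP; split.
  exact: holomorphic_translate.
exact: le_lt_trans (zen_sqnorm_translate nu hF) fF.
Qed.

Definition comp_translate nu : zenSpace nu -> zenSpace nu :=
  comp_op (@translate_zen nu).
HB.instance Definition _ nu := GRing.Linear.on (@comp_translate nu).

Lemma comp_translate_norm nu (f : zenSpace nu) :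
  `|comp_translate f| <= `|f|.
Proof.
rewrite lecR ler_wsqrtr//; apply: fine_le; rewrite ?zen_sqnorm_fin//.
by apply: zen_sqnorm_translate; exact: zen_holo.
Qed.

Lemma comp_translate_continuous nu : continuous (@comp_translate nu).
Proof.
apply: bounded_linear_continuous; apply/linear_boundedP.
near=> r => f; rewrite (le_trans (comp_translate_norm f))//.
by rewrite ler_peMl.
Unshelve. all: by end_near. Qed.

End translation.

End zen_theory.

(* Main.v *)
Require Import Defs.
From HB Require Import structures.
From mathcomp Require Import all_boot all_order all_algebra complex.
From mathcomp Require Import all_classical all_reals all_analysis.
From mathcomp Require Import measurable_realfun ring lra.

Set Implicit Arguments.
Unset Strict Implicit.
Unset Printing Implicit Defensive.

Import Order.TTheory GRing.Theory Num.Theory.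
Import numFieldNormedType.Exports.

Local Open Scope classical_set_scope.
Local Open Scope complex_scope.
Local Open Scope ring_scope.

(** Write T for the translation f |-> f (. + s0) on the Zen space and A for the set in
    the statement. An invertible operator is Fredholm, so it suffices to invert T - l
    for l outside A and to show that T - l is not Fredholm for l in A.

    Outside A the inverses are built from operators f |-> int k(y) f(. + u(y)) dmu(y)
    with k integrable and Re u >= 0. These are bounded on the Zen space ([conv_op]):
    translations along vertical lines preserve square norms and translations to the
    right stay below the supremum defining the norm. That such integrals are
    holomorphic needs a locally uniform bound for Zen functions ([zen_bounded]) and a
    uniform Taylor remainder ([taylor2_uniform]), both from the Cauchy formula on
    rectangles. If |l| > 1, or |l| < 1 and T is invertible because Re s0 = 0, the
    inverse is a geometric series ([spectrum_le1], [spectrum_ge1]). If Re s0 > 0,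
    choose tau with e^(- s0 tau) = l and integrate f against the kernel
    e^(tau zeta) / (1 - e^(- 2 pi i zeta / s0)) over a vertical line. Translation by
    s0 multiplies the kernel by 1 / l, and moving the line by s0 crosses exactly one
    pole; hence the resulting operator S satisfies T S - l S = K T with K <> 0
    ([mb_op_equation]), and (S / K - 1) / l inverts T - l. The kernel decays in both
    directions when Im tau lies in an open interval whose length is the imaginary
    period of the solutions tau, and such a tau exists exactly because l is not on the
    spiral ([mb_parameter]).

    On A the range of T - l does not have finite codimension. Otherwise every sequence
    of Zen functions would have a nontrivial finite combination in the range
    ([finite_codim_dependent]), which is contradicted as follows.
    For l = 0 take the functions (s + a)^(- k - j) with 0 < a < Re s0: a function F with
    F (s + s0) equal to a combination of them would have a pole at s0 - a, by the
    identity theorem ([zero_not_finite_codim]).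
    For l = e^(- s0 t0) take e^(- t0 s) (s + 1)^(- g). By doubling these are Zen
    functions for large g, and they are not for g = 0, so there is a threshold. If
    T F - l F = G then averaging e^(t0 s) F along the segment from s to s + s0 gives
    e^(t0 s) H with H again a Zen function and with derivative proportional to
    e^(t0 s) G ([integrated_equation]). A combination of powers with exponents g just
    above the threshold thus integrates to powers with exponents g - 1 below it, whose
    dominant term would still be a Zen function ([spiral_not_finite_codim]).

    For Re s0 = 0 the spiral is the unit circle, wound around infinitely often
    ([circle_on_ray]). *)

Local Notation normc := ComplexField.Normc.normc.
Local Notation Re := complex.Re.
Local Notation Im := complex.Im.

(** * Complex numbers and complex differentiability *)

Section complex_basics.
Context {R : realType}.
Implicit Types (z w : R[i]) (x y e : R).

Lemma ReD z w : Re (z + w) = Re z + Re w.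
Proof. by case: z w => [? ?] [? ?]. Qed.

Lemma ImD z w : Im (z + w) = Im z + Im w.
Proof. by case: z w => [? ?] [? ?]. Qed.

Lemma ReN z : Re (- z) = - Re z.
Proof. by case: z. Qed.

Lemma ImN z : Im (- z) = - Im z.
Proof. by case: z. Qed.

Lemma ReM z w : Re (z * w) = Re z * Re w - Im z * Im w.
Proof. by case: z w => [? ?] [? ?]. Qed.

Lemma ImM z w : Im (z * w) = Re z * Im w + Im z * Re w.
Proof. by case: z w => [? ?] [? ?]. Qed.

Lemma eq_complexP z w : Re z = Re w -> Im z = Im w -> z = w.
Proof. by case: z w => [? ?] [? ?] /= -> ->. Qed.

Lemma complex_eta z : Re z +i* Im z = z.
Proof. by case: z. Qed.

Lemma normc_Re z : `|Re z| <= normc z.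
Proof. by have := normc_ge_Re z; rewrite lecR. Qed.

Lemma normcN z : normc (- z) = normc z.
Proof. by rewrite -[in RHS](subr0 z) normcB sub0r. Qed.

Lemma normc_Im z : `|Im z| <= normc z.
Proof.
have := normc_Re ('i%C * z); rewrite ReM /= mul0r mul1r sub0r normrN.
rewrite ComplexField.Normc.normcM (_ : normc 'i%C = 1) ?mul1r//=.
by rewrite expr0n expr1n add0r sqrtr1.
Qed.

Lemma normc_real x : normc x%:C = `|x|.
Proof. by rewrite /= expr0n addr0 sqrtr_sqr. Qed.

Lemma normc_imag x : normc (0 +i* x) = `|x|.
Proof. by rewrite /= expr0n add0r sqrtr_sqr. Qed.

Lemma normcM z w : normc (z * w) = normc z * normc w.
Proof. exact: ComplexField.Normc.normcM. Qed.

Lemma normcV z : normc z^-1 = (normc z)^-1.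
Proof. exact: ComplexField.Normc.normcV. Qed.

Lemma normcX z n : normc (z ^+ n) = normc z ^+ n.
Proof.
elim: n => [|n ih]; first by rewrite !expr0 ComplexField.Normc.normc1.
by rewrite !exprS normcM ih.
Qed.

Lemma normc_eq0 z : (normc z == 0) = (z == 0).
Proof.
apply/eqP/eqP => [/ComplexField.Normc.eq0_normc//|->].
exact: ComplexField.Normc.normc0.
Qed.

Lemma normc_gt0 z : (0 < normc z) = (z != 0).
Proof. by rewrite lt_neqAle normc_ge0 andbT eq_sym normc_eq0. Qed.

Lemma normc_sqr z : normc z ^+ 2 = Re z ^+ 2 + Im z ^+ 2.
Proof. by case: z => a b /=; rewrite sqr_sqrtr// addr_ge0// sqr_ge0. Qed.

Lemma normcBD z w : normc z <= normc (z - w) + normc w.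
Proof. by have := normcD (z - w) w; rewrite subrK. Qed.

Lemma lerB_normc z w : normc z - normc w <= normc (z - w).
Proof. by rewrite lerBlDr normcBD. Qed.

Lemma normc_sum (I : Type) (r : seq I) (P : pred I) (f : I -> R[i]) :
  normc (\sum_(i <- r | P i) f i) <= \sum_(i <- r | P i) normc (f i).
Proof.
elim/big_ind2 : _ => //; first by rewrite ComplexField.Normc.normc0.
by move=> a b c d h1 h2; rewrite (le_trans (normcD _ _))// lerD.
Qed.

End complex_basics.

Section cderiv.
Context {R : realType}.
Implicit Types (f g r : R[i] -> R[i]) (z w D : R[i]).

Definition little_o z r := forall e : R, 0 < e ->
  exists2 d : R, 0 < d & forall w, normc (w - z) < d -> normc (r w) <= e * normc (w - z).

Definition lipschitz_at z r := exists2 M : R, 0 < M &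
  exists2 d : R, 0 < d & forall w, normc (w - z) < d -> normc (r w) <= M * normc (w - z).

(** A Frechet derivative with real tolerances and without division, so that the
    rules below are triangle inequalities; it exists exactly when the function is
    derivable in the direction 1. *)
Definition cderiv f z D := little_o z (fun w => f w - f z - D * (w - z)).

Definition ccont f z := forall e : R, 0 < e ->
  exists2 d : R, 0 < d & forall w, normc (w - z) < d -> normc (f w - f z) < e.

Lemma little_oD z r s : little_o z r -> little_o z s ->
  little_o z (fun w => r w + s w).
Proof.
move=> hr hs e e0; have e20 : 0 < e / 2 by rewrite divr_gt0.
have [d1 d10 h1] := hr _ e20; have [d2 d20 h2] := hs _ e20.
exists (Num.min d1 d2); first by rewrite lt_min d10.
move=> w; rewrite lt_min => /andP[/h1 a /h2 b].
by rewrite (le_trans (normcD _ _))// (le_trans (lerD a b))// -mulrDl -splitr.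
Qed.

Lemma little_oZ z r (a : R[i]) : little_o z r -> little_o z (fun w => a * r w).
Proof.
move=> hr e e0; have a1 : 0 < normc a + 1 by rewrite ltr_wpDl ?normc_ge0.
have [d d0 h] := hr (e / (normc a + 1)) (divr_gt0 e0 a1).
exists d => // w /h {}h; rewrite normcM.
apply: (@le_trans _ _ ((normc a + 1) * normc (r w))).
  by rewrite ler_wpM2r ?normc_ge0// lerDl.
by rewrite (le_trans (ler_wpM2l (ltW a1) h))// mulrA [_ * (e / _)]mulrC divfK ?gt_eqF.
Qed.

Lemma little_o_lip z r s : lipschitz_at z r -> lipschitz_at z s ->
  little_o z (fun w => r w * s w).
Proof.
move=> [M M0 [d d0 hr]] [N N0 [d' d'0 hs]] e e0.
exists (Num.min (Num.min d d') (e / (M * N))).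
  by rewrite !lt_min d0 d'0 divr_gt0// mulr_gt0.
move=> w; rewrite !lt_min => /andP[/andP[/hr a /hs b]] c.
rewrite normcM (le_trans (ler_pM (normc_ge0 _) (normc_ge0 _) a b))//.
rewrite mulrACA mulrA ler_wpM2r ?normc_ge0//.
by move: c; rewrite ltr_pdivlMr ?mulr_gt0// => /ltW; rewrite mulrC.
Qed.

Lemma little_o_near z r s d : 0 < d ->
  (forall w, normc (w - z) < d -> r w = s w) -> little_o z r -> little_o z s.
Proof.
move=> d0 rs hr e /hr[d' d'0 h]; exists (Num.min d d').
  by rewrite lt_min d0.
by move=> w; rewrite lt_min => /andP[/rs <- /h].
Qed.

Lemma eq_little_o z r s : r =1 s -> little_o z r -> little_o z s.
Proof. by move=> rs; apply: (@little_o_near _ _ _ 1) => // w _; rewrite rs. Qed.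

Lemma cderiv_lip f z D : cderiv f z D -> lipschitz_at z (fun w => f w - f z).
Proof.
move=> /(_ 1 ltr01)[d d0 h]; exists (1 + normc D).
  by rewrite ltr_pwDl// normc_ge0.
exists d => // w /h {}h; rewrite mulrDl.
by rewrite (le_trans (normcBD _ (D * (w - z))))// lerD// normcM.
Qed.

Lemma cderiv_ccont f z D : cderiv f z D -> ccont f z.
Proof.
move=> /cderiv_lip[M M0 [d d0 h]] e e0.
exists (Num.min d (e / M)); first by rewrite lt_min d0 divr_gt0.
move=> w; rewrite lt_min => /andP[/h a b]; apply: (le_lt_trans a).
by rewrite mulrC -ltr_pdivlMr.
Qed.

Lemma eq_cderiv_near f g z D d : 0 < d ->
  (forall w, normc (w - z) < d -> f w = g w) -> cderiv f z D -> cderiv g z D.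
Proof.
move=> d0 fg; apply: (little_o_near d0) => w wz; rewrite !fg//.
by rewrite subrr ComplexField.Normc.normc0.
Qed.

Lemma eq_cderiv f g z D : f =1 g -> cderiv f z D -> cderiv g z D.
Proof. by move=> fg; apply: (@eq_cderiv_near _ _ _ _ 1) => // w _; rewrite fg. Qed.

Lemma cderiv_cst (a : R[i]) z : cderiv (fun=> a) z 0.
Proof.
move=> e e0; exists 1 => // w _; rewrite subrr mul0r subrr.
by rewrite ComplexField.Normc.normc0 mulr_ge0 ?normc_ge0// ltW.
Qed.

Lemma cderiv_id z : cderiv id z 1.
Proof.
move=> e e0; exists 1 => // w _; rewrite mul1r subrr.
by rewrite ComplexField.Normc.normc0 mulr_ge0 ?normc_ge0// ltW.
Qed.

Lemma cderivD f g z D D' : cderiv f z D -> cderiv g z D' ->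
  cderiv (fun w => f w + g w) z (D + D').
Proof.
move=> hf hg; apply: (eq_little_o _ (little_oD hf hg)) => w /=.
by ring.
Qed.

Lemma cderivM f g z D D' : cderiv f z D -> cderiv g z D' ->
  cderiv (fun w => f w * g w) z (D * g z + f z * D').
Proof.
move=> hf hg.
have h1 := little_o_lip (cderiv_lip hf) (cderiv_lip hg).
have h2 := little_oD (little_oZ (g z) hf) (little_oZ (f z) hg).
by apply: (eq_little_o _ (little_oD h1 h2)) => w /=; ring.
Qed.

Lemma cderivZ (a : R[i]) f z D : cderiv f z D -> cderiv (fun w => a * f w) z (a * D).
Proof.
by move=> /(cderivM (cderiv_cst a z)); rewrite mul0r add0r.
Qed.

Lemma cderivB f g z D D' : cderiv f z D -> cderiv g z D' ->
  cderiv (fun w => f w - g w) z (D - D').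
Proof.
move=> hf /(cderivZ (-1)) hg; have := cderivD hf hg.
by rewrite mulN1r; apply: eq_cderiv => w; rewrite mulN1r.
Qed.

Lemma cderivX f n z D : cderiv f z D ->
  exists D', cderiv (fun w => f w ^+ n) z D'.
Proof.
move=> hf; elim: n => [|n [D' h]].
  by exists 0; apply: (eq_cderiv _ (cderiv_cst 1 z)) => w; rewrite expr0.
exists (D * f z ^+ n + f z * D').
by apply: (eq_cderiv _ (cderivM hf h)) => w; rewrite exprS.
Qed.

Lemma cderiv_sum (I : Type) (s : seq I) (f : I -> R[i] -> R[i]) (D : I -> R[i]) z :
  (forall i, cderiv (f i) z (D i)) ->
  cderiv (fun w => \sum_(i <- s) f i w) z (\sum_(i <- s) D i).
Proof.
move=> h; elim: s => [|i s ih].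
  by rewrite big_nil; apply: (eq_cderiv _ (cderiv_cst 0 z)) => w; rewrite big_nil.
rewrite big_cons; apply: (eq_cderiv _ (cderivD (h i) ih)) => w.
by rewrite big_cons.
Qed.

Lemma cderiv_comp f g z D D' : cderiv f (g z) D -> cderiv g z D' ->
  cderiv (fun w => f (g w)) z (D * D').
Proof.
move=> hf hg.
suff h : little_o z (fun w => f (g w) - f (g z) - D * (g w - g z)).
  by apply: (eq_little_o _ (little_oD h (little_oZ D hg))) => w /=; ring.
have [M M0 [d d0 hM]] := cderiv_lip hg.
move=> e e0; have [d' d'0 h] := hf (e / M) (divr_gt0 e0 M0).
exists (Num.min d (d' / M)); first by rewrite lt_min d0 divr_gt0.
move=> w; rewrite lt_min => /andP[/hM a b].
have : normc (g w - g z) < d'.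
  by rewrite (le_lt_trans a)// mulrC -ltr_pdivlMr.
move=> /h {}h; apply: (le_trans h).
have -> : e * normc (w - z) = e / M * (M * normc (w - z)).
  by rewrite mulrA divfK// gt_eqF.
by apply: ler_wpM2l => //; rewrite divr_ge0 ?ltW.
Qed.

Lemma cderiv_inv z : z != 0 -> cderiv (fun w => w^-1) z (- (z ^+ 2)^-1).
Proof.
move=> z0; have nz : 0 < normc z by rewrite normc_gt0.
move=> e e0.
exists (Num.min (normc z / 2) (e * normc z ^+ 3 / 2)).
  by rewrite lt_min !divr_gt0// mulr_gt0// exprn_gt0.
move=> w; rewrite lt_min => /andP[a b].
have nw : normc z / 2 < normc w.
  by have := lerB_normc z (z - w); rewrite subKr normcB; lra.
have w0 : w != 0 by rewrite -normc_gt0 (lt_trans _ nw)// divr_gt0.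
rewrite (_ : w^-1 - _ - _ = (w - z) * (w - z) * (w^-1 * (z^-1) ^+ 2)); last first.
  by field; rewrite z0 w0.
rewrite !expr2 !normcM !normcV.
move: (normc (w - z)) (normc_ge0 (w - z)) (normc w) (normc z) a b nw nz => a a0 b c ac ae bc c0.
have b0 : 0 < b by lra.
have -> : a * a * (b^-1 * (c^-1 * c^-1)) = a * (a / (b * c ^+ 2)).
  by field; rewrite !gt_eqF.
rewrite [leRHS]mulrC ler_wpM2l// ler_pdivrMr ?mulr_gt0 ?exprn_gt0//.
have : e * c ^+ 2 * (c / 2) <= e * c ^+ 2 * b.
  by apply: ler_wpM2l; [rewrite mulr_ge0 ?sqr_ge0 ?ltW|exact: ltW].
by rewrite exprSr in ae; lra.
Qed.

Lemma cderivV f z D : f z != 0 -> cderiv f z D ->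
  cderiv (fun w => (f w)^-1) z (- (f z ^+ 2)^-1 * D).
Proof. by move=> fz hf; exact: cderiv_comp (cderiv_inv fz) hf. Qed.

Lemma derivable_cderiv (f : R[i]^o -> R[i]^o) (z : R[i]^o) :
  derivable f z 1 -> exists D, cderiv f z D.
Proof.
move=> /cvg_ex[/= D /cvgrPdist_le h]; exists D => e e0.
have e0C : (0 : R[i]) < e%:C by rewrite ltcR.
have := h _ e0C; rewrite /dnbhs /= => /nbhs_ballP[d /= d0 hd].
have [er dE] : exists t : R, d = t%:C by apply/complex_realP; rewrite gtr0_real.
rewrite dE ltcR in d0; exists er => // w wz.
have [->|wz0] := eqVneq w z.
  rewrite !subrr mulr0 subrr ComplexField.Normc.normc0 mulr_ge0 ?normc_ge0//.
  exact: ltW.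
have /hd : ball (0 : R[i]^o) d (w - z).
  by rewrite -ball_normE /= sub0r normrN dE Defs.normcE ltcR.
rewrite subr_eq0 => /(_ wz0) /=.
rewrite Defs.normcE lecR [_ *: 1 + z](_ : _ = w); last first.
  by rewrite /GRing.scale /= mulr1 subrK.
move=> hw; rewrite normcB in hw.
have -> : f w - f z - D * (w - z) = (w - z) * ((w - z)^-1 *: (f w - f z) - D).
  rewrite -[(w - z)^-1 *: (f w - f z)]/((w - z)^-1 * (f w - f z) : R[i]).
  by rewrite [RHS]mulrBr [X in _ = X - _]mulrA divff ?subr_eq0// mul1r [D * _]mulrC.
by rewrite normcM mulrC; apply: ler_wpM2r => //; exact: normc_ge0.
Qed.

Lemma cderiv_derivable (f : R[i]^o -> R[i]^o) (z : R[i]^o) D :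
  cderiv f z D -> derivable f z 1.
Proof.
move=> h; apply/cvg_ex; exists (D : R[i]^o); apply/cvgrPdist_le => /= e e0.
have [er eE] : exists t : R, e = t%:C by apply/complex_realP; rewrite gtr0_real.
rewrite eE ltcR in e0; have [d d0 hd] := h _ e0.
rewrite /dnbhs /=; apply/nbhs_ballP; exists d%:C => /=; first by rewrite ltcR.
move=> w /=; rewrite sub0r normrN Defs.normcE ltcR => wd w0.
have := hd (w + z); rewrite addrK => /(_ wd) hw.
rewrite Defs.normcE eE lecR [_ *: 1 + z](_ : _ = w + z); last first.
  by rewrite /GRing.scale /= mulr1.
rewrite normcB.
have -> : w^-1 *: (f (w + z) - f z) - D = w^-1 * (f (w + z) - f z - D * w).
  rewrite -[w^-1 *: _]/(w^-1 * (f (w + z) - f z) : R[i]).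
  by rewrite [RHS]mulrBr [w^-1 * (D * w)]mulrC mulfK.
by rewrite normcM normcV mulrC ler_pdivrMr ?normc_gt0.
Qed.

End cderiv.

(** * Integrals of complex functions *)

Section cint.
Context {d} {T : measurableType d} {R : realType}.
Variables (mu : {measure set T -> \bar R}) (A : set T).
Hypothesis mA : measurable A.
Implicit Types (f g : T -> R[i]).

(** Every estimate below may lose a constant factor, so real and imaginary
    parts are integrated separately. *)
Definition cint f : R[i] :=
  (\int[mu]_(x in A) (Re (f x)))%R +i* (\int[mu]_(x in A) (Im (f x)))%R.

Definition cintegrable f :=
  mu.-integrable A (EFin \o (fun x => Re (f x))) /\
  mu.-integrable A (EFin \o (fun x => Im (f x))).

Lemma eq_cint f g : (forall x, A x -> f x = g x) -> cint f = cint g.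
Proof.
by move=> fg; congr (_ +i* _); apply: eq_Rintegral => x;
  rewrite inE => /fg ->.
Qed.

Lemma eq_cintegrable f g : (forall x, A x -> f x = g x) ->
  cintegrable f -> cintegrable g.
Proof.
move=> fg [h1 h2]; split; [apply: eq_integrable h1|apply: eq_integrable h2] => //;
  by move=> x; rewrite inE => /fg /= ->.
Qed.

Lemma cintegrableD f g : cintegrable f -> cintegrable g ->
  cintegrable (fun x => f x + g x).
Proof.
move=> [f1 f2] [g1 g2]; split.
  apply: (eq_integrable mA _ _ _ (integrableD mA f1 g1)) => x _ /=.
  by rewrite ReD EFinD.
apply: (eq_integrable mA _ _ _ (integrableD mA f2 g2)) => x _ /=.
by rewrite ImD EFinD.
Qed.

Lemma cintegrableZ (a : R[i]) f : cintegrable f ->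
  cintegrable (fun x => a * f x).
Proof.
move=> [f1 f2]; split.
  have := integrableB mA (integrableZl mA (Re a) f1) (integrableZl mA (Im a) f2).
  by apply: eq_integrable => // x _ /=; rewrite ReM EFinB !EFinM.
have := integrableD mA (integrableZl mA (Re a) f2) (integrableZl mA (Im a) f1).
by apply: eq_integrable => // x _ /=; rewrite ImM EFinD !EFinM.
Qed.

Lemma cintegrableB f g : cintegrable f -> cintegrable g ->
  cintegrable (fun x => f x - g x).
Proof.
move=> hf /(cintegrableZ (-1)) /(cintegrableD hf); apply: eq_cintegrable => x _.
by rewrite mulN1r.
Qed.

Lemma cintD f g : cintegrable f -> cintegrable g ->
  cint (fun x => f x + g x) = cint f + cint g.
Proof.
move=> [f1 f2] [g1 g2]; apply: eq_complexP; rewrite ?ReD ?ImD /=.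
  by rewrite -RintegralD//; apply: eq_Rintegral => x _; rewrite ReD.
by rewrite -RintegralD//; apply: eq_Rintegral => x _; rewrite ImD.
Qed.

Lemma cintZ (a : R[i]) f : cintegrable f -> cint (fun x => a * f x) = a * cint f.
Proof.
move=> [f1 f2]; apply: eq_complexP; rewrite ?ReM ?ImM /=.
  rewrite -!RintegralZl// -RintegralB//=; last 2 first.
  - by apply: eq_integrable (integrableZl mA (Re a) f1) => // x _.
  - by apply: eq_integrable (integrableZl mA (Im a) f2) => // x _.
  by apply: eq_Rintegral => x _; rewrite ReM.
rewrite -!RintegralZl// -RintegralD//=; last 2 first.
- by apply: eq_integrable (integrableZl mA (Re a) f2) => // x _.
- by apply: eq_integrable (integrableZl mA (Im a) f1) => // x _.
by apply: eq_Rintegral => x _; rewrite ImM.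
Qed.

Lemma cintB f g : cintegrable f -> cintegrable g ->
  cint (fun x => f x - g x) = cint f - cint g.
Proof.
move=> hf hg; rewrite -mulN1r -cintZ// -cintD//; last exact: cintegrableZ.
by apply: eq_cint => x _; rewrite mulN1r.
Qed.

(** The real and the imaginary part contribute the integral of g each. *)
Lemma normc_cint_le f (g : T -> R) : cintegrable f ->
  mu.-integrable A (EFin \o g) -> (forall x, A x -> normc (f x) <= g x) ->
  normc (cint f) <= 2 * (\int[mu]_(x in A) g x)%R.
Proof.
move=> [f1 f2] ig fg; rewrite (le_trans (normc_le_ReIm _))//= mulr2n mulrDl mul1r.
apply: lerD; apply: (le_trans (le_normr_Rintegral _ _)) => //.
  apply: le_Rintegral => //; first exact: integrable_norm f1.
  by move=> x /fg; apply: le_trans; exact: normc_Re.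
apply: le_Rintegral => //; first exact: integrable_norm f2.
by move=> x /fg; apply: le_trans; exact: normc_Im.
Qed.

Lemma cintegrable_le f (g : T -> R) :
  measurable_fun A (fun x => Re (f x)) -> measurable_fun A (fun x => Im (f x)) ->
  mu.-integrable A (EFin \o g) -> (forall x, A x -> normc (f x) <= g x) ->
  cintegrable f.
Proof.
move=> m1 m2 ig fg.
split; apply: (le_integrable mA _ _ ig); try exact/measurable_EFinP.
  move=> x Ax /=; rewrite lee_fin [leRHS]ger0_norm ?(le_trans (normc_ge0 _) (fg _ Ax))//.
  by rewrite (le_trans (normc_Re _))// fg.
move=> x Ax /=; rewrite lee_fin [leRHS]ger0_norm ?(le_trans (normc_ge0 _) (fg _ Ax))//.
by rewrite (le_trans (normc_Im _))// fg.
Qed.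

Lemma cintegrable_measurable f : cintegrable f ->
  measurable_fun A (fun x => Re (f x)) /\ measurable_fun A (fun x => Im (f x)).
Proof.
by move=> [/integrableP[/measurable_EFinP m1 _] /integrableP[/measurable_EFinP m2 _]].
Qed.

End cint.

Section segment_integral.
Context {R : realType}.
Local Notation leb := (@lebesgue_measure R).
Implicit Types (f g : R -> R[i]) (q : R[i] -> R[i]) (a b c d x y : R).

Definition sint f a b := cint leb `[a, b] f.

Definition rcont f x := forall e : R, 0 < e ->
  exists2 d : R, 0 < d & forall y, `|y - x| < d -> normc (f y - f x) < e.

Lemma rcont_within f a b : (forall x, a <= x <= b -> rcont f x) ->
  {within `[a, b], continuous (fun x => Re (f x))} /\
  {within `[a, b], continuous (fun x => Im (f x))}.
Proof.
move=> cf; split; apply: continuous_in_subspaceT => x; rewrite inE /= in_itv /=;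
  move=> /cf cfx; apply/cvgrPdist_lt => e /cfx[d d0 hd]; near=> y;
  rewrite distrC -?ReN -?ImN -?ReD -?ImD.
- apply: (le_lt_trans (normc_Re _)); apply: hd; near: y.
  exists d => //= y; by rewrite /ball_ distrC.
- apply: (le_lt_trans (normc_Im _)); apply: hd; near: y.
  exists d => //= y; by rewrite /ball_ distrC.
Unshelve. all: by end_near. Qed.

Lemma rcont_cintegrable f a b : (forall x, a <= x <= b -> rcont f x) ->
  cintegrable leb `[a, b] f.
Proof.
move=> /rcont_within[c1 c2]; split.
  by apply: continuous_compact_integrable => //; exact: segment_compact.
by apply: continuous_compact_integrable => //; exact: segment_compact.
Qed.

Lemma lebesgue_measure_segment a b : a <= b -> leb `[a, b] = (b - a)%:E.
Proof.
move=> ab; rewrite lebesgue_measure_itv /= lte_fin; case: ltgtP ab => //.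
by move=> ->; rewrite subrr.
Qed.

Lemma integrable_cst_segment (r : R) a b :
  leb.-integrable `[a, b] (EFin \o cst r).
Proof.
apply: continuous_compact_integrable; first exact: segment_compact.
by apply: continuous_subspaceT => x; exact: cst_continuous.
Qed.

Lemma Rintegral_segment_cst (r : R) a b : a <= b ->
  (\int[leb]_(x in `[a, b]) r)%R = r * (b - a).
Proof.
move=> ab; rewrite Rintegral_cst//; congr (_ * _).
exact: (congr1 fine (lebesgue_measure_segment ab)).
Qed.

Lemma sint_cst (z : R[i]) a b : a <= b -> sint (fun=> z) a b = z * (b - a)%:C.
Proof.
move=> ab; rewrite /sint /cint !Rintegral_segment_cst//=.
by apply: eq_complexP; rewrite ?ReM ?ImM /= mulr0 ?subr0 ?add0r.
Qed.

Lemma normc_sint_le f a b M : a <= b -> cintegrable leb `[a, b] f ->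
  (forall x, a <= x <= b -> normc (f x) <= M) ->
  normc (sint f a b) <= 2 * M * (b - a).
Proof.
move=> ab cf fM; rewrite -mulrA -(Rintegral_segment_cst M ab).
apply: (normc_cint_le _ cf (integrable_cst_segment M a b)) => //.
Qed.

Lemma sint_split f a b m : a <= m -> m <= b -> cintegrable leb `[a, b] f ->
  sint f a b = sint f a m + sint f m b.
Proof.
move=> am mb [f1 f2].
have split1 (g : R -> R) : leb.-integrable `[a, b] (EFin \o g) ->
    (\int[leb]_(x in `[a, b]) g x =
     \int[leb]_(x in `[a, m]) g x + \int[leb]_(x in `[m, b]) g x)%R.
  move=> ig; have := @Rintegral_itvB _ g (BLeft a) (BRight b) m ig.
  rewrite !bnd_simp => /(_ am mb) h.
  have imb : leb.-integrable `]m, b] (EFin \o g).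
    apply: integrableS ig => //; apply: subset_itvr.
    by rewrite bnd_simp.
  by rewrite -(Rintegral_itv_obnd_cbnd imb) -h addrC subrK.
by apply: eq_complexP; rewrite ?ReD ?ImD /= split1.
Qed.

Lemma rcont_normc f x : rcont f x -> {for x, continuous (fun t => normc (f t))}.
Proof.
move=> cf; apply/cvgrPdist_lt => e e0; have [d d0 hd] := cf e e0.
exists d => //= y; rewrite /ball_ /= distrC => /hd; apply: le_lt_trans.
rewrite ler_norml lerNl opprB; apply/andP; split; last by rewrite normcB; exact: lerB_normc.
exact: lerB_normc.
Qed.

Lemma ccont_vert q x y : ccont q (x +i* y) -> rcont (fun t => q (x +i* t)) y.
Proof.
move=> cq e /cq[d d0 h]; exists d => // t td; apply: h.
rewrite (_ : _ - _ = 0 +i* (t - y)) ?normc_imag//.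
by apply: eq_complexP; rewrite ?ReD ?ImD ?ReN ?ImN /= ?subrr.
Qed.

Lemma ccont_horiz q x y : ccont q (x +i* y) -> rcont (fun t => q (t +i* y)) x.
Proof.
move=> cq e /cq[d d0 h]; exists d => // t td; apply: h.
rewrite (_ : _ - _ = (t - x)%:C) ?normc_real//.
by apply: eq_complexP; rewrite ?ReD ?ImD ?ReN ?ImN /= ?subrr.
Qed.

End segment_integral.

(** * Cauchy theory on rectangles *)

Section bisection.
Context {R : realType}.
Implicit Types (a b c d x y : R).

(** Nested intervals in two dimensions: a property of rectangles inherited by
    one of the four quarters concentrates at a point. *)
Lemma rectangle_bisection (P : R -> R -> R -> R -> Prop) a b c d :
  a <= b -> c <= d -> P a b c d ->
  (forall a b c d, a <= b -> c <= d -> P a b c d ->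
    let m := (a + b) / 2 in let n := (c + d) / 2 in
    [\/ P a m c n, P m b c n, P a m n d | P m b n d]) ->
  exists x y, [/\ a <= x <= b, c <= y <= d &
    forall k : nat, exists a' b' c' d', [/\ a <= a' <= x, x <= b' <= b,
      c <= c' <= y, y <= d' <= d &
      [/\ b' - a' = (b - a) / 2 ^+ k, d' - c' = (d - c) / 2 ^+ k & P a' b' c' d']]].
Proof.
move=> ab cd P0 step.
pose Q (s : R * R * R * R) := P s.1.1.1 s.1.1.2 s.1.2 s.2.
pose next (s : R * R * R * R) : R * R * R * R :=
  let: (a, b, c, d) := s in
  let m := (a + b) / 2 in let n := (c + d) / 2 in
  if pselect (P a m c n) then (a, m, c, n) else
  if pselect (P m b c n) then (m, b, c, n) else
  if pselect (P a m n d) then (a, m, n, d) else (m, b, n, d).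
pose s k := iter k next (a, b, c, d).
have next_ok t : [/\ t.1.1.1 <= t.1.1.2, t.1.2 <= t.2 & Q t] ->
    [/\ t.1.1.1 <= (next t).1.1.1, (next t).1.1.2 <= t.1.1.2,
    t.1.2 <= (next t).1.2, (next t).2 <= t.2 &
    [/\ (next t).1.1.2 - (next t).1.1.1 = (t.1.1.2 - t.1.1.1) / 2,
    (next t).2 - (next t).1.2 = (t.2 - t.1.2) / 2 & Q (next t)]].
  rewrite /Q; case: t => [[[a' b'] c'] d'] /= [ab' cd' Pk].
  have := step _ _ _ _ ab' cd' Pk => /=.
  case: pselect => [h1 _|h1]; first by split => //=; [lra..|split => //; lra].
  case: pselect => [h2 _|h2]; first by split => //=; [lra..|split => //; lra].
  case: pselect => [h3 _|h3]; first by split => //=; [lra..|split => //; lra].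
  by case=> // h4; split => //=; [lra..|split => //; lra].
have inv k : [/\ (s k).1.1.1 <= (s k).1.1.2, (s k).1.2 <= (s k).2 & Q (s k)].
  elim: k => [//|k ih]; have [h1 h2 h3 h4 [h5 h6 h7]] := next_ok _ ih.
  by case: ih => ? ? _; rewrite [s k.+1]/(next (s k)); split => //; lra.
have nextP k : [/\ (s k).1.1.1 <= (s k.+1).1.1.1, (s k.+1).1.1.2 <= (s k).1.1.2,
    (s k).1.2 <= (s k.+1).1.2, (s k.+1).2 <= (s k).2 &
    [/\ (s k.+1).1.1.2 - (s k.+1).1.1.1 = ((s k).1.1.2 - (s k).1.1.1) / 2,
    (s k.+1).2 - (s k.+1).1.2 = ((s k).2 - (s k).1.2) / 2 & Q (s k.+1)]].
  exact: next_ok (inv k).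
have size k : (s k).1.1.2 - (s k).1.1.1 = (b - a) / 2 ^+ k /\
    (s k).2 - (s k).1.2 = (d - c) / 2 ^+ k.
  elim: k => [|k [ih1 ih2]]; first by rewrite expr0 !divr1.
  have [_ _ _ _ [h1 h2 _]] := nextP k.
  by rewrite h1 h2 ih1 ih2 exprSr invfM !mulrA.
have mono k l : (k <= l)%N -> [/\ (s k).1.1.1 <= (s l).1.1.1, (s l).1.1.2 <= (s k).1.1.2,
    (s k).1.2 <= (s l).1.2 & (s l).2 <= (s k).2].
  elim: l => [|l ih]; first by rewrite leqn0 => /eqP ->.
  rewrite leq_eqVlt => /orP[/eqP -> //|]; rewrite ltnS => /ih[h1 h2 h3 h4].
  have [i1 i2 i3 i4 _] := nextP l.
  by split; [apply: le_trans i1|apply: le_trans h2|apply: le_trans i3|apply: le_trans h4].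
have cross k l : (s k).1.1.1 <= (s l).1.1.2 /\ (s k).1.2 <= (s l).2.
  have [h1 _ h3 _] := mono _ _ (leq_maxl k l).
  have [_ h2 _ h4] := mono _ _ (leq_maxr k l).
  by have [h5 h6 _] := inv (maxn k l); split; lra.
have supP (u v : nat -> R) : (forall k l, u k <= v l) ->
    exists x, forall k, u k <= x <= v k.
  move=> uv; exists (sup (range u)) => k.
  have hu : has_sup (range u).
    by split; [exists (u 0%N), 0%N|exists (v 0%N) => _ [j _ <-]; exact: uv].
  apply/andP; split; first by apply: ub_le_sup; [by case: hu|by exists k].
  by apply: ge_sup => [|_ [j _ <-]]; [case: hu|exact: uv].
have [x hx] := supP (fun k => (s k).1.1.1) (fun k => (s k).1.1.2)
  (fun k l => (cross k l).1).
have [y hy] := supP (fun k => (s k).1.2) (fun k => (s k).2)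
  (fun k l => (cross k l).2).
exists x, y; split; [exact: (hx 0%N)|exact: (hy 0%N)|] => k.
exists (s k).1.1.1, (s k).1.1.2, (s k).1.2, (s k).2.
have [h1 h2 h3 h4] := mono _ _ (leq0n k).
move: (hx k) (hy k) => /andP[x1 x2] /andP[y1 y2]; rewrite x1 x2 y1 y2 !andbT.
have [z1 z2] := size k; split => //; split => //.
by have [] := inv k.
Qed.

End bisection.

Section rectangles.
Context {R : realType}.
Local Notation leb := (@lebesgue_measure R).
Implicit Types (f g : R -> R[i]) (q : R[i] -> R[i]) (a b c d x y : R).

(** Boundary integral of the rectangle [a, b] x [c, d]; opposite sides are
    paired, so that affine functions visibly integrate to 0. *)
Definition rect q a b c d : R[i] :=
  'i%C * sint (fun y => q (b +i* y) - q (a +i* y)) c d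
  - sint (fun x => q (x +i* d) - q (x +i* c)) a b.

Definition vcont q x c d := forall y, c <= y <= d -> ccont q (x +i* y).
Definition hcont q y a b := forall x, a <= x <= b -> ccont q (x +i* y).

Definition contour q a b c d :=
  [/\ vcont q a c d, vcont q b c d, hcont q c a b & hcont q d a b].

Lemma vcont_int q x c d : vcont q x c d -> cintegrable leb `[c, d] (fun y => q (x +i* y)).
Proof. by move=> h; apply: rcont_cintegrable => y /h; exact: ccont_vert. Qed.

Lemma hcont_int q y a b : hcont q y a b -> cintegrable leb `[a, b] (fun x => q (x +i* y)).
Proof. by move=> h; apply: rcont_cintegrable => x /h; exact: ccont_horiz. Qed.

Lemma rectD q r a b c d : contour q a b c d -> contour r a b c d ->
  rect (fun z => q z + r z) a b c d = rect q a b c d + rect r a b c d.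
Proof.
move=> [/vcont_int q1 /vcont_int q2 /hcont_int q3 /hcont_int q4].
move=> [/vcont_int r1 /vcont_int r2 /hcont_int r3 /hcont_int r4].
rewrite /rect.
have -> : sint (fun y => q (b +i* y) + r (b +i* y) - (q (a +i* y) + r (a +i* y))) c d =
    sint (fun y => q (b +i* y) - q (a +i* y)) c d + sint (fun y => r (b +i* y) - r (a +i* y)) c d.
  rewrite -cintD//; [|exact: cintegrableB..].
  by apply: eq_cint => x _; rewrite opprD addrACA.
have -> : sint (fun x => q (x +i* d) + r (x +i* d) - (q (x +i* c) + r (x +i* c))) a b =
    sint (fun x => q (x +i* d) - q (x +i* c)) a b + sint (fun x => r (x +i* d) - r (x +i* c)) a b.
  rewrite -cintD//; [|exact: cintegrableB..].
  by apply: eq_cint => x _; rewrite opprD addrACA.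
by ring.
Qed.

Lemma rectZ (k : R[i]) q a b c d : contour q a b c d ->
  rect (fun z => k * q z) a b c d = k * rect q a b c d.
Proof.
move=> [/vcont_int q1 /vcont_int q2 /hcont_int q3 /hcont_int q4].
rewrite /rect.
have -> : sint (fun y => k * q (b +i* y) - k * q (a +i* y)) c d =
    k * sint (fun y => q (b +i* y) - q (a +i* y)) c d.
  rewrite -cintZ//; last exact: cintegrableB.
  by apply: eq_cint => x _; rewrite mulrBr.
have -> : sint (fun x => k * q (x +i* d) - k * q (x +i* c)) a b =
    k * sint (fun x => q (x +i* d) - q (x +i* c)) a b.
  rewrite -cintZ//; last exact: cintegrableB.
  by apply: eq_cint => x _; rewrite mulrBr.
by ring.
Qed.

Lemma rect_split_x q a b c d m : a <= m -> m <= b ->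
  contour q a b c d -> vcont q m c d ->
  rect q a b c d = rect q a m c d + rect q m b c d.
Proof.
move=> am mb [/vcont_int q1 /vcont_int q2 /hcont_int q3 /hcont_int q4] /vcont_int qm.
rewrite /rect (sint_split am mb) ?cintegrableB//; last exact: cintegrableB.
have -> : sint (fun y => q (b +i* y) - q (a +i* y)) c d =
    sint (fun y => q (m +i* y) - q (a +i* y)) c d + sint (fun y => q (b +i* y) - q (m +i* y)) c d.
  rewrite -cintD//; [|exact: cintegrableB..].
  by apply: eq_cint => y _; ring.
by ring.
Qed.

Lemma rect_split_y q a b c d n : c <= n -> n <= d ->
  contour q a b c d -> hcont q n a b ->
  rect q a b c d = rect q a b c n + rect q a b n d.
Proof.
move=> cn nd [/vcont_int q1 /vcont_int q2 /hcont_int q3 /hcont_int q4] /hcont_int qn.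
rewrite /rect (sint_split cn nd) ?cintegrableB//; last exact: cintegrableB.
have -> : sint (fun x => q (x +i* d) - q (x +i* c)) a b =
    sint (fun x => q (x +i* n) - q (x +i* c)) a b + sint (fun x => q (x +i* d) - q (x +i* n)) a b.
  rewrite -cintD//; [|exact: cintegrableB..].
  by apply: eq_cint => y _; ring.
by ring.
Qed.

Lemma rect_affine (A B : R[i]) a b c d : a <= b -> c <= d ->
  rect (fun z => A + B * z) a b c d = 0.
Proof.
move=> ab cd; rewrite /rect.
have -> : sint (fun y => A + B * (b +i* y) - (A + B * (a +i* y))) c d =
    B * (b - a)%:C * (d - c)%:C.
  rewrite -sint_cst//; apply: eq_cint => y _.
  by rewrite opprD addrACA subrr add0r -mulrBr; congr (_ * _);
    apply: eq_complexP; rewrite ?ReD ?ImD ?ReN ?ImN /= ?subrr.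
have -> : sint (fun x => A + B * (x +i* d) - (A + B * (x +i* c))) a b =
    B * ('i%C * (d - c)%:C) * (b - a)%:C.
  rewrite -sint_cst//; apply: eq_cint => y _.
  rewrite opprD addrACA subrr add0r -mulrBr; congr (_ * _).
  by apply: eq_complexP; rewrite ?ReD ?ImD ?ReN ?ImN ?ReM ?ImM /= ?subrr; ring.
by ring.
Qed.

Lemma normc_i : normc ('i%C : R[i]) = 1.
Proof. by rewrite (normc_imag 1) normr1. Qed.

Lemma rect_bound q a b c d M : a <= b -> c <= d -> contour q a b c d ->
  (forall x y, a <= x <= b -> c <= y <= d ->
     (x == a) || (x == b) || (y == c) || (y == d) -> normc (q (x +i* y)) <= M) ->
  normc (rect q a b c d) <= 4 * M * ((b - a) + (d - c)).
Proof.
move=> ab cd [/vcont_int q1 /vcont_int q2 /hcont_int q3 /hcont_int q4] qM.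
have h1 : normc (sint (fun y => q (b +i* y) - q (a +i* y)) c d) <= 2 * (2 * M) * (d - c).
  apply: normc_sint_le => //; first exact: cintegrableB.
  move=> y ycd; rewrite (le_trans (normcD _ _))// normcN.
  have := qM a y; have := qM b y; rewrite !eqxx !orbT ab !lexx /= => /(_ isT ycd isT) ? /(_ isT ycd isT).
  by lra.
have h2 : normc (sint (fun x => q (x +i* d) - q (x +i* c)) a b) <= 2 * (2 * M) * (b - a).
  apply: normc_sint_le => //; first exact: cintegrableB.
  move=> x xab; rewrite (le_trans (normcD _ _))// normcN.
  have := qM x d; have := qM x c; rewrite !eqxx !orbT cd !lexx /= => /(_ xab isT isT) ? /(_ xab isT isT).
  by lra.
rewrite (le_trans (normcD _ _))// normcN normcM normc_i mul1r; lra.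
Qed.

Lemma cderiv_contour q a b c d : a <= b -> c <= d ->
  (forall x y, a <= x <= b -> c <= y <= d ->
     (x == a) || (x == b) || (y == c) || (y == d) -> exists D, cderiv q (x +i* y) D) ->
  contour q a b c d.
Proof.
move=> ab cd h; split => t ht.
- by have [|||D /cderiv_ccont//] := h a t; rewrite ?lexx ?ab ?ht ?eqxx.
- by have [|||D /cderiv_ccont//] := h b t; rewrite ?lexx ?ab ?ht ?eqxx ?orbT.
- by have [|||D /cderiv_ccont//] := h t c; rewrite ?lexx ?cd ?ht ?eqxx ?orbT.
- by have [|||D /cderiv_ccont//] := h t d; rewrite ?lexx ?cd ?ht ?eqxx ?orbT.
Qed.

Lemma midpoint_le a b : a <= b -> a <= (a + b) / 2 /\ (a + b) / 2 <= b.
Proof. by move=> ?; split; lra. Qed.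

Lemma subitv a b a' b' x : a <= a' -> b' <= b -> a' <= x <= b' -> a <= x <= b.
Proof. by move=> ? ? /andP[? ?]; apply/andP; split; lra. Qed.

Lemma exists_geometric_lt a (k r : R) : 1 < k -> 0 < r -> exists n : nat, a / k ^+ n < r.
Proof.
move=> k1 r0; have k0 : 0 < k by exact: lt_trans k1.
have h2 : `|k^-1| < 1 by rewrite ger0_norm ?invf_lt1// invr_ge0 ltW.
have /cvgrPdist_lt/(_ _ r0)[n _ hn] := cvg_geometric a h2.
exists n; have := hn n (leqnn n); rewrite sub0r normrN /geometric /= exprVn.
by apply: le_lt_trans; exact: ler_norm.
Qed.

(** Goursat: bisection keeps a fixed share, relative to area, of a nonzero
    boundary integral; at the limit point q is affine up to an error that makes
    the integral negligible with respect to area. *)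
Theorem goursat q a b c d : a < b -> c < d ->
  (forall x y, a <= x <= b -> c <= y <= d -> exists D, cderiv q (x +i* y) D) ->
  rect q a b c d = 0.
Proof.
move=> ab cd dq; apply/eqP; rewrite -normc_eq0; apply: contraT => I0.
have {}I0 : 0 < normc (rect q a b c d) by rewrite lt0r I0 normc_ge0.
have ar0 : 0 < (b - a) * (d - c) by rewrite mulr_gt0// subr_gt0.
pose eta := normc (rect q a b c d) / ((b - a) * (d - c)).
have eta0 : 0 < eta by rewrite divr_gt0.
pose P a' b' c' d' := [/\ a <= a', b' <= b, c <= c', d' <= d &
  eta * ((b' - a') * (d' - c')) <= normc (rect q a' b' c' d')].
have P0 : P a b c d by split => //; rewrite divfK// gt_eqF.
have ctr a' b' c' d' : a <= a' -> b' <= b -> c <= c' -> d' <= d -> a' <= b' -> c' <= d' ->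
    contour q a' b' c' d'.
  move=> *; apply: cderiv_contour => // x y hx hy _.
  by apply: dq; [exact: subitv hx|exact: subitv hy].
have ccq x y : a <= x <= b -> c <= y <= d -> ccont q (x +i* y).
  by move=> h1 h2; have [D /cderiv_ccont] := dq x y h1 h2.
have [|x [y [xab ycd hk]]] := rectangle_bisection (ltW ab) (ltW cd) P0.
  move=> a' b' c' d' ab' cd' [aa bb cc dd hP] m n.
  have [am mb] := @midpoint_le a' b' ab'; have [cn nd] := @midpoint_le c' d' cd'.
  apply: contrapT => nP.
  have lt4 (u1 u2 v1 v2 : R) : a' <= u1 -> u2 <= b' -> c' <= v1 -> v2 <= d' ->
      u2 - u1 = (b' - a') / 2 -> v2 - v1 = (d' - c') / 2 -> ~ P u1 u2 v1 v2 ->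
      normc (rect q u1 u2 v1 v2) < eta * ((b' - a') * (d' - c')) / 4.
    move=> h1 h2 h3 h4 e1 e2 nPu; rewrite ltNge; apply/negP => hle; apply: nPu.
    split; [exact: le_trans h1|exact: le_trans bb|exact: le_trans h3|exact: le_trans dd|].
    rewrite e1 e2; apply: le_trans hle.
    by rewrite le_eqVlt; apply/orP; left; apply/eqP; field.
  have hm1 : m - a' = (b' - a') / 2 by rewrite /m; field.
  have hm2 : b' - m = (b' - a') / 2 by rewrite /m; field.
  have hn1 : n - c' = (d' - c') / 2 by rewrite /n; field.
  have hn2 : d' - n = (d' - c') / 2 by rewrite /n; field.
  have k1 := lt4 _ _ _ _ (lexx _) mb (lexx _) nd hm1 hn1 (fun h => nP (Or41 _ _ _ h)).
  have k2 := lt4 _ _ _ _ am (lexx _) (lexx _) nd hm2 hn1 (fun h => nP (Or42 _ _ _ h)).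
  have k3 := lt4 _ _ _ _ (lexx _) mb cn (lexx _) hm1 hn2 (fun h => nP (Or43 _ _ _ h)).
  have k4 := lt4 _ _ _ _ am (lexx _) cn (lexx _) hm2 hn2 (fun h => nP (Or44 _ _ _ h)).
  have s1 : rect q a' b' c' d' = rect q a' m c' d' + rect q m b' c' d'.
    apply: rect_split_x => //; first exact: ctr.
    move=> t ht; apply: ccq; last exact: subitv ht.
    by rewrite (le_trans aa) ?(le_trans mb).
  have s2 : rect q a' m c' d' = rect q a' m c' n + rect q a' m n d'.
    apply: rect_split_y => //; first by apply: ctr => //; exact: le_trans mb bb.
    move=> t ht; apply: ccq; last by rewrite (le_trans cc) ?(le_trans nd).
    by apply: subitv ht => //; exact: le_trans mb bb.
  have s3 : rect q m b' c' d' = rect q m b' c' n + rect q m b' n d'.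
    apply: rect_split_y => //; first by apply: ctr => //; exact: le_trans aa am.
    move=> t ht; apply: ccq; last by rewrite (le_trans cc) ?(le_trans nd).
    by apply: subitv ht => //; exact: le_trans aa am.
  move: hP; rewrite s1 s2 s3; move: k1 k2 k3 k4; clear.
  have := normcD (rect q a' m c' n + rect q a' m n d') (rect q m b' c' n + rect q m b' n d').
  have := normcD (rect q a' m c' n) (rect q a' m n d').
  have := normcD (rect q m b' c' n) (rect q m b' n d').
  by lra.
have [D hD] := dq x y xab ycd.
pose S := (b - a) + (d - c); have S0 : 0 < S by rewrite /S; lra.
(* An affine error e |w - z| makes the k-th integral at most 4 e (S / 2^k)^2, half of
   the share that bisection keeps. *)
pose e := eta * ((b - a) * (d - c)) / (8 * S ^+ 2).
have e0 : 0 < e.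
  by apply: divr_gt0; [exact: mulr_gt0|rewrite mulr_gt0// exprn_gt0].
have [r r0 hr] := hD e e0.
have [k Sk] := exists_geometric_lt S (ltr1n R 2) r0.
have [a' [b' [c' [d' [h1 h2 h3 h4 [e1 e2 [aa bb cc dd hP]]]]]]] := hk k.
move: h1 h2 h3 h4 => /andP[_ h1] /andP[h2 _] /andP[_ h3] /andP[h4 _].
have ab' : a' <= b' by exact: le_trans h2.
have cd' : c' <= d' by exact: le_trans h4.
set p := 2 ^+ k in Sk e1 e2; have p0 : 0 < p by rewrite exprn_gt0.
have near u v : a' <= u <= b' -> c' <= v <= d' ->
    normc (u +i* v - (x +i* y)) <= S / p.
  move=> hu hv; rewrite (le_trans (normc_le_ReIm _))//.
  have -> : S / p = (b' - a') + (d' - c') by rewrite e1 e2 /S mulrDl.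
  rewrite ReD ImD ReN ImN /=; move: h1 h2 h3 h4 hu hv; clear => h1 h2 h3 h4.
  move=> /andP[? ?] /andP[? ?].
  by apply: lerD; rewrite ler_norml; apply/andP; split; lra.
pose lin z := (q (x +i* y) - D * (x +i* y)) + D * z.
have cl : contour lin a' b' c' d'.
  apply: cderiv_contour => // u v _ _ _; eexists.
  by apply: cderivD; [exact: cderiv_cst|apply: cderivZ; exact: cderiv_id].
have cq : contour q a' b' c' d' by apply: ctr.
have cml : contour (fun z => -1 * lin z) a' b' c' d'.
  apply: cderiv_contour => // u v _ _ _; eexists; apply: cderivZ.
  by apply: cderivD; [exact: cderiv_cst|apply: cderivZ; exact: cderiv_id].
have cd_ : contour (fun z => q z + -1 * lin z) a' b' c' d'.
  apply: cderiv_contour => // u v hu hv _.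
  have [|| D' hD'] := dq u v; [exact: subitv hu|exact: subitv hv|].
  eexists; apply: cderivD; first exact: hD'.
  by apply: cderivZ; apply: cderivD; [exact: cderiv_cst|apply: cderivZ; exact: cderiv_id].
have hI : rect (fun z => q z + -1 * lin z) a' b' c' d' = rect q a' b' c' d'.
  by rewrite rectD// rectZ// rect_affine// mulr0 addr0.
have : normc (rect q a' b' c' d') <= 4 * (e * (S / p)) * (S / p).
  have -> : (4 * (e * (S / p)) * (S / p)) = 4 * (e * (S / p)) * ((b' - a') + (d' - c')).
    by rewrite e1 e2 -mulrDl.
  rewrite -hI; apply: rect_bound => // u v hu hv _.
  have hn := near u v hu hv.
  have := hr (u +i* v) (le_lt_trans hn Sk).
  rewrite (_ : q (u +i* v) + -1 * lin (u +i* v) =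
    q (u +i* v) - q (x +i* y) - D * (u +i* v - (x +i* y))); last by rewrite /lin; ring.
  move=> h; apply: (le_trans h); apply: ler_wpM2l => //; exact: ltW.
move=> hle; have := le_trans hP hle; rewrite e1 e2 /e leNgt => /negP[].
have -> : 4 * (eta * ((b - a) * (d - c)) / (8 * S ^+ 2) * (S / p)) * (S / p) =
    eta * ((b - a) / p * ((d - c) / p)) / 2.
  by field; rewrite (gt_eqF p0) (gt_eqF S0).
rewrite ltr_pdivrMr// ltr_pMr ?ltr1n//.
by rewrite mulr_gt0// mulr_gt0// divr_gt0// subr_gt0.
Qed.

End rectangles.

Section translation_invariance.
Context {R : realType}.
Local Notation leb := (@lebesgue_measure R).
Implicit Types (D : set (measurableTypeR R)) (t : R).

Lemma measurable_shift t :
  measurable_fun setT (fun x : measurableTypeR R => x + t : measurableTypeR R).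
Proof. exact: measurable_funD. Qed.

Lemma ge0_integral_translate D (f : measurableTypeR R -> \bar R) t :
  measurable D -> measurable_fun D f -> (forall x, (0 <= f x)%E) ->
  (\int[leb]_(x in (fun x => x + t)%R @^-1` D) f (x + t)%R = \int[leb]_(x in D) f x)%E.
Proof.
move=> mD mf f0.
have := ge0_integral_pushforward (measurable_shift t) leb mD mf (fun x _ => f0 x).
move=> <-; apply: eq_measure_integral; first exact: measurable_shift.
by move=> mt A mA _; exact: lebesgue_measure_translate.
Qed.

Lemma integral_translate D (f : measurableTypeR R -> \bar R) t :
  measurable D -> measurable_fun D f ->
  (\int[leb]_(x in (fun x => x + t)%R @^-1` D) f (x + t)%R = \int[leb]_(x in D) f x)%E.
Proof.
move=> mD mf; rewrite integralE [RHS]integralE; congr (_ - _)%E.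
  rewrite -(@ge0_integral_translate _ _ t mD (measurable_funepos mf) (funepos_ge0 _)).
  by apply: eq_integral => x _; rewrite !funeposE.
rewrite -(@ge0_integral_translate _ _ t mD (measurable_funeneg mf) (funeneg_ge0 _)).
by apply: eq_integral => x _; rewrite !funenegE.
Qed.

Lemma cint_translate D (f : R -> R[i]) t : measurable D -> cintegrable leb D f ->
  cint leb ((fun x => x + t) @^-1` D) (fun x => f (x + t)) = cint leb D f.
Proof.
move=> mD /cintegrable_measurable[m1 m2].
apply: eq_complexP => /=; congr fine.
  by rewrite -(@integral_translate _ _ t mD ((measurable_EFinP _ _).2 m1)).
by rewrite -(@integral_translate _ _ t mD ((measurable_EFinP _ _).2 m2)).
Qed.

Lemma sint_translate (f : R -> R[i]) t (a b : R) :
  cintegrable leb `[a + t, b + t] f ->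
  sint (fun x => f (x + t)) a b = sint f (a + t) (b + t).
Proof.
move=> cf; rewrite /sint -(@cint_translate _ f t _ cf)//; congr cint.
by apply/seteqP; split => x /=; rewrite !in_itv /= !lerD2r.
Qed.

End translation_invariance.

Section shrinking.
Context {R : realType}.
Local Notation leb := (@lebesgue_measure R).
Implicit Types (f g : R -> R[i]) (q : R[i] -> R[i]) (a b c d x y r : R).

Definition cderiv_box q a b c d (z : R[i]) := forall x y, a <= x <= b -> c <= y <= d ->
  x +i* y != z -> exists D, cderiv q (x +i* y) D.

(** Cutting along the four sides of the small square leaves outer rectangles on which
    the function is holomorphic and Goursat applies. *)
Lemma rect_shrink q a b c d (z : R[i]) r : 0 < r ->
  a < Re z - r -> Re z + r < b -> c < Im z - r -> Im z + r < d ->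
  cderiv_box q a b c d z ->
  rect q a b c d = rect q (Re z - r) (Re z + r) (Im z - r) (Im z + r).
Proof.
move=> r0 ha hb hc hd dq.
have offx x y : x != Re z -> x +i* y != z.
  by apply: contra => /eqP <-.
have offy x y : y != Im z -> x +i* y != z.
  by apply: contra => /eqP <-.
have v x a' b' : a <= x <= b -> x != Re z -> c <= a' -> b' <= d -> vcont q x a' b'.
  move=> hx xz ha' hb' y hy.
  by have [D /cderiv_ccont] := dq x y hx (subitv ha' hb' hy) (offx _ _ xz).
have h y a' b' : c <= y <= d -> y != Im z -> a <= a' -> b' <= b -> hcont q y a' b'.
  move=> hy yz ha' hb' x hx.
  by have [D /cderiv_ccont] := dq x y (subitv ha' hb' hx) hy (offy _ _ yz).
have gx a' b' c' d' : a <= a' -> b' <= b -> c <= c' -> d' <= d -> a' < b' -> c' < d' ->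
    [\/ b' < Re z, Re z < a', d' < Im z | Im z < c'] -> rect q a' b' c' d' = 0.
  move=> h1 h2 h3 h4 h5 h6 h7; apply: goursat => // x y hx hy.
  apply: dq; [exact: subitv hx|exact: subitv hy|].
  move: hx hy h7 => /andP[? ?] /andP[? ?] [] ?; [apply: offx|apply: offx|apply: offy|apply: offy];
    by rewrite neq_lt; apply/orP; first [left; lra|right; lra].
have ax : Re z - r != Re z by rewrite lt_eqF// ltrBlDr ltrDl.
have bx : Re z + r != Re z by rewrite gt_eqF// ltrDl.
have cy : Im z - r != Im z by rewrite lt_eqF// ltrBlDr ltrDl.
have dy : Im z + r != Im z by rewrite gt_eqF// ltrDl.
have ab1 : a <= Re z - r <= b by apply/andP; split; lra.
have ab2 : a <= Re z + r <= b by apply/andP; split; lra.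
have cd1 : c <= Im z - r <= d by apply/andP; split; lra.
have cd2 : c <= Im z + r <= d by apply/andP; split; lra.
have a0 : a != Re z by rewrite lt_eqF//; lra.
have b0 : b != Re z by rewrite gt_eqF//; lra.
have c0 : c != Im z by rewrite lt_eqF//; lra.
have d0 : d != Im z by rewrite gt_eqF//; lra.
have aab : a <= a <= b by apply/andP; split; lra.
have bab : a <= b <= b by apply/andP; split; lra.
have ccd : c <= c <= d by apply/andP; split; lra.
have dcd : c <= d <= d by apply/andP; split; lra.
rewrite (@rect_split_x _ q a b c d (Re z - r)); last first.
- exact: v.
- by split; [exact: v|exact: v|exact: h|exact: h].
- by case/andP: ab1.
- exact: ltW.
rewrite gx ?add0r//; [|lra..|by apply: Or41; lra].
rewrite (@rect_split_x _ q (Re z - r) b c d (Re z + r)); last first.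
- exact: v.
- split; [exact: v|exact: v|apply: h => //; lra|apply: h => //; lra].
- exact: ltW.
- lra.
rewrite [X in _ + X]gx ?addr0//; [|lra..|by apply: Or42; lra].
rewrite (@rect_split_y _ q _ _ c d (Im z - r)); last first.
- apply: h => //; lra.
- by split; [exact: v|exact: v|apply: h => //; lra|apply: h => //; lra].
- lra.
- lra.
rewrite gx ?add0r//; [|lra..|by apply: Or43; lra].
rewrite (@rect_split_y _ q _ _ _ d (Im z + r)); last first.
- apply: h => //; lra.
- by split; [apply: v => //; lra|apply: v => //; lra|apply: h => //; lra|apply: h => //; lra].
- lra.
- lra.
by rewrite [X in _ + X]gx ?addr0//; [lra..|by apply: Or44; lra].
Qed.

End shrinking.

Section residue.
Context {R : realType}.
Local Notation leb := (@lebesgue_measure R).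
Implicit Types (f g : R -> R[i]) (q : R[i] -> R[i]) (a b c d x y r : R).

Lemma exists_small_square a b c d (z : R[i]) e : 0 < e ->
  a < Re z < b -> c < Im z < d -> exists r, [/\ 0 < r, r < e,
    a < Re z - r /\ Re z + r < b & c < Im z - r /\ Im z + r < d].
Proof.
move=> e0 /andP[h1 h2] /andP[h3 h4].
pose m := Num.min e (Num.min (Num.min (Re z - a) (b - Re z)) (Num.min (Im z - c) (d - Im z))).
have m0 : 0 < m by rewrite !lt_min e0 !subr_gt0 h1 h2 h3.
have : m <= m by [].
rewrite {2}/m !le_min => /and3P[m1 /andP[m2 m3] /andP[m4 m5]].
by exists (m / 2); split; [lra|lra|split; lra|split; lra].
Qed.

Lemma boundary_dist (z : R[i]) r x y : 0 < r ->
  (x == Re z - r) || (x == Re z + r) || (y == Im z - r) || (y == Im z + r) ->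
  r <= normc (x +i* y - z).
Proof.
move=> r0 H; have hre := normc_Re (x +i* y - z); have him := normc_Im (x +i* y - z).
rewrite ReD ReN /= in hre; rewrite ImD ImN /= in him.
by move: H => /orP[/orP[/orP[]|]|] /eqP e; rewrite e in hre him *;
  [move: hre|move: hre|move: him|move: him]; apply: le_trans;
  rewrite ler_normr; apply/orP; [right|left|right|left]; lra.
Qed.

(** On a square of half side r around z the integrand is at most e / r, while the
    perimeter is 8 r, so the integral is arbitrarily small. *)
Lemma rect_removable q a b c d (z : R[i]) : a < Re z < b -> c < Im z < d ->
  cderiv_box q a b c d z ->
  (forall e, 0 < e -> exists2 r, 0 < r & forall w, 0 < normc (w - z) < r ->
     normc ((w - z) * q w) <= e) ->
  rect q a b c d = 0.
Proof.
move=> hx hy dq hq; apply/eqP; rewrite -normc_eq0; apply: contraT => I0.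
have {}I0 : 0 < normc (rect q a b c d) by rewrite lt0r I0 normc_ge0.
pose e := normc (rect q a b c d) / 32.
have e0 : 0 < e by rewrite divr_gt0.
have [s s0 hs] := hq e e0; have s20 : 0 < s / 2 by rewrite divr_gt0.
have [r [r0 rs [h1 h2] [h3 h4]]] := exists_small_square s20 hx hy.
have rE := rect_shrink r0 h1 h2 h3 h4 dq.
have cx : Re z - r <= Re z + r by lra.
have cy : Im z - r <= Im z + r by lra.
have bnd x y : (x == Re z - r) || (x == Re z + r) || (y == Im z - r) || (y == Im z + r) ->
    x +i* y != z.
  by move=> /(boundary_dist r0) h; rewrite -subr_eq0 -normc_gt0 (lt_le_trans r0).
have ctr : contour q (Re z - r) (Re z + r) (Im z - r) (Im z + r).
  apply: cderiv_contour => // x y xr yr b0; apply: dq; last exact: bnd.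
    by apply: subitv xr; exact: ltW.
  by apply: subitv yr; exact: ltW.
have : normc (rect q (Re z - r) (Re z + r) (Im z - r) (Im z + r)) <=
    4 * (e / r) * ((Re z + r - (Re z - r)) + (Im z + r - (Im z - r))).
  apply: rect_bound => // x y xr yr b0.
  have d1 := boundary_dist r0 b0.
  have d2 : normc (x +i* y - z) <= 2 * r.
    rewrite (le_trans (normc_le_ReIm _))// ReD ImD ReN ImN /= mulr2n mulrDl mul1r.
    move: xr yr => /andP[? ?] /andP[? ?].
    by apply: lerD; rewrite ler_norml; apply/andP; split; lra.
  have d3 : 0 < normc (x +i* y - z) by rewrite (lt_le_trans r0).
  have := hs (x +i* y); rewrite d3 => /(_ _) H.
  have {}H : normc ((x +i* y - z) * q (x +i* y)) <= e by apply: H; apply: (le_lt_trans d2); lra.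
  rewrite normcM in H.
  rewrite ler_pdivlMr//; apply: le_trans H; rewrite mulrC ler_wpM2r ?normc_ge0//.
rewrite -rE => hle.
have : 4 * (e / r) * ((Re z + r - (Re z - r)) + (Im z + r - (Im z - r))) =
    normc (rect q a b c d) / 2 by rewrite /e; field; rewrite gt_eqF.
by move=> E; rewrite E in hle; lra.
Qed.

(** This is 2 pi i; only its being a nonzero absolute constant matters. *)
Definition residue_constant : R[i] := rect (fun z => z^-1) (-1) 1 (-1) 1.

(** Opposite sides combine to real integrals of 2 / (1 + y^2) on [-1, 1], where the
    integrand is at least 1. *)
Lemma residue_constant_neq0 : residue_constant != 0.
Proof.
pose J := sint (fun y : R => (2 / (1 + y ^+ 2))%:C) (-1) 1.
have sq (y : R) : 0 < 1 + y ^+ 2 by rewrite ltr_pwDl ?sqr_ge0.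
have cJ x : rcont (fun y : R => (2 / (1 + y ^+ 2))%:C) x.
  have c1 : {for x, continuous (fun y : R => 2 / (1 + y ^+ 2))}.
    apply: cvgM; first exact: cvg_cst.
    by apply: cvgV; [rewrite gt_eqF|apply: cvgD; [exact: cvg_cst|exact: exprn_continuous]].
  move=> e e0; have /cvgrPdist_lt/(_ _ e0)[d d0 hd] := c1.
  exists d => // y yx; rewrite -rmorphB normc_real distrC.
  by apply: hd; rewrite /ball_ /= distrC.
have iJ : cintegrable leb `[-1, 1] (fun y : R => (2 / (1 + y ^+ 2))%:C).
  by apply: rcont_cintegrable => x _.
have E : residue_constant = 2 * 'i%C * J.
  rewrite /residue_constant /rect.
  have -> : sint (fun y : R => (1 +i* y)^-1 - (-1 +i* y)^-1) (-1) 1 = J.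
    apply: eq_cint => y _; apply: eq_complexP; rewrite ?ReD ?ImD ?ReN ?ImN /=.
      rewrite sqrrN expr1n; field; exact: lt0r_neq0.
    by rewrite sqrrN expr1n subrr.
  have -> : sint (fun x : R => (x +i* 1)^-1 - (x +i* -1)^-1) (-1) 1 = - 'i%C * J.
    rewrite -cintZ//; apply: eq_cint => y _.
    apply: eq_complexP; rewrite ?ReM ?ImM ?ReD ?ImD ?ReN ?ImN /=.
      by rewrite sqrrN expr1n; ring.
    by rewrite sqrrN expr1n [_ + 1]addrC; field; exact: lt0r_neq0.
  by ring.
rewrite E !mulf_neq0//.
- by rewrite -normc_eq0 normc_i oner_eq0.
- apply/negP => /eqP/(congr1 (fun z : R[i] => Re z)) /= J0.
  have : (\int[leb]_(x in `[-1, 1]%classic) (1 : R) <= \int[leb]_(x in `[-1, 1]%classic) (2 / (1 + x ^+ 2)))%R.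
    apply: le_Rintegral => //; [exact: integrable_cst_segment|by case: iJ|].
    move=> x /=; rewrite in_itv /= => /andP[x1 x2].
    rewrite ler_pdivlMr// mul1r.
    have : x ^+ 2 <= 1 by nra.
    by lra.
  by rewrite Rintegral_segment_cst; lra.
Qed.


Lemma eq_rect q1 q2 a b c d : (forall x y, a <= x <= b -> c <= y <= d ->
    (x == a) || (x == b) || (y == c) || (y == d) -> q1 (x +i* y) = q2 (x +i* y)) ->
  a <= b -> c <= d -> rect q1 a b c d = rect q2 a b c d.
Proof.
move=> h ab cd; rewrite /rect; congr (_ * _ - _).
  apply: eq_cint => y; rewrite /= in_itv /= => hy.
  by rewrite !h ?lexx ?ab ?eqxx ?orbT.
apply: eq_cint => x; rewrite /= in_itv /= => hx.
by rewrite !h ?lexx ?cd ?eqxx ?orbT.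
Qed.

Lemma rect_translate q (z : R[i]) a b c d : 
  contour q (a + Re z) (b + Re z) (c + Im z) (d + Im z) ->
  rect (fun w => q (w + z)) a b c d =
  rect q (a + Re z) (b + Re z) (c + Im z) (d + Im z).
Proof.
move=> [/vcont_int h1 /vcont_int h2 /hcont_int h3 /hcont_int h4].
have E x y : x +i* y + z = (x + Re z) +i* (y + Im z) by case: z {h1 h2 h3 h4}.
rewrite /rect; congr (_ * _ - _).
  by rewrite -sint_translate; [apply: eq_cint => y _; rewrite !E|exact: cintegrableB].
by rewrite -sint_translate; [apply: eq_cint => y _; rewrite !E|exact: cintegrableB].
Qed.

Lemma cderiv_inv_sub (z w : R[i]) : w != z -> exists D, cderiv (fun w => (w - z)^-1) w D.
Proof.
move=> wz; eexists; apply: cderivV; first by rewrite subr_eq0.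
by apply: cderivB; [exact: cderiv_id|exact: cderiv_cst].
Qed.

Lemma rect_inv a b c d (z : R[i]) : a < Re z < b -> c < Im z < d ->
  rect (fun w => (w - z)^-1) a b c d = residue_constant.
Proof.
move=> hx hy.
have box a' b' c' d' : cderiv_box (fun w => (w - z)^-1) a' b' c' d' z.
  by move=> x y _ _; exact: cderiv_inv_sub.
have [r [r0 r1 [h1 h2] [h3 h4]]] := exists_small_square (@ltr01 R) hx hy.
rewrite (rect_shrink r0 h1 h2 h3 h4 (box _ _ _ _)).
rewrite -(@rect_shrink _ (fun w => (w - z)^-1) (Re z - 1) (Re z + 1) (Im z - 1) (Im z + 1) z r r0)//;
  [|lra..].
have := @rect_translate (fun w => (w - z)^-1) z (-1) 1 (-1) 1.
rewrite [-1 + Re z]addrC [1 + Re z]addrC [-1 + Im z]addrC [1 + Im z]addrC => <-.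
  by apply: eq_rect => [x y _ _ _||]; rewrite ?addrK//; lra.
apply: cderiv_contour; [lra|lra|] => x y _ _ /(boundary_dist (@ltr01 R)) h.
by apply: cderiv_inv_sub; rewrite -subr_eq0 -normc_gt0 (lt_le_trans _ h).
Qed.

(** Subtracting p / (w - z) leaves a singularity that does not contribute. *)
Theorem rect_residue q a b c d (z p : R[i]) : a < Re z < b -> c < Im z < d ->
  cderiv_box q a b c d z ->
  (forall e, 0 < e -> exists2 r, 0 < r & forall w, 0 < normc (w - z) < r ->
     normc ((w - z) * q w - p) <= e) ->
  rect q a b c d = p * residue_constant.
Proof.
move=> hx hy dq hq; move: (hx) (hy) => /andP[x1 x2] /andP[y1 y2].
have bz x y : a <= x <= b -> c <= y <= d ->
    (x == a) || (x == b) || (y == c) || (y == d) -> x +i* y != z.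
  move=> _ _ H; apply/negP => /eqP zE; rewrite -zE /= in x1 x2 y1 y2.
  by move: H => /orP[/orP[/orP[]|]|] /eqP E; rewrite E ltxx in x1 x2 y1 y2.
have cq : contour q a b c d.
  apply: cderiv_contour; [lra|lra|] => x y xr yr /(bz _ _ xr yr); exact: dq.
have ci (k : R[i]) : contour (fun w => k * (w - z)^-1) a b c d.
  apply: cderiv_contour; [lra|lra|] => x y xr yr /(bz _ _ xr yr) /cderiv_inv_sub[D hD].
  by exists (k * D); exact: cderivZ.
have ci1 : contour (fun w => (w - z)^-1) a b c d.
  apply: cderiv_contour; [lra|lra|] => x y xr yr /(bz _ _ xr yr); exact: cderiv_inv_sub.
have : rect (fun w => q w + - p * (w - z)^-1) a b c d = 0.
  apply: (@rect_removable _ a b c d z) => //.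
    move=> x y xr yr xyz; have [D hD] := dq x y xr yr xyz.
    have [D' hD'] := cderiv_inv_sub xyz; exists (D + - p * D').
    by apply: cderivD => //; exact: cderivZ.
  move=> e /hq[r r0 hr]; exists r => // w /[dup] /andP[w0 _] /hr.
  have wz : w - z != 0 by rewrite -normc_gt0.
  by rewrite mulrDr [_ * (- p * _)]mulrCA divff// mulr1.
rewrite rectD// rectZ// rect_inv// mulNr => /eqP.
by rewrite subr_eq0 => /eqP.
Qed.

Theorem cauchy_formula q a b c d (z : R[i]) : a < Re z < b -> c < Im z < d ->
  (forall x y, a <= x <= b -> c <= y <= d -> exists D, cderiv q (x +i* y) D) ->
  rect (fun w => q w * (w - z)^-1) a b c d = q z * residue_constant.
Proof.
move=> hx hy dq; apply: rect_residue (hx) (hy) _ _.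
  move=> x y xr yr xyz; have [D hD] := dq x y xr yr.
  by have [D' hD'] := cderiv_inv_sub xyz; eexists; apply: cderivM hD hD'.
move: hx hy => /andP[x1 x2] /andP[y1 y2] e e0.
have [||D hD] := dq (Re z) (Im z); [by apply/andP; split; lra..|].
rewrite complex_eta in hD; have [r r0 hr] := cderiv_ccont hD e0.
exists r => // w /andP[w0 /hr wr].
have wz : w - z != 0 by rewrite -normc_gt0.
by rewrite mulrCA divff// mulr1 ltW.
Qed.

End residue.

Section consequences.
Context {R : realType}.
Local Notation leb := (@lebesgue_measure R).
Implicit Types (f g : R -> R[i]) (q F : R[i] -> R[i]) (a b c d x y r : R) (z w : R[i]).

Definition holo F := forall z, 0 < Re z -> exists D, cderiv F z D.

Lemma rcont_bounded f a b : (forall x, a <= x <= b -> rcont f x) ->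
  exists M, forall x, a <= x <= b -> normc (f x) <= M.
Proof.
move=> cf; have [ab|ba] := leP a b; last first.
  by exists 0 => x /andP[ax xb]; have := le_trans ax xb; rewrite leNgt ba.
have cn : {within `[a, b], continuous (fun x => normc (f x))}.
  by apply: continuous_in_subspaceT => x; rewrite inE /= in_itv /= => /cf; exact: rcont_normc.
have [m _ hm] := EVT_max ab cn.
by exists (normc (f m)) => x hx; apply: hm; rewrite in_itv.
Qed.

Lemma contour_bounded q a b c d : contour q a b c d ->
  exists M, forall x y, a <= x <= b -> c <= y <= d ->
     (x == a) || (x == b) || (y == c) || (y == d) -> normc (q (x +i* y)) <= M.
Proof.
move=> [h1 h2 h3 h4].
have [M1 m1] := rcont_bounded (fun y hy => ccont_vert (h1 y hy)).
have [M2 m2] := rcont_bounded (fun y hy => ccont_vert (h2 y hy)).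
have [M3 m3] := rcont_bounded (fun y hy => ccont_horiz (h3 y hy)).
have [M4 m4] := rcont_bounded (fun y hy => ccont_horiz (h4 y hy)).
exists (Num.max (Num.max M1 M2) (Num.max M3 M4)) => x y hx hy.
by move=> /orP[/orP[/orP[]|]|] /eqP E; rewrite !le_max; [rewrite E m1|rewrite E m2 ?orbT|
  rewrite E m3 ?orbT|rewrite E m4 ?orbT].
Qed.

(** Since q vanishes near the centre z + m of a square containing z, the quotients
    q / (w - (z + m))^n are holomorphic; the Cauchy formula for them, with n large,
    forces q z = 0. *)
Lemma identity_theorem q (x1 : R) : holo q ->
  (forall z, x1 < Re z -> q z = 0) -> forall z, 0 < Re z -> q z = 0.
Proof.
move=> hq q0 z z0; apply/eqP; rewrite -normc_eq0; apply: contraT => qz.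
have {}qz : 0 < normc (q z) by rewrite lt0r qz normc_ge0.
(* z1 lies in the region where q vanishes; the square of half side r > m around it
   contains z and stays in the half-plane. *)
pose m : R := `|x1| + 1; have m0 : 0 < m by rewrite ltr_wpDl.
pose z1 := z + m%:C; pose r := m + Re z / 2.
have r0 : 0 < r by rewrite addr_gt0// divr_gt0.
have z1x : x1 < Re z1.
  by rewrite ReD /= /m; have := ler_norm x1; lra.
have z1R : Re z1 = Re z + m by rewrite ReD.
have z1I : Im z1 = Im z by rewrite ImD /= addr0.
set a := Re z1 - r; set b := Re z1 + r; set c := Im z1 - r; set d := Im z1 + r.
have hx : a < Re z < b by rewrite /a /b z1R /r; apply/andP; split; lra.
have hy : c < Im z < d by rewrite /c /d z1I; apply/andP; split; lra.
have ab : a <= b by rewrite /a /b; lra.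
have cd : c <= d by rewrite /c /d; lra.
have a0 : 0 < a by rewrite /a z1R /r; lra.
have dqn n w : 0 < Re w -> exists D, cderiv (fun w => q w * ((w - z1)^-1) ^+ n) w D.
  move=> w0; have [->|wz] := eqVneq w z1.
    exists 0; pose s := Re z1 - x1; have s0 : 0 < s by rewrite subr_gt0.
    apply: (eq_cderiv_near s0 _ (cderiv_cst 0 z1)) => v vz.
    have := normc_Re (v - z1); rewrite ReD ReN => hv.
    rewrite q0 ?mul0r//; have := le_lt_trans hv vz.
    by rewrite ltr_norml /s => /andP[]; lra.
  have [D hD] := hq w w0; have [D' hD'] := cderiv_inv_sub wz.
  have [D2 hD2] := cderivX n hD'; eexists; exact: cderivM hD hD2.
have Fn n := cauchy_formula hx hy (fun x y (hx : a <= x <= b) _ =>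
  dqn n (x +i* y) (lt_le_trans a0 (andP hx).1)).
have bz x y : (x == a) || (x == b) || (y == c) || (y == d) -> x +i* y != z.
  move=> H; apply/negP => /eqP zE; move: hx hy; rewrite -zE /= => /andP[? ?] /andP[? ?].
  by move: H => /orP[/orP[/orP[]|]|] /eqP E; lra.
have ctr (n : nat) : contour (fun w => q w * ((w - z1)^-1) ^+ n * (w - z)^-1) a b c d.
  apply: cderiv_contour => // x y /andP[ax _] yr /bz xyz.
  have [D hD] := dqn n (x +i* y) (lt_le_trans a0 ax); have [D' hD'] := cderiv_inv_sub xyz.
  eexists; exact: cderivM hD hD'.
have [M hM] := contour_bounded (ctr 0%N).
have k1 : 1 < r / m by rewrite ltr_pdivlMr// mul1r /r; lra.
have [n hn] := exists_geometric_lt (4 * M * (b - a + (d - c)) / normc residue_constant) k1 qz.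
have c0 : 0 < normc (residue_constant : R[i]) by rewrite normc_gt0 residue_constant_neq0.
have : normc (rect (fun w => q w * ((w - z1)^-1) ^+ n * (w - z)^-1) a b c d) <=
    4 * (M / r ^+ n) * (b - a + (d - c)).
  apply: rect_bound => // x y xr yr Bxy.
  have := hM x y xr yr Bxy; rewrite expr0 mulr1 => hM'.
  rewrite mulrAC normcM; apply: ler_pM; rewrite ?normc_ge0//.
  rewrite normcX normcV exprVn lef_pV2 ?posrE ?exprn_gt0//; last first.
    by rewrite (lt_le_trans r0)// boundary_dist.
  by rewrite lerXn2r ?nnegrE ?normc_ge0 ?(ltW r0)// boundary_dist.
rewrite Fn normcM normcM normcX normcV.
have -> : normc (z - z1) = m by rewrite /z1 opprD addrA subrr add0r normcN normc_real ger0_norm ?ltW.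
rewrite exprVn => hle.
have rn : 0 < r ^+ n by rewrite exprn_gt0.
have mn : 0 < m ^+ n by rewrite exprn_gt0.
move: hn; rewrite expr_div_n ltNge => /negP[].
move: hle; rewrite -ler_pdivlMr// ler_pdivrMr// => hle.
apply: (le_trans hle); rewrite le_eqVlt; apply/orP; left; apply/eqP.
by field; rewrite !gt_eqF.
Qed.

(** In the Cauchy formula on a square of half side d around w the remainder of the
    kernel is h^2 / ((z - w)^2 (z - w - h)). The uniformity in w is what allows
    differentiation under an integral over infinitely many translates. *)
Lemma taylor2_uniform F d M : 0 < d -> holo F ->
  (forall z, d <= Re z -> normc (F z) <= M) ->
  exists K : R, 0 <= K /\ forall w, 2 * d <= Re w -> exists D, forall h,
    normc h <= d / 2 -> normc (F (w + h) - F w - D * h) <= K * normc h ^+ 2.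
Proof.
move=> d0 hF FM.
have c0 : 0 < normc (residue_constant : R[i]) by rewrite normc_gt0 residue_constant_neq0.
have M0 : 0 <= M by apply: le_trans (normc_ge0 _) (FM (d%:C) _).
exists (32 * M / d ^+ 2 / normc residue_constant); split.
  by rewrite !divr_ge0 ?mulr_ge0 ?normc_ge0 ?exprn_ge0// ltW.
move=> w w2.
set a := Re w - d; set b := Re w + d; set c := Im w - d; set e := Im w + d.
have ab : a <= b by rewrite /a /b; lra.
have ce : c <= e by rewrite /c /e; lra.
have da : d <= a by rewrite /a; lra.
have dq x y : a <= x <= b -> c <= y <= e -> exists D, cderiv F (x +i* y) D.
  by move=> /andP[ax _] _; apply: hF => /=; exact: lt_le_trans (le_trans da ax).
have bd x y : (x == a) || (x == b) || (y == c) || (y == e) -> d <= normc (x +i* y - w).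
  exact: boundary_dist.
have inv h x y : normc h <= d / 2 -> (x == a) || (x == b) || (y == c) || (y == e) ->
    d / 2 <= normc (x +i* y - (w + h)).
  move=> hh /bd; have := lerB_normc (x +i* y - w) h.
  by rewrite opprD addrA; lra.
have ih h x y : normc h <= d / 2 -> (x == a) || (x == b) || (y == c) || (y == e) ->
    x +i* y != w + h.
  move=> hh /(inv h _ _ hh) H; rewrite -subr_eq0 -normc_gt0.
  by apply: lt_le_trans H; rewrite divr_gt0.
have h00 : normc (0 : R[i]) <= d / 2.
  by rewrite ComplexField.Normc.normc0 divr_ge0// ltW.
have i0 x y : (x == a) || (x == b) || (y == c) || (y == e) -> x +i* y != w.
  by move=> /(ih 0 _ _ h00); rewrite addr0.
have ctr1 h : normc h <= d / 2 -> contour (fun z => F z * (z - (w + h))^-1) a b c e.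
  move=> hh; apply: cderiv_contour => // x y xr yr /(ih h _ _ hh) /cderiv_inv_sub[D' hD'].
  by have [D hD] := dq x y xr yr; eexists; exact: cderivM hD hD'.
have ctr2 : contour (fun z => F z * ((z - w)^-1) ^+ 2) a b c e.
  apply: cderiv_contour => // x y xr yr /i0 /cderiv_inv_sub[D' hD'].
  have [D hD] := dq x y xr yr; have [D2 hD2] := cderivX 2 hD'.
  eexists; exact: cderivM hD hD2.
have cf h : normc h <= d / 2 -> rect (fun z => F z * (z - (w + h))^-1) a b c e = F (w + h) * residue_constant.
  move=> hh; apply: cauchy_formula => //; apply/andP; rewrite ?ReD ?ImD.
    by have := le_trans (normc_Re h) hh; rewrite ler_norml => /andP[]; rewrite /a /b; split; lra.
  by have := le_trans (normc_Im h) hh; rewrite ler_norml => /andP[]; rewrite /c /e; split; lra.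
exists (rect (fun z => F z * ((z - w)^-1) ^+ 2) a b c e / residue_constant) => h hh.
have cZ (k : R[i]) q : contour q a b c e -> contour (fun z => k * q z) a b c e.
  have cz z : ccont q z -> ccont (fun z => k * q z) z.
    move=> cq t t0; have k0 : 0 < normc k + 1 by rewrite ltr_wpDl ?normc_ge0.
    have [s s0 hs] := cq (t / (normc k + 1)) (divr_gt0 t0 k0).
    exists s => // v /hs; rewrite ltr_pdivlMr// -mulrBr normcM; apply: le_lt_trans.
    by rewrite mulrC ler_wpM2l ?normc_ge0// lerDl.
  by move=> [h1 h2 h3 h4]; split => t ht; apply: cz; [exact: h1|exact: h2|exact: h3|exact: h4].
have cD q q' : contour q a b c e -> contour q' a b c e -> contour (fun z => q z + q' z) a b c e.
  have cz z : ccont q z -> ccont q' z -> ccont (fun z => q z + q' z) z.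
    move=> c1 c2 t t0; have t20 : 0 < t / 2 by rewrite divr_gt0.
    have [s s0 hs] := c1 _ t20; have [s' s'0 hs'] := c2 _ t20.
    exists (Num.min s s'); first by rewrite lt_min s0.
    move=> v; rewrite lt_min => /andP[/hs A /hs' B].
    rewrite opprD addrACA (le_lt_trans (normcD _ _))//.
    by rewrite [ltRHS]splitr ltrD.
  move=> [h1 h2 h3 h4] [k1 k2 k3 k4].
  by split => t ht; apply: cz; [exact: h1|exact: k1|exact: h2|exact: k2|exact: h3|exact: k3|exact: h4|exact: k4].
have cf0 : rect (fun z => F z * (z - w)^-1) a b c e = F w * residue_constant.
  by have := cf 0 h00; rewrite addr0.
have ctr0 : contour (fun z => F z * (z - w)^-1) a b c e.
  by have := ctr1 0 h00; rewrite addr0.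
have E : rect (fun z => F z * (z - (w + h))^-1 +
      (-1 * (F z * (z - w)^-1) + - h * (F z * ((z - w)^-1) ^+ 2))) a b c e =
    (F (w + h) - F w - rect (fun z => F z * (z - w)^-1 ^+ 2) a b c e / residue_constant * h) * residue_constant.
  rewrite !rectD//; [|exact: cZ|exact: cZ|exact: ctr1|by apply: cD; exact: cZ].
  rewrite !rectZ// cf// cf0.
  by field; exact: residue_constant_neq0.
rewrite -(ler_pM2r c0) -normcM -E.
have : normc (rect (fun z => F z * (z - (w + h))^-1 +
      (-1 * (F z * (z - w)^-1) + - h * (F z * ((z - w)^-1) ^+ 2))) a b c e) <=
    4 * (M * (normc h ^+ 2 / (d ^+ 2 * (d / 2)))) * (b - a + (e - c)).
  apply: rect_bound => //.
    by apply: (@cD); [exact: ctr1|apply: (@cD); exact: cZ].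
  move=> x y xr yr B.
  have n1 := ih _ _ _ hh B; have n0 := i0 _ _ B.
  have -> : F (x +i* y) * (x +i* y - (w + h))^-1 +
      (-1 * (F (x +i* y) * (x +i* y - w)^-1) + - h * (F (x +i* y) * ((x +i* y - w)^-1) ^+ 2)) =
      F (x +i* y) * (h ^+ 2 * (((x +i* y - w) ^+ 2)^-1 * (x +i* y - (w + h))^-1)).
    by field; rewrite !subr_eq0 n1 n0.
  rewrite !normcM !normcV !normcX; apply: ler_pM; rewrite ?normc_ge0//.
  - by rewrite !mulr_ge0 ?invr_ge0 ?exprn_ge0 ?normc_ge0.
  - by apply: FM; move: xr => /andP[ax _] /=; exact: le_trans ax.
  - apply: ler_pM; rewrite ?exprn_ge0 ?mulr_ge0 ?invr_ge0 ?exprn_ge0 ?normc_ge0//.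
    rewrite [leRHS]invfM.
    apply: ler_pM; rewrite ?invr_ge0 ?exprn_ge0 ?normc_ge0//.
      rewrite lef_pV2 ?posrE ?exprn_gt0//; last by rewrite (lt_le_trans d0)// bd.
      by rewrite lerXn2r ?nnegrE ?normc_ge0 ?(ltW d0)// bd.
    rewrite lef_pV2 ?posrE ?divr_gt0//; last by rewrite normc_gt0 subr_eq0.
    exact: inv.
move=> H; apply: (le_trans H); rewrite le_eqVlt; apply/orP; left; apply/eqP.
by rewrite /a /b /c /e; field; rewrite !gt_eqF.
Qed.

End consequences.

(** * Zen functions are bounded away from the imaginary axis *)

Section zen_bounded.
Context {R : realType}.
Local Notation leb := (@lebesgue_measure R).
Local Notation M := (measurableTypeR R).
Implicit Types (nu : zenMeasure R) (F : Cplus R -> R[i]^o).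

Lemma zen_sigma_finite nu : sigma_finite setT (zen_measure nu).
Proof.
exists (fun n => `[- (n%:R : R), n%:R]%classic).
  apply/esym; rewrite -subTset => x _; exists (Num.truncn `|x|).+1 => //=.
  rewrite in_itv /= -ler_norml; apply: ltW.
  by rewrite truncnS_gt.
move=> n; split; first exact: measurable_itv.
by have [+ _ _] := zen_regular nu; apply; exact: segment_compact.
Qed.

(** A copy of the measure, to carry the sigma-finite structure. *)
Definition zen_sf nu : set M -> \bar R := zen_measure nu.
HB.instance Definition _ nu := Measure.copy (zen_sf nu) (zen_measure nu).
HB.instance Definition _ nu :=
  Measure_isSigmaFinite.Build _ _ _ (zen_sf nu) (zen_sigma_finite nu).

(** Replacing abscissas below e by e makes the square of the modulus measurable on the
    whole plane; extension by zero has no continuity at the imaginary axis. *)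
Definition clamp_sqr F (e : R) (p : M * M) : \bar R :=
  ((half_plane_normc F e (Num.max (p.1 - e) 0, p.2)) ^+ 2)%:E.

Lemma measurable_clamp (e : R) : measurable_fun setT (fun p : M * M => (Num.max (p.1 - e) 0, p.2) : M * M).
Proof.
apply/measurable_fun_pair => //=.
by apply: measurable_maxr => //; exact: measurable_funB.
Qed.

Lemma measurable_clamp_sqr F e : holomorphic F -> 0 < e ->
  measurable_fun setT (clamp_sqr F e).
Proof.
move=> hF e0; apply/measurable_EFinP; apply: measurable_funX.
apply: (measurable_comp (@measurable_half_space R) _ (measurable_half_plane_normc hF e0)
  (measurable_clamp e)).
by move=> _ [p _ <-]; split => //=; rewrite in_itv /= andbT le_max lexx orbT.
Qed.

Lemma clamp_sqr_ge0 F e p : (0 <= clamp_sqr F e p)%E.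
Proof. by rewrite lee_fin sqr_ge0. Qed.

Lemma clamp_sqrE F e (x y : R) : e <= x ->
  clamp_sqr F e (x, y) = ((normc (ext0 F (x +i* y))) ^+ 2)%:E.
Proof.
by move=> ex; rewrite /clamp_sqr /half_plane_normc /= max_l ?subr_ge0// subrK.
Qed.

Definition clamp_line F e (x : R) : \bar R := (\int[leb]_y clamp_sqr F e (x, y))%E.

Lemma measurable_clamp_line F e : holomorphic F -> 0 < e ->
  measurable_fun setT (clamp_line F e).
Proof.
move=> hF e0; apply: (@measurable_fun_fubini_tonelli_F _ _ M M R leb _
  (measurable_clamp_sqr hF e0)); exact: clamp_sqr_ge0.
Qed.

Lemma clamp_line_ge0 F e x : (0 <= clamp_line F e x)%E.
Proof. by apply: integral_ge0 => y _; exact: clamp_sqr_ge0. Qed.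

Lemma measurable_clamp_sqr1 F e (x : M) : holomorphic F -> 0 < e ->
  measurable_fun setT (fun y : M => clamp_sqr F e (x, y)).
Proof.
by move=> hF e0; apply: measurableT_comp (measurable_clamp_sqr hF e0) _.
Qed.

Lemma measurable_clamp_sqr2 F e (y : M) : holomorphic F -> 0 < e ->
  measurable_fun setT (fun x : M => clamp_sqr F e (x, y)).
Proof.
by move=> hF e0; apply: measurableT_comp (measurable_clamp_sqr hF e0) _.
Qed.

Definition line_sqnorm F (x : R) : \bar R :=
  (\int[leb]_y ((normc (ext0 F (x +i* y))) ^+ 2)%:E)%E.

Lemma clamp_lineE F e x : e <= x -> clamp_line F e x = line_sqnorm F x.
Proof. by move=> ex; apply: eq_integral => y _; rewrite clamp_sqrE. Qed.

Lemma line_sqnorm_ge0 F x : (0 <= line_sqnorm F x)%E.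
Proof. by apply: integral_ge0 => y _; rewrite lee_fin sqr_ge0. Qed.

Lemma measurable_line_sqnorm F e : holomorphic F -> 0 < e ->
  measurable_fun (`[0, +oo[%classic : set M) (fun x => line_sqnorm F (x + e)).
Proof.
move=> hF e0.
have h : measurable_fun (`[0, +oo[%classic : set M) (fun x : M => clamp_line F e (x + e)).
  apply: measurable_funTS.
  by apply: measurableT_comp (measurable_clamp_line hF e0) _; exact: measurable_shift.
apply: eq_measurable_fun h => x; rewrite inE /= in_itv /= andbT => x0.
by rewrite clamp_lineE// lerDr.
Qed.

Lemma zen_integralE nu F e : holomorphic F -> 0 < e ->
  zen_integral nu F e = (\int[zen_sf nu]_(x in `[0%R, +oo[) line_sqnorm F (x + e)%R)%E.
Proof.
move=> hF e0.
transitivity (\int[zen_sf nu \x leb]_(p in `[0%R, +oo[%classic `*` setT)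
    clamp_sqr F e ((p.1 + e)%R, p.2))%E.
  apply: eq_integral => p; rewrite inE /= => -[]; rewrite in_itv /= andbT => p0 _.
  by rewrite clamp_sqrE// lerDr.
rewrite integral_mkcond.
have mg : measurable_fun setT (fun p : M * M => clamp_sqr F e ((p.1 + e)%R : M, p.2)).
  apply: measurableT_comp (measurable_clamp_sqr hF e0) _.
  by apply/measurable_fun_pair => //=; apply: measurableT_comp (measurable_shift e) _.
rewrite fubini_tonelli1//=; last 2 first.
- by apply/(measurable_restrictT _ _).1; [exact: measurable_half_space|exact: measurable_funTS].
- by move=> p; rewrite patchE; case: ifP => // _; exact: clamp_sqr_ge0.
rewrite [RHS]integral_mkcond; apply: eq_integral => x _.
rewrite /fubini_F patchE; case: ifPn => xP.
  apply: eq_integral => y _; rewrite patchE ifT; last first.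
    by rewrite inE; split => //=; move: xP; rewrite inE.
  by move: xP; rewrite inE /= in_itv /= andbT => ?; rewrite clamp_sqrE// lerDr.
apply: integral0_eq => y _; rewrite patchE ifF//.
by apply/negbTE; apply: contra xP; rewrite !inE /= => -[].
Qed.


Lemma ge0_integral_translate_segment (f : M -> \bar R) (t a b : R) :
  measurable_fun setT f -> (forall x, (0 <= f x)%E) ->
  (\int[leb]_(x in `[a, b]) f (x + t)%R = \int[leb]_(x in `[(a + t)%R, (b + t)%R]) f x)%E.
Proof.
move=> mf f0; rewrite -(@ge0_integral_translate _ `[a + t, b + t]%classic f t)//; last first.
  exact: measurable_funTS.
congr integral.
by apply/seteqP; split => x /=; rewrite !in_itv /= !lerD2r.
Qed.

(** Averaging over translations converts nu-integrals of line norms, which is what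
    the Zen norm controls, into area integrals over vertical strips. *)
Lemma strip_integral_le nu F (e a b : R) : holomorphic F -> 0 < e ->
  2 * e <= a -> a <= b ->
  (zen_sf nu `[0%R, e[ * (\int[leb]_(x in `[a, b]) clamp_line F e x)
   <= (b - a + e)%:E * zen_sqnorm nu F)%E.
Proof.
move=> hF e0 ea ab.
have mL := measurable_clamp_line hF e0; have L0 := clamp_line_ge0 F e.
pose A : set M := `[0%R, e[%classic; pose B : set M := `[(a - e)%R, b]%classic.
have mA : measurable A by exact: measurable_itv.
have mB : measurable B by exact: measurable_itv.
pose I := (\int[leb]_(x in `[a, b]) clamp_line F e x)%E.
have I0 : (0 <= I)%E by exact: integral_ge0.
pose f (p : M * M) : \bar R :=
  ((\1_A p.1)%:E * ((\1_B p.2)%:E * clamp_line F e (p.1 + p.2)%R))%E.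
have mf : measurable_fun setT f.
  apply: emeasurable_funM.
    apply/measurable_EFinP; apply: measurableT_comp (measurable_indic mA) _.
    exact: measurable_fst.
  apply: emeasurable_funM.
    apply/measurable_EFinP; apply: measurableT_comp (measurable_indic mB) _.
    exact: measurable_snd.
  by apply: measurableT_comp mL _; exact: measurable_funD.
have f0 p : (0 <= f p)%E by rewrite /f !mule_ge0// ?lee_fin.
have mshift (x : M) : measurable_fun setT (fun t : M => clamp_line F e (x + t)%R).
  by apply: measurableT_comp mL _; exact: measurable_funD.
have mshift' (t : M) : measurable_fun setT (fun x : M => clamp_line F e (x + t)%R).
  by apply: measurableT_comp mL _; exact: measurable_funD.
apply: (@le_trans _ _ (\int[zen_sf nu]_x \int[leb]_t f (x, t))%E).
  have -> : (zen_sf nu A * I = \int[zen_sf nu]_x ((\1_A x)%:E * I))%E.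
    rewrite ge0_integralZr//; last by apply/measurable_EFinP; exact: measurable_indic.
    by rewrite integral_indic// setIT.
  apply: ge0_le_integral => //.
  - by move=> x _; apply: mule_ge0; rewrite ?lee_fin.
  - apply: emeasurable_funM => //; apply/measurable_EFinP; exact: measurable_indic.
  - exact: (measurable_fun_fubini_tonelli_F (m2 := leb) _ mf f0).
  move=> x _; rewrite indicE; case: (boolP (x \in A)) => xA /=; last first.
    by rewrite mul0e; exact: integral_ge0.
  have [x0 xe] : 0 <= x /\ x < e.
    by move: xA; rewrite inE /A /= in_itv /= => /andP[].
  rewrite mul1e; apply: (@le_trans _ _ (\int[leb]_(t in B) clamp_line F e (t + x)%R)%E); last first.
    rewrite integral_mkcond le_eqVlt; apply/orP; left; apply/eqP.
    apply: eq_integral => t _; rewrite epatch_indic /f /= !indicE xA mul1e muleC.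
    by rewrite addrC.
  rewrite ge0_integral_translate_segment//; apply: ge0_subset_integral => //.
    exact: measurable_funTS.
  by move=> t /=; rewrite !in_itv /= => /andP[? ?]; apply/andP; split; lra.
rewrite (@fubini_tonelli _ _ M M R (zen_sf nu) leb f mf f0).
apply: (@le_trans _ _ (\int[leb]_t ((\1_B t)%:E * zen_sqnorm nu F))%E); last first.
  rewrite ge0_integralZr//; first last.
  - exact: zen_sqnorm_ge0.
  - by apply/measurable_EFinP; exact: measurable_indic.
  rewrite integral_indic// setIT.
  have lB : (leb B = (b - a + e)%:E)%E.
    by rewrite [LHS]lebesgue_measure_segment; [congr EFin; lra|lra].
  by apply: lee_wpmul2r; [exact: zen_sqnorm_ge0|rewrite [leLHS]lB].
apply: ge0_le_integral => //.
- by move=> x _; exact: integral_ge0.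
- exact: (measurable_fun_fubini_tonelli_G (m1 := zen_sf nu) _ mf f0).
- by apply: emeasurable_funM => //; apply/measurable_EFinP; exact: measurable_indic.
move=> t _; rewrite indicE; case: (boolP (t \in B)) => tB /=; last first.
  rewrite mul0e integral0_eq// => x _.
  by rewrite /f /= !indicE (negbTE tB) mul0e mule0.
have t0 : e <= t by move: tB; rewrite inE /B /= in_itv /= => /andP[? ?]; lra.
rewrite mul1e; apply: (@le_trans _ _ (zen_integral nu F t)); last first.
  by apply: zen_integral_le; lra.
rewrite zen_integralE//; last lra.
rewrite [leRHS]integral_mkcond; apply: ge0_le_integral => //.
- by apply: measurableT_comp mf _; exact: measurable_pair2.
- apply/(measurable_restrictT _ _).1; first exact: measurable_itv.
  apply: measurable_line_sqnorm => //; lra.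
move=> x _; rewrite /f /= patchE indicE; case: (boolP (x \in A)) => xA; last first.
  by rewrite mul0e; case: ifP => // _; exact: line_sqnorm_ge0.
have [x0 xe] : 0 <= x /\ x < e.
  by move: xA; rewrite inE /A /= in_itv /= => /andP[].
rewrite ifT; last by rewrite inE /= in_itv /= x0.
by rewrite !indicE tB !mul1e clamp_lineE//; lra.
Qed.

End zen_bounded.

Section square_estimate.
Context {R : realType}.
Local Notation leb := (@lebesgue_measure R).
Local Notation M := (measurableTypeR R).
Implicit Types (nu : zenMeasure R) (F : Cplus R -> R[i]^o).

Lemma normc_cint_lee d (T : measurableType d) (mu : {measure set T -> \bar R})
    (A : set T) (f : T -> R[i]) (g : T -> \bar R) : measurable A ->
  cintegrable mu A f -> measurable_fun A g ->
  (forall x, A x -> ((normc (f x))%:E <= g x)%E) ->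
  ((normc (cint mu A f))%:E <= 2%:E * \int[mu]_(x in A) g x)%E.
Proof.
move=> mA cf mg fg; have [f1 f2] := cf.
have [m1 m2] := cintegrable_measurable cf.
have part (h : T -> R) : mu.-integrable A (EFin \o h) -> measurable_fun A h ->
    (forall x, A x -> `|h x| <= normc (f x)) ->
    ((`|\int[mu]_(x in A) h x|%R)%:E <= \int[mu]_(x in A) g x)%E.
  move=> ih mh hf; rewrite EFin_normr_Rintegral//.
  apply: (le_trans (le_abse_integral _ _ _)) => //; first exact/measurable_EFinP.
  apply: ge0_le_integral => //.
    by apply: measurableT_comp => //; exact/measurable_EFinP.
  by move=> x Ax /=; apply: le_trans (fg x Ax); rewrite lee_fin hf.
rewrite (_ : 2%:E = 1%:E + 1%:E)%E; last by rewrite -EFinD.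
rewrite ge0_muleDl// !mul1e.
apply: (@le_trans _ _ (`|Re (cint mu A f)|%:E + `|Im (cint mu A f)|%:E)%E).
  by rewrite -EFinD lee_fin normc_le_ReIm.
apply: leeD; apply: part => // x _; [exact: normc_Re|exact: normc_Im].
Qed.

Lemma holomorphic_holo F : holomorphic F -> holo (ext0 F).
Proof. by move=> hF z z0; apply: derivable_cderiv; exact: hF. Qed.

Lemma normc_le_1Dsqr (z : R[i]) : normc z <= 1 + normc z ^+ 2.
Proof. by have := normc_ge0 z; move: (normc z) => t t0; nra. Qed.

Definition strip_row F e (a b y : R) : \bar R :=
  (\int[leb]_(x in `[a, b]) clamp_sqr F e (x, y))%E.

(** The Cauchy formula on a square of side 3 d placed at s, with |F| <= 1 + |F|^2 on the
    sides: a bound by square integrals over lines and segments, in which s is free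
    and will be averaged over [0, d]. *)
Lemma square_estimate F (e d s : R) (z : R[i]) : holomorphic F -> 0 < e -> 0 < d ->
  e <= Re z - 2 * d -> 0 <= s <= d ->
  ((normc (ext0 F z) * normc (residue_constant : R[i]))%:E <=
   (2 / d)%:E * ((12 * d)%:E +
     (clamp_line F e (Re z + d + s) + clamp_line F e (Re z - 2 * d + s) +
      (strip_row F e (Re z - 2 * d) (Re z + 2 * d) (Im z + d + s) +
       strip_row F e (Re z - 2 * d) (Re z + 2 * d) (Im z - 2 * d + s)))))%E.
Proof.
move=> hF e0 d0 ez /andP[s0 sd].
set a := Re z - 2 * d + s; set b := Re z + d + s.
set c := Im z - 2 * d + s; set c' := Im z + d + s.
have ab : a <= b by rewrite /a /b; lra.
have cc' : c <= c' by rewrite /c /c'; lra.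
have ea : e <= a by rewrite /a; lra.
have hx : a < Re z < b by rewrite /a /b; apply/andP; split; lra.
have hy : c < Im z < c' by rewrite /c /c'; apply/andP; split; lra.
have hq x y : a <= x <= b -> c <= y <= c' -> exists D, cderiv (ext0 F) (x +i* y) D.
  move=> /andP[ax _] _; apply: holomorphic_holo => //=.
  by rewrite (lt_le_trans e0)// (le_trans ea).
rewrite -normcM -(cauchy_formula hx hy hq).
have dist x y : (x == a) || (x == b) || (y == c) || (y == c') -> d <= normc (x +i* y - z).
  have := normc_Re (x +i* y - z); rewrite ReD ReN /= => hre.
  have := normc_Im (x +i* y - z); rewrite ImD ImN /= => him.
  move=> /orP[/orP[/orP[]|]|] /eqP E; rewrite ?E in hre him *.
  - apply: le_trans hre; rewrite ler_normr; apply/orP; right; rewrite /a; lra.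
  - apply: le_trans hre; rewrite ler_normr; apply/orP; left; rewrite /b; lra.
  - apply: le_trans him; rewrite ler_normr; apply/orP; right; rewrite /c; lra.
  - apply: le_trans him; rewrite ler_normr; apply/orP; left; rewrite /c'; lra.
have nz x y : (x == a) || (x == b) || (y == c) || (y == c') -> x +i* y != z.
  by move=> /dist h; rewrite -subr_eq0 -normc_gt0 (lt_le_trans d0).
have ctr : contour (fun w => ext0 F w * (w - z)^-1) a b c c'.
  apply: cderiv_contour => // x y xr yr /nz xyz.
  have [D hD] := hq x y xr yr; have [D' hD'] := cderiv_inv_sub xyz.
  by eexists; exact: cderivM hD hD'.
have [/vcont_int q1 /vcont_int q2 /hcont_int q3 /hcont_int q4] := ctr.
have bnd x y : e <= x -> (x == a) || (x == b) || (y == c) || (y == c') ->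
    ((normc (ext0 F (x +i* y) * (x +i* y - z)^-1))%:E <=
     d^-1%:E * (1 + clamp_sqr F e (x, y)))%E.
  move=> ex B; rewrite clamp_sqrE// normcM normcV -EFinD -EFinM lee_fin mulrC.
  apply: ler_pM; rewrite ?invr_ge0 ?normc_ge0//; last exact: normc_le_1Dsqr.
  by rewrite lef_pV2 ?posrE ?dist// (lt_le_trans d0)// dist.
have side (g1 g2 : M -> \bar R) (f : M -> R[i]) (u v : R) (L1 L2 : \bar R) : 
    u <= v -> v - u <= 3 * d ->
    cintegrable leb `[u, v] f -> measurable_fun setT g1 -> measurable_fun setT g2 ->
    (forall t, 0 <= g1 t)%E -> (forall t, 0 <= g2 t)%E ->
    (\int[leb]_(t in `[u, v]) g1 t <= L1)%E -> (\int[leb]_(t in `[u, v]) g2 t <= L2)%E ->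
    (forall t, u <= t <= v -> ((normc (f t))%:E <= d^-1%:E * (1 + g1 t) + d^-1%:E * (1 + g2 t))%E) ->
    ((normc (sint f u v))%:E <= (2 / d)%:E * ((6 * d)%:E + (L1 + L2)))%E.
  move=> uv vu cf mg1 mg2 g10 g20 gL1 gL2 fg.
  have m1 : measurable_fun setT (fun t : M => (1 + g1 t)%E).
    by apply: emeasurable_funD => //; exact: measurable_cst.
  have m2 : measurable_fun setT (fun t : M => (1 + g2 t)%E).
    by apply: emeasurable_funD => //; exact: measurable_cst.
  have di : 0 <= d^-1 by rewrite invr_ge0 ltW.
  have int1 (g : M -> \bar R) (L : \bar R) : measurable_fun setT g -> (forall t, 0 <= g t)%E ->
      (\int[leb]_(t in `[u, v]) g t <= L)%E ->
      (\int[leb]_(t in `[u, v]) (d^-1%:E * (1 + g t)) <= d^-1%:E * ((3 * d)%:E + L))%E.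
    move=> mg g0 gL; have mg' := @measurable_funTS _ _ _ _ `[u, v]%classic _ mg.
    have h1 : measurable_fun `[u, v]%classic (fun t : M => (1 + g t)%E).
      by apply: emeasurable_funD => //; exact: measurable_cst.
    have h2 (t : M) : (0 <= 1 + g t)%E by rewrite adde_ge0.
    have -> : (\int[leb]_(t in `[u, v]) (d^-1%:E * (1 + g t)) =
        d^-1%:E * \int[leb]_(t in `[u, v]) (1 + g t))%E.
      by apply: ge0_integralZl => //; rewrite lee_fin.
    apply: lee_wpmul2l; first by rewrite lee_fin.
    rewrite ge0_integralD//; apply: leeD => //.
    rewrite integral_cst// mul1e.
    by rewrite [leLHS](lebesgue_measure_segment uv) lee_fin.
  have mgg1 : measurable_fun `[u, v]%classic (fun t : M => d^-1%:E * (1 + g1 t))%E.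
    by apply: measurable_funeM; exact: measurable_funTS.
  have mgg2 : measurable_fun `[u, v]%classic (fun t : M => d^-1%:E * (1 + g2 t))%E.
    by apply: measurable_funeM; exact: measurable_funTS.
  have fg' (t : M) : `[u, v]%classic t ->
      ((normc (f t))%:E <= d^-1%:E * (1 + g1 t) + d^-1%:E * (1 + g2 t))%E.
    by rewrite /= in_itv; exact: fg.
  apply: (le_trans (normc_cint_lee _ cf (emeasurable_funD mgg1 mgg2) fg')) => //.
  rewrite EFinM -muleA; apply: lee_wpmul2l; first by rewrite lee_fin.
  rewrite ge0_integralD//; last 2 first.
  - by move=> t _; rewrite mule_ge0 ?adde_ge0// lee_fin.
  - by move=> t _; rewrite mule_ge0 ?adde_ge0// lee_fin.
  have L10 : (0 <= L1)%E by apply: le_trans gL1; exact: integral_ge0.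
  have L20 : (0 <= L2)%E by apply: le_trans gL2; exact: integral_ge0.
  apply: (le_trans (leeD (int1 _ _ mg1 g10 gL1) (int1 _ _ mg2 g20 gL2))).
  have d30 : (0 <= (3 * d)%:E)%E by rewrite lee_fin; lra.
  rewrite -ge0_muleDr ?adde_ge0//.
  rewrite addeACA -EFinD (_ : 3 * d + 3 * d = 6 * d)//; lra.
have lineT x : (\int[leb]_(t in `[c, c']) clamp_sqr F e (x, t) <= clamp_line F e x)%E.
  apply: ge0_subset_integral => //; first exact: measurable_clamp_sqr1.
  by move=> t _; exact: clamp_sqr_ge0.
have -> : ((12 * d)%:E = (6 * d)%:E + (6 * d)%:E)%E by rewrite -EFinD; congr EFin; lra.
have d60 : (0 <= (6 * d)%:E)%E by rewrite lee_fin; lra.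
have sr0 y : (0 <= strip_row F e (Re z - 2 * d) (Re z + 2 * d) y)%E.
  by apply: integral_ge0 => t _; exact: clamp_sqr_ge0.
have cl0 x : (0 <= clamp_line F e x)%E by exact: clamp_line_ge0.
rewrite addeACA ge0_muleDr; [|exact: adde_ge0 d60 (adde_ge0 (cl0 _) (cl0 _))|
  exact: adde_ge0 d60 (adde_ge0 (sr0 _) (sr0 _))].
apply: (@le_trans _ _ ((normc (sint (fun y => ext0 F (b +i* y) * (b +i* y - z)^-1 -
     ext0 F (a +i* y) * (a +i* y - z)^-1) c c'))%:E +
   (normc (sint (fun x => ext0 F (x +i* c') * (x +i* c' - z)^-1 -
     ext0 F (x +i* c) * (x +i* c - z)^-1) a b))%:E)%E).
  rewrite -EFinD lee_fin /rect (le_trans (normcD _ _))// normcN normcM normc_i mul1r.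
  by [].
have sub x y : ((normc (ext0 F x * (x - z)^-1 - ext0 F y * (y - z)^-1))%:E <=
    (normc (ext0 F x * (x - z)^-1))%:E + (normc (ext0 F y * (y - z)^-1))%:E)%E.
  by rewrite -EFinD lee_fin (le_trans (normcD _ _))// normcN.
apply: leeD.
  apply: (side (fun y => clamp_sqr F e (b, y)) (fun y => clamp_sqr F e (a, y))) => //;
    try (by move=> t; exact: clamp_sqr_ge0); try exact: measurable_clamp_sqr1.
  - by rewrite /c /c'; lra.
  - exact: cintegrableB.
  move=> t _; apply: (le_trans (sub _ _)); apply: leeD; apply: bnd; rewrite ?eqxx ?orbT//.
  exact: le_trans ab.
have srT y : (\int[leb]_(t in `[a, b]) clamp_sqr F e (t, y) <=
    strip_row F e (Re z - 2 * d) (Re z + 2 * d) y)%E.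
  apply: ge0_subset_integral => //.
    by apply: measurable_funTS; exact: measurable_clamp_sqr2.
    by move=> t _; exact: clamp_sqr_ge0.
  move=> t /=; rewrite !in_itv /= /a /b => /andP[? ?]; apply/andP; split; lra.
apply: (side (fun x => clamp_sqr F e (x, c')) (fun x => clamp_sqr F e (x, c))) => //;
  try (by move=> t; exact: clamp_sqr_ge0); try exact: measurable_clamp_sqr2.
- by rewrite /a /b; lra.
- exact: cintegrableB.
move=> t /andP[ta _]; apply: (le_trans (sub _ _)); apply: leeD; apply: bnd; rewrite ?eqxx ?orbT//.
  exact: le_trans ta.
exact: le_trans ta.
Qed.

End square_estimate.

Section boundedness.
Context {R : realType}.
Local Notation leb := (@lebesgue_measure R).
Local Notation M := (measurableTypeR R).
Implicit Types (nu : zenMeasure R) (F : Cplus R -> R[i]^o).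

Lemma measurable_strip_row F (e a b : R) : holomorphic F -> 0 < e ->
  measurable_fun setT (strip_row F e a b) /\
  (\int[leb]_y strip_row F e a b y = \int[leb]_(x in `[a, b]) clamp_line F e x)%E.
Proof.
move=> hF e0; pose I : set M := `[a, b]%classic.
have mI : measurable I by exact: measurable_itv.
pose f (p : M * M) : \bar R := (clamp_sqr F e p * (\1_I p.1)%:E)%E.
have mf : measurable_fun setT f.
  apply: emeasurable_funM; first exact: measurable_clamp_sqr.
  apply/measurable_EFinP; apply: measurableT_comp (measurable_indic mI) _.
  exact: measurable_fst.
have f0 p : (0 <= f p)%E.
  by apply: mule_ge0; [exact: clamp_sqr_ge0|rewrite lee_fin].
have rowE y : strip_row F e a b y = (\int[leb]_x f (x, y))%E.
  by rewrite /strip_row integral_mkcond epatch_indic.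
split.
  apply: eq_measurable_fun (measurable_fun_fubini_tonelli_G (m1 := leb) _ mf f0).
  by move=> y _; rewrite rowE.
under eq_integral do rewrite rowE.
rewrite -(@fubini_tonelli _ _ M M R leb leb f mf f0) [RHS]integral_mkcond epatch_indic.
apply: eq_integral => x _; rewrite /f /= -ge0_integralZr//.
- exact: measurable_clamp_sqr1.
- by move=> y _; exact: clamp_sqr_ge0.
Qed.

Lemma ge0_shift_segment_le (f : M -> \bar R) (t u v d : R) (K : \bar R) :
  measurable_fun setT f -> (forall x, (0 <= f x)%E) ->
  u <= t -> t + d <= v -> (\int[leb]_(x in `[u, v]) f x <= K)%E ->
  (\int[leb]_(s in `[0%R, d]) f (t + s)%R <= K)%E.
Proof.
move=> mf f0 ut tv; apply: le_trans.
under eq_integral do rewrite addrC.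
rewrite ge0_integral_translate_segment//; apply: ge0_subset_integral => //.
  exact: measurable_funTS.
move=> x /=; rewrite !in_itv /= => /andP[? ?]; apply/andP; split; lra.
Qed.

Lemma average_core (f1 f2 f3 f4 : M -> \bar R) (c e A : R) : 0 < e -> 0 <= c ->
  measurable_fun `[0, e]%classic f1 -> measurable_fun `[0, e]%classic f2 ->
  measurable_fun `[0, e]%classic f3 -> measurable_fun `[0, e]%classic f4 ->
  (forall s, 0 <= f1 s)%E -> (forall s, 0 <= f2 s)%E ->
  (forall s, 0 <= f3 s)%E -> (forall s, 0 <= f4 s)%E ->
  (\int[leb]_(s in `[0%R, e]) f1 s <= A%:E)%E -> (\int[leb]_(s in `[0%R, e]) f2 s <= A%:E)%E ->
  (\int[leb]_(s in `[0%R, e]) f3 s <= A%:E)%E -> (\int[leb]_(s in `[0%R, e]) f4 s <= A%:E)%E ->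
  (forall s, 0 <= s <= e ->
     (c%:E <= (2 / e)%:E * ((12 * e)%:E + (f1 s + f2 s + (f3 s + f4 s))))%E) ->
  c * e <= (2 / e) * (12 * e * e + 4 * A).
Proof.
move=> e0 c0 m1 m2 m3 m4 p1 p2 p3 p4 I1 I2 I3 I4 H.
have q12 s : (0 <= f1 s + f2 s)%E := adde_ge0 (p1 s) (p2 s).
have q34 s : (0 <= f3 s + f4 s)%E := adde_ge0 (p3 s) (p4 s).
have m12 : measurable_fun `[0, e]%classic (fun s => f1 s + f2 s)%E by exact: emeasurable_funD.
have m34 : measurable_fun `[0, e]%classic (fun s => f3 s + f4 s)%E by exact: emeasurable_funD.
have IT : (\int[leb]_(s in `[0%R, e]) (f1 s + f2 s + (f3 s + f4 s)) <= (4 * A)%:E)%E.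
  have -> : (4 * A = (A + A) + (A + A)) by lra.
  by rewrite !EFinD !ge0_integralD//; apply: leeD; apply: leeD.
have [T [mT T0 IT' H']] : exists T : M -> \bar R, [/\ measurable_fun `[0, e]%classic T,
    (forall s, 0 <= T s)%E, (\int[leb]_(s in `[0%R, e]) T s <= (4 * A)%:E)%E &
    (forall s, 0 <= s <= e -> (c%:E <= (2 / e)%:E * ((12 * e)%:E + T s))%E)].
  exists (fun s => f1 s + f2 s + (f3 s + f4 s))%E; split => //.
  - exact: emeasurable_funD.
  - by move=> s; exact: adde_ge0 (q12 s) (q34 s).
have mT1 : measurable_fun `[0, e]%classic (fun s => (12 * e)%:E + T s)%E.
  by apply: emeasurable_funD => //; exact: measurable_cst.
have e120 : (0 <= (12 * e)%:E)%E by rewrite lee_fin; lra.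
have T10 s : (0 <= (12 * e)%:E + T s)%E := adde_ge0 e120 (T0 s).
have e2 : 0 <= 2 / e by rewrite divr_ge0// ltW.
rewrite -lee_fin.
apply: (@le_trans _ _ (\int[leb]_(s in `[0%R, e]) ((2 / e)%:E * ((12 * e)%:E + T s)))%E).
  have -> : ((c * e)%:E = \int[leb]_(s in `[0%R, e]) (c%:E))%E.
    rewrite integral_cst// EFinM; congr (_ * _)%E.
    by rewrite [RHS](lebesgue_measure_segment (ltW e0)) subr0.
  apply: ge0_le_integral => //.
  exact: measurable_funeM.
have -> : (\int[leb]_(s in `[0%R, e]) ((2 / e)%:E * ((12 * e)%:E + T s)) =
    (2 / e)%:E * \int[leb]_(s in `[0%R, e]) ((12 * e)%:E + T s))%E.
  by apply: ge0_integralZl => //; rewrite lee_fin.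
rewrite [leRHS]EFinM; apply: lee_wpmul2l; first by rewrite lee_fin.
rewrite ge0_integralD// EFinD; apply: leeD => //.
rewrite integral_cst// [leRHS]EFinM; apply: lee_wpmul2l => //.
by rewrite [leLHS](lebesgue_measure_segment (ltW e0)) subr0.
Qed.

(** Integrating over s in [0, e] turns the line integrals into integrals over a strip. *)
Lemma average_bound (L V : M -> \bar R) (c e a b A x1 y1 y2 : R) : 0 < e -> 0 <= c ->
  measurable_fun setT L -> measurable_fun setT V ->
  (forall x, (0 <= L x)%E) -> (forall x, (0 <= V x)%E) ->
  (\int[leb]_(x in `[a, b]) L x <= A%:E)%E -> (\int[leb]_y V y <= A%:E)%E ->
  a <= x1 -> x1 + e <= b -> a + e <= b ->
  (forall s, 0 <= s <= e -> (c%:E <= (2 / e)%:E * ((12 * e)%:E +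
     (L (x1 + s)%R + L (a + s)%R + (V (y1 + s)%R + V (y2 + s)%R))))%E) ->
  c * e <= (2 / e) * (12 * e * e + 4 * A).
Proof.
move=> e0 c0 mL mV L0 V0 IL IV ax1 x1b aeb H.
have Vle t : (\int[leb]_(s in `[0%R, e]) V (t + s)%R <= A%:E)%E.
  apply: (@ge0_shift_segment_le V t t (t + e)) => //.
  by apply: le_trans IV; exact: ge0_subset_integral.
have Lle1 : (\int[leb]_(s in `[0%R, e]) L (x1 + s)%R <= A%:E)%E.
  exact: (@ge0_shift_segment_le L x1 a b).
have Lle2 : (\int[leb]_(s in `[0%R, e]) L (a + s)%R <= A%:E)%E.
  exact: (@ge0_shift_segment_le L a a b).
have mshift (f : M -> \bar R) (t : R) : measurable_fun setT f ->
    measurable_fun `[0, e]%classic (fun s : M => f (t + s)).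
  by move=> mf; apply: measurable_funTS; apply: measurableT_comp mf _; exact: measurable_funD.
apply: (@average_core (fun s => L (x1 + s)) (fun s => L (a + s)) (fun s => V (y1 + s))
  (fun s => V (y2 + s))) => //; exact: mshift.
Qed.

(** The averaged Cauchy estimate bounds |F z| by the integral of |F|^2 over a vertical
    strip of fixed width around z, and this integral by the Zen norm, because nu
    charges every neighbourhood of 0. *)
Theorem zen_bounded nu F (d : R) : holomorphic F -> (zen_sqnorm nu F < +oo)%E ->
  0 < d -> exists K, forall z, d <= Re z -> normc (ext0 F z) <= K.
Proof.
move=> hF fF d0; pose e := d / 4; have e0 : 0 < e by rewrite divr_gt0.
have c0 : 0 < normc (residue_constant : R[i]) by rewrite normc_gt0 residue_constant_neq0.
have v0 : (0 < zen_sf nu `[0%R, e[)%E by have [+ _] := zen_doubling nu; exact.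
have vfin : (zen_sf nu `[0%R, e[ < +oo)%E.
  have [+ _ _] := zen_regular nu => /(_ _ (@segment_compact R 0 e)).
  apply: le_lt_trans; apply: le_measure; rewrite ?inE; try exact: measurable_itv.
  by move=> x /=; rewrite !in_itv /= => /andP[-> /ltW].
have {vfin} vfin : zen_sf nu `[0%R, e[ \is a fin_num by rewrite ge0_fin_numE// ltW.
have Nfin : zen_sqnorm nu F \is a fin_num by rewrite ge0_fin_numE// zen_sqnorm_ge0.
pose v := fine (zen_sf nu `[0%R, e[); pose N := fine (zen_sqnorm nu F).
have vE : zen_sf nu `[0%R, e[ = v%:E by rewrite fineK.
have NE : zen_sqnorm nu F = N%:E by rewrite fineK.
rewrite vE lte_fin in v0.
pose A := (4 * e + e) * N / v.
exists ((2 / e) * (12 * e * e + 4 * A) / e / normc (residue_constant : R[i])) => z dz.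
set a := Re z - 2 * e; set b := Re z + 2 * e.
have strip : (\int[leb]_(x in `[a, b]) clamp_line F e x <= A%:E)%E.
  have e2 : 2 * e <= a by rewrite /a /e; lra.
  have ab : a <= b by rewrite /a /b; lra.
  have := strip_integral_le nu hF e0 e2 ab.
  rewrite vE NE -lee_pdivlMl// => /le_trans; apply.
  rewrite -!EFinM lee_fin /A le_eqVlt; apply/orP; left; apply/eqP.
  by rewrite /a /b; field; rewrite gt_eqF.
have [mV VE] := @measurable_strip_row F e a b hF e0.
have mL := measurable_clamp_line hF e0.
have L0 x : (0 <= clamp_line F e x)%E := clamp_line_ge0 F e x.
have V0 y : (0 <= strip_row F e a b y)%E.
  by apply: integral_ge0 => t _; exact: clamp_sqr_ge0.
have IV : (\int[leb]_y strip_row F e a b y <= A%:E)%E by rewrite VE.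
have c1 : 0 <= normc (ext0 F z) * normc (residue_constant : R[i]) by rewrite mulr_ge0 ?normc_ge0.
have ez : e <= Re z - 2 * e by rewrite /e; lra.
have x1 : a <= Re z + e by rewrite /a; lra.
have x2 : Re z + e + e <= b by rewrite /b; lra.
have x3 : a + e <= b by rewrite /a /b; lra.
rewrite (ler_pdivlMr _ _ c0) (ler_pdivlMr _ _ e0).
exact: (average_bound e0 c1 mL mV L0 V0 strip IV x1 x2 x3
  (fun s hs => square_estimate hF e0 e0 ez hs)).
Qed.

End boundedness.

(** * Convolution operators on Zen spaces *)

Lemma weighted_amgm (R : realDomainType) (a b m : R) : 0 <= a ->
  2 * m * (a * b) <= m ^+ 2 * a + a * b ^+ 2.
Proof.
move=> a0; rewrite -subr_ge0 (_ : _ - _ = a * (m - b) ^+ 2); last by ring.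
by rewrite mulr_ge0 ?sqr_ge0.
Qed.

Lemma quadratic_discriminant (R : realFieldType) (J Q k : R) :
  0 <= k -> 0 <= J -> 0 <= Q -> (forall m, 2 * m * J <= m ^+ 2 * k + Q) ->
  J ^+ 2 <= k * Q.
Proof.
rewrite le_eqVlt => /predU1P[<-|k0] J0 Q0 quad.
  have [->|J1] := eqVneq J 0; first by rewrite expr0n mul0r.
  have := quad ((Q + 1) / J); rewrite mulr0 add0r -mulrA divfK//.
  by rewrite leNgt (_ : Q < _)//; lra.
have := quad (J / k).
have -> : 2 * (J / k) * J = 2 * (J ^+ 2 / k) by field; rewrite gt_eqF.
have -> : (J / k) ^+ 2 * k = J ^+ 2 / k by field; rewrite gt_eqF.
by rewrite -ler_pdivrMl// [k^-1 * _]mulrC; lra.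
Qed.

Section convolution.
Context {d : measure_display} {Y : measurableType d} {R : realType}.
Variable mu : {sigma_finite_measure set Y -> \bar R}.
Variables (k u : Y -> R[i]).
Hypothesis mkRe : measurable_fun setT (fun y => Re (k y)).
Hypothesis mkIm : measurable_fun setT (fun y => Im (k y)).
Hypothesis muRe : measurable_fun setT (fun y => Re (u y)).
Hypothesis muIm : measurable_fun setT (fun y => Im (u y)).
Hypothesis u0 : forall y, 0 <= Re (u y).
Hypothesis ik : mu.-integrable setT (EFin \o (fun y => normc (k y))).
Local Notation leb := (@lebesgue_measure R).
Local Notation M := (measurableTypeR R).
Local Notation C := (R[i]^o).
Implicit Types (nu : zenMeasure R) (F G : Cplus R -> C) (z : R[i]) (e : R).

Lemma ReDu z y : 0 < Re z -> 0 < Re (z + u y).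
Proof. by move=> z0; rewrite ReD ltr_pwDl. Qed.

Lemma holomorphic_cst (a : C) : holomorphic (fun _ : Cplus R => a).
Proof.
move=> z z0; apply: (@cderiv_derivable _ _ _ 0).
have z0' : 0 < Re z by [].
apply: (@eq_cderiv_near _ (fun=> a) _ z 0 (Re z) z0' _ (cderiv_cst a z)) => w wz.
rewrite /ext0 insubT//=; have := le_lt_trans (normc_Re _) wz.
by rewrite ReD ReN ltr_norml => /andP[]; lra.
Qed.

Lemma ext0_in F z (z0 : 0 < Re z) : ext0 F z = F (exist _ z z0).
Proof. by rewrite /ext0 insubT. Qed.

Lemma measurable_normc_shift F z : holomorphic F -> 0 < Re z ->
  measurable_fun setT (fun y : Y => normc (ext0 F (z + u y))).
Proof.
move=> hF z0.
have mp : measurable_fun setT (fun y : Y => (Re (u y), Im z + Im (u y)) : M * M).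
  by apply/measurable_fun_pair => //=; exact: measurable_funD.
have := measurable_comp (@measurable_half_space R) _ (measurable_half_plane_normc hF z0) mp.
have sub : [set (Re (u y), Im z + Im (u y)) | y in setT] `<=` `[0%R, +oo[%classic `*` setT.
  by move=> _ [y _ <-]; split => //=; rewrite in_itv /= andbT.
move=> /(_ sub); apply: eq_measurable_fun => y _.
rewrite /= /half_plane_normc /=; congr (normc (ext0 F _)).
by apply: eq_complexP; rewrite ?ReD ?ImD //= addrC.
Qed.

(** Measurability is known for moduli only; the identities
    |w + 1|^2 - |w|^2 - 1 = 2 Re w and |w + i|^2 - |w|^2 - 1 = 2 Im w recover the parts. *)
Lemma measurable_shift_ext0 F z : holomorphic F -> 0 < Re z ->
  measurable_fun setT (fun y : Y => Re (ext0 F (z + u y))) /\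
  measurable_fun setT (fun y : Y => Im (ext0 F (z + u y))).
Proof.
move=> hF z0.
have m0 : measurable_fun setT (fun y : Y => normc (ext0 F (z + u y)) ^+ 2).
  by apply: measurable_funX; exact: measurable_normc_shift.
have m1 a : measurable_fun setT (fun y : Y => normc (ext0 (F + (fun=> a)) (z + u y)) ^+ 2).
  have hFa : holomorphic (F + (fun=> a)) := holomorphicD hF (@holomorphic_cst a).
  exact: measurable_funX _ (measurable_normc_shift hFa z0).
have addE a y : ext0 (F + (fun=> a)) (z + u y) = ext0 F (z + u y) + a.
  by have h := ReDu y z0; rewrite !(ext0_in _ h).
have sq (v : R[i]) : normc v ^+ 2 = Re v ^+ 2 + Im v ^+ 2 by exact: normc_sqr.
split.
  have : measurable_fun setT (fun y : Y => 2^-1 *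
      (normc (ext0 (F + (fun=> 1 : C)) (z + u y)) ^+ 2 - normc (ext0 F (z + u y)) ^+ 2 - 1)).
    apply: measurable_funM => //; apply: measurable_funB => //; exact: measurable_funB.
  by apply: eq_measurable_fun => y _; rewrite addE !sq ReD ImD /=; field.
have : measurable_fun setT (fun y : Y => 2^-1 *
    (normc (ext0 (F + (fun=> 'i%C : C)) (z + u y)) ^+ 2 - normc (ext0 F (z + u y)) ^+ 2 - 1)).
  apply: measurable_funM => //; apply: measurable_funB => //; exact: measurable_funB.
by apply: eq_measurable_fun => y _; rewrite addE !sq ReD ImD /=; field.
Qed.

Lemma measurable_cM (f : Y -> R[i]) :
  measurable_fun setT (fun y => Re (f y)) -> measurable_fun setT (fun y => Im (f y)) ->
  measurable_fun setT (fun y => Re (k y * f y)) /\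
  measurable_fun setT (fun y => Im (k y * f y)).
Proof.
move=> m1 m2; split.
  apply: (eq_measurable_fun (fun y => Re (k y) * Re (f y) - Im (k y) * Im (f y))).
    by move=> y _; rewrite ReM.
  by apply: measurable_funB; exact: measurable_funM.
apply: (eq_measurable_fun (fun y => Re (k y) * Im (f y) + Im (k y) * Re (f y))).
  by move=> y _; rewrite ImM.
by apply: measurable_funD; exact: measurable_funM.
Qed.

Definition k_mass : R := (\int[mu]_y normc (k y))%R.

Lemma k_mass_ge0 : 0 <= k_mass.
Proof. by apply: Rintegral_ge0 => y _; exact: normc_ge0. Qed.

Lemma integrable_kZ (K : R) : mu.-integrable setT (EFin \o (fun y => K * normc (k y))).
Proof.
by apply: eq_integrable (integrableZl measurableT K ik) => // y _ /=; rewrite EFinM.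
Qed.

Lemma cintegrable_kM (f : Y -> R[i]) (K : R) :
  measurable_fun setT (fun y => Re (f y)) -> measurable_fun setT (fun y => Im (f y)) ->
  (forall y, normc (f y) <= K) -> cintegrable mu setT (fun y => k y * f y).
Proof.
move=> m1 m2 fK; have [n1 n2] := measurable_cM m1 m2.
apply: (cintegrable_le _ n1 n2 (integrable_kZ K)) => // y _.
by rewrite normcM mulrC ler_wpM2r// normc_ge0.
Qed.

Lemma normc_cint_kM (f : Y -> R[i]) (K : R) :
  measurable_fun setT (fun y => Re (f y)) -> measurable_fun setT (fun y => Im (f y)) ->
  (forall y, normc (f y) <= K) ->
  normc (cint mu setT (fun y => k y * f y)) <= 2 * (K * k_mass).
Proof.
move=> m1 m2 fK.
have E : K * k_mass = (\int[mu]_y (K * normc (k y)))%R by rewrite RintegralZl.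
rewrite E; apply: normc_cint_le (cintegrable_kM m1 m2 fK) (integrable_kZ K) _ => // y _.
by rewrite normcM mulrC ler_wpM2r// normc_ge0.
Qed.

(** The measure space is left abstract: counting measure gives series of translations,
    Lebesgue measure gives integrals along lines and segments. *)
Definition conv_at F z : R[i] := cint mu setT (fun y => k y * ext0 F (z + u y)).
Definition conv_fun F : Cplus R -> C := fun s => conv_at F (val s).

Lemma ext0_conv F z : 0 < Re z -> ext0 (conv_fun F) z = conv_at F z.
Proof. by move=> z0; rewrite (ext0_in _ z0). Qed.

Definition bounded_inside F := forall e, 0 < e ->
  exists K, forall z, e <= Re z -> normc (ext0 F z) <= K.

Lemma cintegrable_conv F z : holomorphic F -> bounded_inside F -> 0 < Re z ->
  cintegrable mu setT (fun y => k y * ext0 F (z + u y)).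
Proof.
move=> hF bF z0; have [K hK] := bF _ z0.
have [m1 m2] := measurable_shift_ext0 hF z0.
by apply: (cintegrable_kM (K := K)) => // y; apply: hK; rewrite ReD lerDl.
Qed.

(** The derivatives at the points z + u y are limits of difference quotients along one
    sequence h n, hence measurable, and the uniform second order remainder can be
    integrated against k. *)
Lemma conv_cderiv F z : holomorphic F -> bounded_inside F -> 0 < Re z ->
  exists D, cderiv (conv_at F) z D.
Proof.
move=> hF bF z0; pose e := Re z / 2; have e0 : 0 < e by rewrite divr_gt0.
have [K0 hK0] := bF e e0.
have [K [K_ge0 hK]] := taylor2_uniform e0 (holomorphic_holo hF) hK0.
have zu y : 2 * e <= Re (z + u y) by rewrite ReD /e; have := u0 y; lra.
have [D hD] := choice (fun y => hK _ (zu y)).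
pose h (n : nat) : R := (e / 2) / n.+1%:R.
have hn0 n : 0 < h n by rewrite divr_gt0// divr_gt0.
have hne n : h n <= e / 2.
  by rewrite ler_pdivrMr// ler_peMr ?ler1n// divr_ge0// ltW.
have cvh : h n @[n --> \oo] --> 0.
  rewrite -[X in _ --> X](mulr0 (e / 2)); apply: cvgMl_tmp.
  by have := @cvg_harmonic R; apply.
pose q n y : R[i] := (h n)^-1%:C * (ext0 F (z + (h n)%:C + u y) - ext0 F (z + u y)).
have qD n y : normc (q n y - D y) <= K * h n.
  have hc : normc ((h n)%:C : R[i]) = h n by rewrite normc_real ger0_norm ?ltW.
  have := hD y (h n)%:C; rewrite hc => /(_ (hne n)).
  have -> : q n y - D y = (h n)^-1%:C * (ext0 F (z + u y + (h n)%:C) - ext0 F (z + u y) - D y * (h n)%:C).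
    rewrite [RHS]mulrBr [X in _ = _ - X]mulrC -mulrA -rmorphM divff ?gt_eqF// mulr1.
    by rewrite /q [z + _ + u y]addrAC.
  rewrite normcM normc_real ger0_norm ?invr_ge0 ?(ltW (hn0 n))// => H.
  rewrite ler_pdivrMl//; apply: (le_trans H).
  by rewrite le_eqVlt; apply/orP; left; apply/eqP; ring.
have mq n : measurable_fun setT (fun y => Re (q n y)) /\ measurable_fun setT (fun y => Im (q n y)).
  have zh : 0 < Re (z + (h n)%:C) by rewrite ReD /= addr_gt0.
  have [a1 a2] := measurable_shift_ext0 hF z0.
  have [b1 b2] := measurable_shift_ext0 hF zh.
  split.
    apply: (eq_measurable_fun (fun y => (h n)^-1 * (Re (ext0 F (z + (h n)%:C + u y)) - Re (ext0 F (z + u y))))).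
      by move=> y _; rewrite /q ReM ReD ReN /= mul0r subr0.
    by apply: measurable_funM => //; exact: measurable_funB.
  apply: (eq_measurable_fun (fun y => (h n)^-1 * (Im (ext0 F (z + (h n)%:C + u y)) - Im (ext0 F (z + u y))))).
    by move=> y _; rewrite /q ImM ImD ImN /= mul0r addr0.
  by apply: measurable_funM => //; exact: measurable_funB.
have small (eps : R) : 0 < eps -> \forall n \near \oo, K * h n < eps.
  move=> eps0; have : K * h n @[n --> \oo] --> K * 0 by apply: cvgMl_tmp.
  rewrite mulr0 => /cvgrPdist_lt/(_ _ eps0); apply: filterS => n.
  by rewrite sub0r normrN; apply: le_lt_trans; exact: ler_norm.
have mDRe : measurable_fun setT (fun y => Re (D y)).
  apply: (@measurable_fun_cvg _ _ _ _ (fun n y => Re (q n y))) => [n|y _]; first by case: (mq n).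
  apply/cvgrPdist_lt => eps /small; apply: filterS => n; apply: le_lt_trans.
  by rewrite -ReN -ReD (le_trans (normc_Re _))// normcB.
have mDIm : measurable_fun setT (fun y => Im (D y)).
  apply: (@measurable_fun_cvg _ _ _ _ (fun n y => Im (q n y))) => [n|y _]; first by case: (mq n).
  apply/cvgrPdist_lt => eps /small; apply: filterS => n; apply: le_lt_trans.
  by rewrite -ImN -ImD (le_trans (normc_Im _))// normcB.
have zue y : e <= Re (z + u y) by have := zu y; lra.
have Dbd y : normc (D y) <= K * h 0%N + (h 0%N)^-1 * (K0 + K0).
  rewrite (le_trans (normcBD _ (q 0%N y)))//; apply: lerD; first by rewrite normcB.
  rewrite normcM normc_real ger0_norm ?invr_ge0 ?(ltW (hn0 0%N))//; apply: ler_wpM2l.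
    by rewrite invr_ge0 ltW.
  rewrite (le_trans (normcD _ _))// normcN; apply: lerD; apply: hK0 => //.
  by rewrite addrAC ReD /=; have := zue y; have := hn0 0%N; lra.
exists (cint mu setT (fun y => k y * D y)) => eps eps0.
have km0 := k_mass_ge0.
exists (Num.min (e / 2) (eps / (2 * (K * k_mass) + 1))).
  rewrite lt_min !divr_gt0// ltr_wpDl//; apply: mulr_ge0 => //; exact: mulr_ge0.
move=> w; rewrite lt_min => /andP[w1 w2].
set v := w - z in w1 w2 *.
have wE : w = z + v by rewrite /v addrC subrK.
clearbody v.
have w0 : 0 < Re w.
  have := le_lt_trans (normc_Re _) w1; rewrite ltr_norml => /andP[hh _].
  have eE : Re z = 2 * e by rewrite /e; field.
  by rewrite wE ReD; lra.
have iD : cintegrable mu setT (fun y => k y * D y) by exact: cintegrable_kM mDRe mDIm Dbd.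
have i1 := cintegrable_conv hF bF w0; have i2 := cintegrable_conv hF bF z0.
have [a1 a2] := measurable_shift_ext0 hF z0.
have [b1 b2] := measurable_shift_ext0 hF w0.
pose r y := ext0 F (w + u y) - ext0 F (z + u y) - D y * v.
have rb y : normc (r y) <= K * normc v ^+ 2.
  by have := hD y v (ltW w1); rewrite /r wE [z + v + _]addrAC.
have mr1 : measurable_fun setT (fun y => Re (r y)).
  apply: (eq_measurable_fun (fun y => Re (ext0 F (w + u y)) - Re (ext0 F (z + u y)) -
    (Re (D y) * Re v - Im (D y) * Im v))).
    by move=> y _; rewrite /r !ReD !ReN ReM.
  apply: measurable_funB; first exact: measurable_funB.
  by apply: measurable_funB; exact: measurable_funM.
have mr2 : measurable_fun setT (fun y => Im (r y)).
  apply: (eq_measurable_fun (fun y => Im (ext0 F (w + u y)) - Im (ext0 F (z + u y)) -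
    (Re (D y) * Im v + Im (D y) * Re v))).
    by move=> y _; rewrite /r !ImD !ImN ImM.
  apply: measurable_funB; first exact: measurable_funB.
  by apply: measurable_funD; exact: measurable_funM.
have -> : conv_at F w - conv_at F z - cint mu setT (fun y => k y * D y) * v =
    cint mu setT (fun y => k y * r y).
  rewrite [_ * v]mulrC -(cintZ measurableT v iD) -(cintB measurableT i1 i2).
  rewrite -(cintB measurableT (cintegrableB measurableT i1 i2) (cintegrableZ measurableT v iD)).
  by apply: eq_cint => y _; rewrite /r; ring.
apply: (le_trans (normc_cint_kM mr1 mr2 rb)).
have v0 := normc_ge0 v; have Kk : 0 <= K * k_mass by exact: mulr_ge0.
move: w2; rewrite ltr_pdivlMr; last lra.
move: Kk v0; rewrite [K * _ * k_mass]mulrAC; move: (K * k_mass) (normc v) => t x t0 x0 H.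
have -> : 2 * (t * x ^+ 2) = (x * (2 * t)) * x by ring.
apply: ler_wpM2r => //; lra.
Qed.

Lemma holomorphic_conv F : holomorphic F -> bounded_inside F -> holomorphic (conv_fun F).
Proof.
move=> hF bF z z0; have [D hD] := conv_cderiv hF bF z0.
apply: (@cderiv_derivable _ _ _ D).
have z0' : 0 < Re z by [].
apply: (eq_cderiv_near z0' _ hD) => w wz.
rewrite ext0_conv//; have := le_lt_trans (normc_Re _) wz.
by rewrite ReD ReN ltr_norml => /andP[]; lra.
Qed.


Lemma measurable_normc_k : measurable_fun setT (fun y => normc (k y)).
Proof. by move/integrableP: ik => [/measurable_EFinP]. Qed.

Lemma k_massE : (\int[mu]_y (normc (k y))%:E)%E = k_mass%:E.
Proof.
rewrite /k_mass /Rintegral fineK//.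
exact: (integrable_fin_num measurableT ik).
Qed.

(** Cauchy-Schwarz for the density of total mass at most k_mass, through
    2 m |f| <= m^2 + |f|^2 for a well chosen constant m. *)
Lemma normc_conv_at_sqr F z : holomorphic F -> bounded_inside F -> 0 < Re z ->
  (((normc (conv_at F z)) ^+ 2)%:E <= (4 * k_mass)%:E *
    \int[mu]_y ((normc (k y))%:E * ((normc (ext0 F (z + u y))) ^+ 2)%:E))%E.
Proof.
move=> hF bF z0; have [K hK] := bF _ z0.
have gK y : normc (ext0 F (z + u y)) <= K by apply: hK; rewrite ReD lerDl.
pose g y := normc (ext0 F (z + u y)).
have g0 y : 0 <= g y by exact: normc_ge0.
have K0 y : 0 <= K := le_trans (g0 y) (gK y).
have mg : measurable_fun setT g by exact: measurable_normc_shift.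
have mk := measurable_normc_k.
have i1 : mu.-integrable setT (EFin \o (fun y => normc (k y) * g y)).
  apply: (le_integrable measurableT _ _ (integrable_kZ K)).
    by apply/measurable_EFinP; exact: measurable_funM.
  move=> y _ /=; rewrite lee_fin !ger0_norm ?mulr_ge0 ?normc_ge0 ?(K0 y)//.
  by rewrite mulrC ler_wpM2r ?normc_ge0//; exact: gK.
have i2 : mu.-integrable setT (EFin \o (fun y => normc (k y) * g y ^+ 2)).
  apply: (le_integrable measurableT _ _ (integrable_kZ (K ^+ 2))).
    by apply/measurable_EFinP; apply: measurable_funM => //; exact: measurable_funX.
  move=> y _ /=; rewrite lee_fin (ger0_norm (mulr_ge0 (normc_ge0 _) (sqr_ge0 _))).
  rewrite (ger0_norm (mulr_ge0 (sqr_ge0 _) (normc_ge0 _))) mulrC; apply: ler_wpM2r; first exact: normc_ge0.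
  by rewrite lerXn2r ?nnegrE ?g0 ?(K0 y)//; exact: gK.
pose J : R := (\int[mu]_y (normc (k y) * g y))%R.
pose Q : R := (\int[mu]_y (normc (k y) * g y ^+ 2))%R.
have QE : (\int[mu]_y ((normc (k y))%:E * ((normc (ext0 F (z + u y))) ^+ 2)%:E) = Q%:E)%E.
  rewrite /Q /Rintegral fineK; last exact: (integrable_fin_num measurableT i2).
  by apply: eq_integral => y _; rewrite EFinM.
rewrite QE -EFinM lee_fin.
have cJ : normc (conv_at F z) <= 2 * J.
  apply: normc_cint_le i1 _ => //; first exact: cintegrable_conv.
  by move=> y _; rewrite normcM.
have J0 : 0 <= J by apply: Rintegral_ge0 => y _; rewrite mulr_ge0 ?normc_ge0.
have Q0 : 0 <= Q by apply: Rintegral_ge0 => y _; rewrite mulr_ge0 ?normc_ge0 ?sqr_ge0.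
have quad m : 2 * m * J <= m ^+ 2 * k_mass + Q.
  rewrite /J /k_mass /Q -!RintegralZl//.
  have j1 : mu.-integrable setT (EFin \o (fun y => m ^+ 2 * normc (k y))) by exact: integrable_kZ.
  rewrite -RintegralD//; apply: le_Rintegral => //.
  - by apply: eq_integrable (integrableZl measurableT (2 * m) i1) => // y _ /=; rewrite EFinM.
  - by apply: eq_integrable (integrableD measurableT j1 i2) => // y _ /=; rewrite EFinD.
  by move=> y _; apply: weighted_amgm; exact: normc_ge0.
have J2 : J ^+ 2 <= k_mass * Q by exact: quadratic_discriminant k_mass_ge0 J0 Q0 quad.
apply: (@le_trans _ _ ((2 * J) ^+ 2)).
  by rewrite lerXn2r ?nnegrE ?normc_ge0 ?mulr_ge0.
have -> : (2 * J) ^+ 2 = 4 * J ^+ 2 by ring.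
by rewrite -mulrA; apply: ler_wpM2l.
Qed.

(** Tonelli: the imaginary part of u only translates a line along itself, and the real
    part moves it to another line. *)
Lemma line_sqnorm_conv F (x : R) : holomorphic F -> bounded_inside F -> 0 < x ->
  (line_sqnorm (conv_fun F) x <= (4 * k_mass)%:E *
    \int[mu]_t ((normc (k t))%:E * line_sqnorm F (x + Re (u t))%R))%E.
Proof.
move=> hF bF x0.
have hc := holomorphic_conv hF bF.
have km := k_mass_ge0.
have mk : measurable_fun setT (fun p : M * Y => (normc (k p.2))%:E).
  apply/measurable_EFinP; apply: measurableT_comp measurable_normc_k _.
  exact: measurable_snd.
pose f (p : M * Y) : \bar R :=
  ((normc (k p.2))%:E * clamp_sqr F x ((x + Re (u p.2))%R, (p.1 + Im (u p.2))%R))%E.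
have mp : measurable_fun setT (fun p : M * Y => ((x + Re (u p.2))%R, (p.1 + Im (u p.2))%R) : M * M).
  apply/measurable_fun_pair => /=.
    by apply: measurable_funD => //; apply: measurableT_comp muRe _; exact: measurable_snd.
  by apply: measurable_funD; [exact: measurable_fst|apply: measurableT_comp muIm _; exact: measurable_snd].
have mf : measurable_fun setT f.
  apply: emeasurable_funM => //.
  exact: measurableT_comp (measurable_clamp_sqr hF x0) mp.
have f0 p : (0 <= f p)%E by apply: mule_ge0; rewrite lee_fin ?normc_ge0 ?sqr_ge0.
have fE y t : f (y, t) = ((normc (k t))%:E * ((normc (ext0 F (x +i* y + u t))) ^+ 2)%:E)%E.
  rewrite /f /= clamp_sqrE ?lerDl//; congr (_ * ((normc (ext0 F _)) ^+ 2)%:E)%E.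
  by apply: eq_complexP; rewrite ?ReD ?ImD.
have mF := measurable_fun_fubini_tonelli_F (m2 := mu) f mf f0.
apply: (@le_trans _ _ (\int[leb]_y ((4 * k_mass)%:E * \int[mu]_t f (y, t)))%E).
  apply: ge0_le_integral => //.
  - by move=> y _; rewrite lee_fin sqr_ge0.
  - have := measurable_clamp_sqr1 x hc x0; apply: eq_measurable_fun => y _.
    by rewrite clamp_sqrE.
  - exact: measurable_funeM.
  move=> y _; under eq_integral do rewrite fE.
  by rewrite ext0_conv//; exact: normc_conv_at_sqr.
have -> : (\int[leb]_y ((4 * k_mass)%:E * \int[mu]_t f (y, t)) =
    (4 * k_mass)%:E * \int[leb]_y \int[mu]_t f (y, t))%E.
  apply: ge0_integralZl => //.
  - by move=> y _; exact: integral_ge0.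
  - by rewrite lee_fin mulr_ge0.
apply: lee_wpmul2l; first by rewrite lee_fin mulr_ge0.
rewrite (@fubini_tonelli _ _ M Y R leb mu f mf f0) le_eqVlt; apply/orP; left; apply/eqP.
apply: eq_integral => t _.
have x1 : x <= x + Re (u t) by rewrite lerDl.
have mc : measurable_fun setT (fun y : M => clamp_sqr F x (x + Re (u t), y)).
  exact: measurable_clamp_sqr1.
have c0 y : (0 <= clamp_sqr F x ((x + Re (u t))%R, y))%E by exact: clamp_sqr_ge0.
rewrite /f /= -(clamp_lineE _ x1) /clamp_line.
rewrite -(@ge0_integral_translate R setT (fun y => clamp_sqr F x (x + Re (u t), y))
  (Im (u t)) measurableT mc c0) preimage_setT.
rewrite -ge0_integralZl//.
  by apply: measurableT_comp mc _; exact: measurable_shift.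
by rewrite lee_fin normc_ge0.
Qed.

(** Moving lines to the right stays below the supremum that defines the Zen norm, which
    is why only nonnegative real parts of u are allowed. *)
Lemma zen_sqnorm_conv nu F : holomorphic F -> bounded_inside F ->
  (zen_sqnorm nu (conv_fun F) <= (4 * k_mass ^+ 2)%:E * zen_sqnorm nu F)%E.
Proof.
move=> hF bF; apply: ge_ereal_sup => _ [e e0 <-].
have hc := holomorphic_conv hF bF; have km := k_mass_ge0.
have N0 := zen_sqnorm_ge0 nu F.
rewrite zen_integralE//.
pose P : set M := `[0%R, +oo[%classic.
have mP : measurable P by exact: measurable_itv.
pose f (p : M * Y) : \bar R :=
  ((\1_P p.1)%:E * ((normc (k p.2))%:E * clamp_line F e (p.1 + e + Re (u p.2))%R))%E.
have mf : measurable_fun setT f.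
  apply: emeasurable_funM.
    apply/measurable_EFinP; apply: measurableT_comp (measurable_indic mP) _.
    exact: measurable_fst.
  apply: emeasurable_funM.
    apply/measurable_EFinP; apply: measurableT_comp measurable_normc_k _.
    exact: measurable_snd.
  apply: measurableT_comp (measurable_clamp_line hF e0) _.
  apply: measurable_funD; last by apply: measurableT_comp muRe _; exact: measurable_snd.
  by apply: measurableT_comp (measurable_shift e) _; exact: measurable_fst.
have L0 x : (0 <= clamp_line F e x)%E := clamp_line_ge0 F e x.
have f0 p : (0 <= f p)%E.
  by apply: mule_ge0; [rewrite lee_fin|apply: mule_ge0 => //; rewrite lee_fin normc_ge0].
have mF := measurable_fun_fubini_tonelli_F (m2 := mu) f mf f0.
have mG := measurable_fun_fubini_tonelli_G (m1 := zen_sf nu) f mf f0.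
apply: (@le_trans _ _ (\int[zen_sf nu]_x ((4 * k_mass)%:E * \int[mu]_t f (x, t)))%E).
  rewrite integral_mkcond; apply: ge0_le_integral => //.
  - by move=> x _; rewrite patchE; case: ifP => // _; exact: line_sqnorm_ge0.
  - apply/(measurable_restrictT _ _).1; first exact: measurable_itv.
    exact: measurable_line_sqnorm.
  - exact: measurable_funeM.
  move=> x _; rewrite patchE; case: ifPn => xP; last first.
    by apply: mule_ge0; [rewrite lee_fin mulr_ge0|exact: integral_ge0].
  have x0 : 0 <= x by move: xP; rewrite inE /= in_itv /= andbT.
  apply: (le_trans (line_sqnorm_conv hF bF _)); first by rewrite ltr_wpDl.
  apply: lee_wpmul2l; first by rewrite lee_fin mulr_ge0.
  rewrite le_eqVlt; apply/orP; left; apply/eqP; apply: eq_integral => t _.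
  by rewrite /f /= indicE xP mul1e clamp_lineE// -addrA addrCA lerDl addr_ge0.
have -> : (\int[zen_sf nu]_x ((4 * k_mass)%:E * \int[mu]_t f (x, t)) =
    (4 * k_mass)%:E * \int[zen_sf nu]_x \int[mu]_t f (x, t))%E.
  apply: ge0_integralZl => //.
  - by move=> y _; exact: integral_ge0.
  - by rewrite lee_fin mulr_ge0.
rewrite (_ : (4 * k_mass ^+ 2)%:E = (4 * k_mass)%:E * k_mass%:E)%E; last first.
  by rewrite -EFinM; congr EFin; ring.
rewrite -muleA; apply: lee_wpmul2l; first by rewrite lee_fin mulr_ge0.
rewrite (@fubini_tonelli _ _ M Y R (zen_sf nu) mu f mf f0) -k_massE.
rewrite -ge0_integralZr//; last 2 first.
- by apply/measurable_EFinP; exact: measurable_normc_k.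
- by move=> y _; rewrite lee_fin normc_ge0.
apply: ge0_le_integral => //.
- by move=> t _; exact: integral_ge0.
- apply: emeasurable_funM => //; apply/measurable_EFinP; exact: measurable_normc_k.
move=> t _.
have et : 0 < e + Re (u t) by rewrite ltr_pwDl.
apply: (@le_trans _ _ ((normc (k t))%:E * zen_integral nu F (e + Re (u t))%R)%E); last first.
  by apply: lee_wpmul2l; [rewrite lee_fin normc_ge0|exact: zen_integral_le].
rewrite zen_integralE// [in leRHS]integral_mkcond -ge0_integralZl//; last 3 first.
- apply/(measurable_restrictT _ _).1; first exact: measurable_itv.
  exact: measurable_line_sqnorm.
- by move=> x _; rewrite patchE; case: ifP => // _; exact: line_sqnorm_ge0.
- by rewrite lee_fin normc_ge0.
rewrite le_eqVlt; apply/orP; left; apply/eqP; apply: eq_integral => x _.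
rewrite /f /= patchE indicE; case: (boolP (x \in P)) => xP; last by rewrite mul0e mule0.
have x0 : 0 <= x by move: xP; rewrite inE /P /= in_itv /= andbT.
by rewrite mul1e clamp_lineE -?addrA// addrCA lerDl addr_ge0.
Qed.

Lemma zen_bounded_inside nu F : F \in zen_pred nu -> bounded_inside F.
Proof. by move=> /zen_predP[hF fF] e e0; exact: zen_bounded hF fF e0. Qed.

Lemma conv_zen nu F : F \in zen_pred nu -> conv_fun F \in zen_pred nu.
Proof.
move=> Fz; have bF := zen_bounded_inside Fz; move: Fz => /zen_predP[hF fF].
apply/zen_predP; split; first exact: holomorphic_conv.
apply: le_lt_trans (zen_sqnorm_conv nu hF bF) _.
by apply: lte_mul_pinfty => //; rewrite lee_fin mulr_ge0 ?sqr_ge0.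
Qed.

Definition conv_op nu (f : zenSpace nu) : zenSpace nu := ZenSpace (conv_zen (zen_funP f)).

Lemma conv_op_linear nu : linear (@conv_op nu).
Proof.
move=> a f g; apply/val_inj/funext => s /=.
rewrite /conv_fun /conv_at.
have s0 : 0 < Re (val s) by exact: valP s.
have i1 := cintegrable_conv (@zen_holo _ _ f) (zen_bounded_inside (zen_funP f)) s0.
have i2 := cintegrable_conv (@zen_holo _ _ g) (zen_bounded_inside (zen_funP g)) s0.
have -> : cint mu setT (fun y => k y * ext0 (zen_fun (a *: f + g)) (val s + u y)) =
    cint mu setT (fun y => a * (k y * ext0 f (val s + u y)) + k y * ext0 g (val s + u y)).
  apply: eq_cint => y _; have h := ReDu y s0; rewrite !(ext0_in _ h).
  pose v : Cplus R := @exist R[i] (fun z => is_true (0 < Re z)) _ h; rewrite -/v.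
  have -> : zen_fun (a *: f + g) v = a * zen_fun f v + zen_fun g v :> R[i] by [].
  by ring.
by rewrite (cintD _ (cintegrableZ measurableT a i1) i2)// cintZ.
Qed.

HB.instance Definition _ nu :=
  GRing.isLinear.Build R[i] (zenSpace nu) (zenSpace nu) _ (@conv_op nu) (@conv_op_linear nu).

Lemma conv_op_continuous nu : continuous (@conv_op nu).
Proof.
apply: bounded_linear_continuous; apply/linear_boundedP.
near=> r => f; apply: (@le_trans _ _ ((2 * k_mass)%:C * `|f|)); last first.
  apply: ler_wpM2r => //; near: r; apply: nbhs_pinfty_ge.
  by apply/complex_realP; exists (2 * k_mass).
have km := k_mass_ge0.
rewrite !zen_normE -rmorphM lecR.
have -> : 2 * k_mass = Num.sqrt (4 * k_mass ^+ 2).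
  rewrite (_ : 4 * k_mass ^+ 2 = (2 * k_mass) ^+ 2); last by ring.
  by rewrite sqrtr_sqr ger0_norm// mulr_ge0.
rewrite -sqrtrM ?mulr_ge0 ?sqr_ge0// ler_wsqrtr// -lee_fin EFinM !fineK ?zen_sqnorm_fin//.
apply: zen_sqnorm_conv; [exact: zen_holo|exact: zen_bounded_inside (zen_funP f)].
Unshelve. all: by end_near. Qed.

End convolution.

(** * Resolvents *)

Section counting_integral.
Context {R : realType}.
Local Notation cnt := (@counting nat R).

HB.instance Definition _ := Measure_isSigmaFinite.Build _ _ _ cnt (sigma_finite_counting R).

Lemma ge0_integral_counting_recl (f : nat -> \bar R) : (forall n, (0 <= f n)%E) ->
  (\int[cnt]_n f n = f 0%N + \int[cnt]_n f n.+1)%E.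
Proof.
move=> f0; rewrite !ge0_integral_count//.
rewrite nneseries_recl//; congr (_ + _)%E.
rewrite -(@nneseries_addn R f 1)//.
by apply: eq_eseriesr => n _; rewrite addn1.
Qed.

Lemma Rintegral_counting_recl (f : nat -> R) : cnt.-integrable setT (EFin \o f) ->
  (\int[cnt]_n f n = f 0%N + \int[cnt]_n f n.+1)%R.
Proof.
move=> /integrableP[_ fi].
have sfi : (\int[cnt]_n `|(f n.+1)%:E| < +oo)%E.
  apply: le_lt_trans fi; rewrite [leRHS]ge0_integral_counting_recl//.
  by rewrite leeDr.
have finP (g : nat -> R) : (\int[cnt]_n `|(g n)%:E| < +oo)%E ->
    (\int[cnt]_n ((EFin \o g)^\+ n))%E \is a fin_num /\
    (\int[cnt]_n ((EFin \o g)^\- n))%E \is a fin_num.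
  move=> gi; have ig : cnt.-integrable setT (EFin \o g) by apply/integrableP.
  split; rewrite ge0_fin_numE ?integral_ge0//.
    exact: integral_funepos_lt_pinfty ig.
  exact: integral_funeneg_lt_pinfty ig.
have [p1 p2] := finP _ fi; have [q1 q2] := finP (fun n => f n.+1) sfi.
have E : (\int[cnt]_n (f n)%:E = (f 0%N)%:E + \int[cnt]_n (f n.+1)%:E)%E.
  rewrite integralE [X in _ = _ + X]integralE.
  rewrite ge0_integral_counting_recl// [X in (_ - X)%E]ge0_integral_counting_recl//.
  have -> : (\int[cnt]_n (EFin \o f)^\+ n.+1 = \int[cnt]_n (EFin \o (fun n => f n.+1))^\+ n)%E.
    by apply: eq_integral => n _; rewrite !funeposE.
  have -> : (\int[cnt]_n (EFin \o f)^\- n.+1 = \int[cnt]_n (EFin \o (fun n => f n.+1))^\- n)%E.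
    by apply: eq_integral => n _; rewrite !funenegE.
  rewrite -(fineK q1) -(fineK q2) funeposE funenegE /= -!EFin_max -!EFinD.
  congr EFin; have -> : Num.max (f 0%N) 0 = f 0%N + Num.max (- f 0%N) 0; last by lra.
  by case: (leP (f 0%N) 0) => h; [rewrite max_l|rewrite max_r]; lra.
rewrite /Rintegral E fineD//.
by rewrite integralE fin_numB q1 q2.
Qed.

Lemma cint_counting_recl (f : nat -> R[i]) : cintegrable cnt setT f ->
  cint cnt setT f = f 0%N + cint cnt setT (fun n => f n.+1).
Proof.
move=> [f1 f2]; apply: eq_complexP; rewrite ?ReD ?ImD /=.
  exact: Rintegral_counting_recl.
exact: Rintegral_counting_recl.
Qed.

Lemma integrable_geometric (x : R) : 0 <= x -> x < 1 ->
  cnt.-integrable setT (EFin \o (fun n => x ^+ n)).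
Proof.
move=> x0 x1; pose y := (x + 1) / 2.
have y0 : 0 < y by rewrite divr_gt0// ltr_wpDl.
have y1 : y < 1 by rewrite /y; lra.
have xy : x <= y by rewrite /y; lra.
apply/integrableP; split=> //.
rewrite ge0_integral_count//.
apply: (@le_lt_trans _ _ ((1 - y)^-1)%:E); last exact: ltry.
apply: lime_le; first by apply: is_cvg_nneseries => n _.
near=> n; rewrite (eq_bigr (fun i => (x ^+ i)%:E)); last first.
  by move=> i _ /=; rewrite ger0_norm// exprn_ge0.
rewrite sumEFin lee_fin.
have ny : `|y| < 1 by rewrite ger0_norm// ltW.
have := geometric_le_lim n (@ler01 R) y0 ny; rewrite mul1r; apply: le_trans.
rewrite /series /=; apply: ler_sum => i _; rewrite /geometric /= mul1r.
by rewrite lerXn2r// nnegrE// ltW.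
Unshelve. all: by end_near. Qed.

End counting_integral.

Section inverses.
Context {R : realType} (nu : zenMeasure R).
Local Notation C := (R[i]^o).
Local Notation cnt := (@counting nat R).

Lemma not_spectrum_of_inverse (T S : {linear zenSpace nu -> zenSpace nu}) (l : R[i]) :
  continuous S -> (forall f, S (T f - l *: f) = f) -> (forall f, T (S f) - l *: S f = f) ->
  ~ spectrum T l.
Proof.
by move=> cS ST TS; apply; exists S; split.
Qed.

Lemma zen_eq (f g : zenSpace nu) : (forall z : R[i], 0 < Re z -> ext0 f z = ext0 g z) -> f = g.
Proof.
move=> h; apply/val_inj/funext => s; have := h (val s) (valP s).
by rewrite !ext0E.
Qed.

Lemma ext0_zenD (f g : zenSpace nu) z : ext0 (zen_fun (f + g)) z = ext0 f z + ext0 g z.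
Proof. by have -> : zen_fun (f + g) = (zen_fun f + zen_fun g)%R by []; rewrite ext0D. Qed.

Lemma ext0_zenZ (a : R[i]) (f : zenSpace nu) z : ext0 (zen_fun (a *: f)) z = a * ext0 f z.
Proof. by have -> : zen_fun (a *: f) = (a *: zen_fun f)%R by []; rewrite ext0Z. Qed.

Lemma ext0_zenB (f g : zenSpace nu) z : ext0 (zen_fun (f - g)) z = ext0 f z - ext0 g z.
Proof. by rewrite -scaleN1r ext0_zenD ext0_zenZ mulN1r. Qed.

Lemma ext0_comp_translate (s0 : R[i]) (Re_s0 : 0 <= Re s0) (f : zenSpace nu) z :
  0 < Re z -> ext0 (zen_fun (comp_translate Re_s0 f)) z = ext0 f (z + s0).
Proof. by move=> z0; exact: ext0_translate. Qed.

Lemma conv_op_comp_translate d (Y : measurableType d) (mu : {sigma_finite_measure set Y -> \bar R})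
    (k u : Y -> R[i]) (m1 : measurable_fun setT (fun y => Re (k y)))
    (m2 : measurable_fun setT (fun y => Im (k y))) (m3 : measurable_fun setT (fun y => Re (u y)))
    (m4 : measurable_fun setT (fun y => Im (u y))) (u0 : forall y, 0 <= Re (u y))
    (ik : mu.-integrable setT (EFin \o (fun y => normc (k y))))
    (s0 : R[i]) (Re_s0 : 0 <= Re s0) (f : zenSpace nu) :
  conv_op m1 m2 m3 m4 u0 ik (comp_translate Re_s0 f) =
  comp_translate Re_s0 (conv_op m1 m2 m3 m4 u0 ik f).
Proof.
apply: zen_eq => z z0; have zs : 0 < Re (z + s0) by rewrite ReD ltr_pwDl.
rewrite ext0_comp_translate// !ext0_conv//; apply: eq_cint => y _.
by rewrite ext0_comp_translate ?ReDu// addrAC.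
Qed.

(** Geometric series: the operator with kernel a r^n at the points v + n s is the
    solution N of N = a T_v + r T_s N. *)
Section geometric_operator.
Variables (a r v s : R[i]).
Hypothesis r1 : normc r < 1.
Hypothesis v0 : 0 <= Re v.
Hypothesis s0 : 0 <= Re s.

Definition geometric_coef (n : nat) : R[i] := a * r ^+ n.
Definition geometric_shift (n : nat) : R[i] := v + n%:R%:C * s.

Lemma geometric_shift_ge0 n : 0 <= Re (geometric_shift n).
Proof. by rewrite /geometric_shift ReD ReM /= mul0r subr0 addr_ge0// mulr_ge0. Qed.

Lemma integrable_geometric_coef :
  cnt.-integrable setT (EFin \o (fun n => normc (geometric_coef n))).
Proof.
have := integrableZl measurableT (normc a) (integrable_geometric (normc_ge0 r) r1).
by apply: eq_integrable => // n _ /=; rewrite /geometric_coef normcM normcX EFinM.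
Qed.

Lemma measurable_nat (f : nat -> R) : measurable_fun setT f.
Proof. by []. Qed.

Definition geometric_op : zenSpace nu -> zenSpace nu :=
  conv_op (mu := cnt) (measurable_nat (fun n => Re (geometric_coef n)))
  (measurable_nat (fun n => Im (geometric_coef n)))
  (measurable_nat (fun n => Re (geometric_shift n)))
  (measurable_nat (fun n => Im (geometric_shift n)))
  geometric_shift_ge0 integrable_geometric_coef (nu := nu).
HB.instance Definition _ := GRing.Linear.on geometric_op.

Lemma geometric_op_continuous : continuous geometric_op.
Proof. exact: conv_op_continuous. Qed.

Lemma geometric_op_recl f z : 0 < Re z ->
  ext0 (zen_fun (geometric_op f)) z =
  a * ext0 f (z + v) + r * ext0 (zen_fun (geometric_op f)) (z + s).
Proof.
move=> z0; have zs : 0 < Re (z + s) by rewrite ReD ltr_pwDl.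
have b := zen_bounded_inside (zen_funP f).
have i1 := cintegrable_conv (mu := cnt) (measurable_nat (fun n => Re (geometric_coef n)))
  (measurable_nat (fun n => Im (geometric_coef n)))
  (measurable_nat (fun n => Re (geometric_shift n)))
  (measurable_nat (fun n => Im (geometric_shift n)))
  geometric_shift_ge0 integrable_geometric_coef (@zen_holo _ _ f) b.
rewrite !ext0_conv// /conv_at (cint_counting_recl (i1 _ z0)); congr (_ + _).
  by rewrite /geometric_coef /geometric_shift expr0 mulr1 mul0r addr0.
rewrite -(cintZ measurableT r (i1 _ zs)); apply: eq_cint => n _.
rewrite /geometric_coef /geometric_shift.
have -> : z + (v + n.+1%:R%:C * s) = z + s + (v + n%:R%:C * s).
  by rewrite -natr1 rmorphD /=; ring.
by rewrite exprS; ring.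
Qed.

Lemma geometric_op_comp_translate (t0 : R[i]) (Re_t0 : 0 <= Re t0) f :
  geometric_op (comp_translate Re_t0 f) = comp_translate Re_t0 (geometric_op f).
Proof. exact: conv_op_comp_translate. Qed.

End geometric_operator.

(** Neumann series in 1 / l. *)
Lemma spectrum_le1 (s0 : R[i]) (Re_s0 : 0 <= Re s0) (l : R[i]) : 1 < normc l ->
  ~ spectrum (comp_translate Re_s0 (nu := nu)) l.
Proof.
move=> l1; have l0 : l != 0 by rewrite -normc_gt0 (lt_trans ltr01).
have r1 : normc l^-1 < 1 by rewrite normcV invf_lt1// (lt_trans ltr01).
have z0 : 0 <= Re (0 : R[i]) by [].
have right_inv f : comp_translate Re_s0 (geometric_op (- l^-1) r1 z0 Re_s0 f) -
    l *: geometric_op (- l^-1) r1 z0 Re_s0 f = f.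
  apply: zen_eq => z zp; rewrite ext0_zenB ext0_zenZ ext0_comp_translate//.
  by rewrite [X in _ - l * X]geometric_op_recl// addr0; field.
apply: (@not_spectrum_of_inverse _ (geometric_op (- l^-1) r1 z0 Re_s0)) => //.
- exact: geometric_op_continuous.
- by move=> f; rewrite linearB linearZ; apply: etrans (right_inv f);
    congr (_ - _); exact: geometric_op_comp_translate.
Qed.

(** For purely imaginary s0 the translation by - s0 is also bounded; Neumann series for
    the inverse. *)
Lemma spectrum_ge1 (s0 : R[i]) (Re_s0 : 0 <= Re s0) (l : R[i]) : Re s0 = 0 -> normc l < 1 ->
  ~ spectrum (comp_translate Re_s0 (nu := nu)) l.
Proof.
move=> s00 l1; have m0 : 0 <= Re (- s0) by rewrite ReN s00 oppr0.
have right_inv f : comp_translate Re_s0 (geometric_op 1 l1 m0 m0 f) -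
    l *: geometric_op 1 l1 m0 m0 f = f.
  apply: zen_eq => z zp; rewrite ext0_zenB ext0_zenZ ext0_comp_translate//.
  by rewrite geometric_op_recl ?ReD ?s00 ?addr0// addrK; ring.
apply: (@not_spectrum_of_inverse _ (geometric_op 1 l1 m0 m0)) => //.
- exact: geometric_op_continuous.
- by move=> f; rewrite linearB linearZ; apply: etrans (right_inv f);
    congr (_ - _); exact: geometric_op_comp_translate.
Qed.

End inverses.

(** * Complex exponential, logarithm and powers *)

Section exponential.
Context {R : realType}.
Implicit Types (z w h : R[i]) (x y : R).

Lemma cexpE z : cexp z = (expR (Re z) * cos (Im z)) +i* (expR (Re z) * sin (Im z)).
Proof. by rewrite /cexp; apply: eq_complexP; rewrite ?ReM ?ImM /=; ring. Qed.

Lemma cexpD z w : cexp (z + w) = cexp z * cexp w.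
Proof.
rewrite !cexpE ReD ImD expRD cosD sinD.
by apply: eq_complexP; rewrite ?ReM ?ImM /=; ring.
Qed.

Lemma cexp0 : cexp (0 : R[i]) = 1.
Proof. by rewrite cexpE /= expR0 cos0 sin0 !mul1r. Qed.

Lemma normc_cexp z : normc (cexp z) = expR (Re z).
Proof.
apply/eqP; rewrite -(@eqrXn2 _ 2)// ?normc_ge0 ?expR_ge0// normc_sqr cexpE /=.
by rewrite !exprMn -mulrDr cos2Dsin2 mulr1.
Qed.

Lemma cexp_neq0 z : cexp z != 0.
Proof. by rewrite -normc_gt0 normc_cexp expR_gt0. Qed.

Lemma cexpN z : cexp (- z) = (cexp z)^-1.
Proof.
apply: (mulfI (cexp_neq0 z)).
by rewrite -cexpD subrr cexp0 divff// cexp_neq0.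
Qed.

Lemma cexpB z w : cexp (z - w) = cexp z / cexp w.
Proof. by rewrite cexpD cexpN. Qed.

Lemma real_little_o (f : R -> R) (x D : R) : is_derive x (1 : R) f D ->
  forall e : R, 0 < e -> exists2 d : R, 0 < d & forall h : R, `|h| < d -> `|f (x + h) - f x - D * h| <= e * `|h|.
Proof.
move=> [df <-] e e0; move: df => /cvg_ex[/= l hl].
have -> : 'D_1 f x = l by apply: cvg_lim.
move/cvgrPdist_le: hl => /(_ e e0); rewrite /dnbhs /= => -[d /= d0 hd].
exists d => // h hd'; have [->|h0] := eqVneq h 0.
  by rewrite addr0 subrr mulr0 subrr normr0 mulr0.
have := hd h; rewrite /ball_ /= sub0r normrN => /(_ hd' h0).
rewrite [_ *: 1]mulr1 [h + x]addrC => H.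
have -> : f (x + h) - f x - l * h = h * (h^-1 * (f (x + h) - f x) - l) by field.
by rewrite normrM mulrC ler_wpM2r// distrC.
Qed.

Lemma little_o_Re (f : R -> R) (D : R) : is_derive 0 (1 : R) f D ->
  little_o 0 (fun h => (f (Re h) - f 0 - D * Re h)%:C).
Proof.
move=> /real_little_o hf e e0; have [d d0 hd] := hf e e0.
exists d => // w; rewrite subr0 => wd; rewrite normc_real.
have wr := normc_Re w; have := hd (Re w) (le_lt_trans wr wd); rewrite add0r => H.
by rewrite (le_trans H)// ler_wpM2l// ltW.
Qed.

Lemma little_o_Im (f : R -> R) (D : R) : is_derive 0 (1 : R) f D ->
  little_o 0 (fun h => (f (Im h) - f 0 - D * Im h)%:C).
Proof.
move=> /real_little_o hf e e0; have [d d0 hd] := hf e e0.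
exists d => // w; rewrite subr0 => wd; rewrite normc_real.
have wr := normc_Im w; have := hd (Im w) (le_lt_trans wr wd); rewrite add0r => H.
by rewrite (le_trans H)// ler_wpM2l// ltW.
Qed.

Lemma little_o_lipschitz z (r s : R[i] -> R[i]) : little_o z r ->
  (exists2 M : R, 0 < M & forall w, normc (s w) <= M * normc (w - z)) ->
  lipschitz_at z (fun w => r w + s w).
Proof.
move=> /(_ 1 ltr01)[d d0 hd] [M M0 hM]; exists (1 + M); first by rewrite addr_gt0.
exists d => // w /hd H; rewrite (le_trans (normcD _ _))// mulrDl.
by apply: lerD.
Qed.

(** Near 0 the exponential differs from 1 + h by terms which are products of, or
    themselves, real second order errors. *)
Lemma cderiv_cexp0 : cderiv cexp (0 : R[i]) 1.
Proof.
have dE : is_derive 0 (1 : R) (@expR R) 1 by rewrite -[X in is_derive _ _ _ X]expR0; exact: is_derive_expR.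
have dS : is_derive 0 (1 : R) (@sin R) 1 by rewrite -[X in is_derive _ _ _ X]cos0; exact: is_derive_sin.
have dC : is_derive 0 (1 : R) (@cos R) 0 by have := is_derive_cos (0 : R); rewrite sin0 oppr0.
have oE := little_o_Re dE; have oS := little_o_Im dS; have oC := little_o_Im dC.
have lE : lipschitz_at 0 (fun h : R[i] => (expR (Re h) - 1)%:C).
  have := @little_o_lipschitz 0 _ (fun h => (Re h)%:C) oE.
  case=> [|M M0 [d d0 hd]].
    by exists 1 => // w; rewrite normc_real subr0 mul1r normc_Re.
  exists M => //; exists d => // w /hd.
  by rewrite -rmorphD /= expR0 mul1r subrK.
have lT : lipschitz_at 0 (fun h : R[i] => (cos (Im h) - 1)%:C + 'i%C * (sin (Im h))%:C).
  have := @little_o_lipschitz 0 _ (fun h => 'i%C * (Im h)%:C) (little_oD oC (little_oZ 'i%C oS)).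
  case=> [|M M0 [d d0 hd]].
    by exists 1 => // w; rewrite normcM normc_i normc_real subr0 !mul1r normc_Im.
  exists M => //; exists d => // w /hd.
  rewrite cos0 sin0 mul0r mul1r !subr0; congr (normc _ <= _).
  by rewrite -addrA -mulrDr -rmorphD /= subrK.
have := little_oD (little_oD oE oC) (little_oD (little_oZ 'i%C oS) (little_o_lip lE lT)).
apply: eq_little_o => h; rewrite cexp0 cexpE expR0 cos0 sin0.
by apply: eq_complexP; rewrite !(ReD, ImD, ReN, ImN, ReM, ImM) /=; ring.
Qed.

Lemma cderiv_cexp z : cderiv cexp z (cexp z).
Proof.
have h0 : cderiv cexp (z - z) 1 by rewrite subrr; exact: cderiv_cexp0.
have h1 := cderiv_comp (f := cexp) (g := fun w => w - z) h0
  (cderivB (cderiv_id z) (cderiv_cst z z)).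
have := cderivZ (cexp z) h1; rewrite subr0 !mulr1.
by apply: eq_cderiv => w; rewrite -cexpD addrC subrK.
Qed.

Lemma cexp_surj z : z != 0 -> exists w, cexp w = z.
Proof.
move=> z0; have n0 : 0 < normc z by rewrite normc_gt0.
have bd : -1 <= Re z / normc z <= 1.
  by rewrite -ler_norml normrM normfV (ger0_norm (ltW n0)) ler_pdivrMr// mul1r normc_Re.
pose t := acos (Re z / normc z).
have ct : cos t = Re z / normc z by rewrite acosK// in_itv.
have st : sin t = `|Im z| / normc z.
  rewrite sin_acos//.
  have -> : 1 - (Re z / normc z) ^+ 2 = (Im z / normc z) ^+ 2.
    apply/eqP; rewrite subr_eq !expr_div_n -mulrDl addrC -normc_sqr divff//.
    by rewrite expf_neq0// gt_eqF.
  by rewrite sqrtr_sqr normrM normfV (ger0_norm (ltW n0)).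
have lnE : expR (ln (normc z)) = normc z by rewrite lnK// posrE.
have [i0|i0] := leP 0 (Im z).
  exists (ln (normc z) +i* t); rewrite cexpE /= lnE ct st ger0_norm//.
  by apply: eq_complexP => /=; field; rewrite gt_eqF.
exists (ln (normc z) +i* - t); rewrite cexpE /= lnE cosN sinN ct st ltr0_norm//.
by apply: eq_complexP => /=; field; rewrite gt_eqF.
Qed.

Lemma cos_eq1 (t : R) : cos t = 1 -> 0 < t < pi *+ 4 -> t = pi *+ 2.
Proof.
have key (s : R) : 0 < s < pi *+ 2 -> cos s = 1 -> False.
  move=> /andP[s0 s1] cs; have : 0 < sin (s / 2).
    by apply: sin_gt0_pi; apply/andP; split; [lra|rewrite mulr2n in s1; lra].
  have s2 : (s / 2) *+ 2 = s by rewrite -mulr_natr divfK.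
  have := cos_mulr2n (s / 2); rewrite s2 cs cos2sin2 => h.
  have : sin (s / 2) ^+ 2 = 0 by rewrite mulr2n in h; lra.
  by move/eqP; rewrite sqrf_eq0 => /eqP ->; rewrite ltxx.
move=> ct /andP[t0 t1]; apply/eqP; rewrite eq_le !leNgt; apply/andP; split; apply/negP => h.
  apply: (key (t - pi *+ 2)).
    by apply/andP; split; rewrite ?subr_gt0// ltrBlDr -mulrnDr.
  by rewrite -[LHS](cosD2pi) subrK.
by apply: (key t) => //; rewrite t0.
Qed.

(** The restriction on the imaginary part isolates the single pole of the kernel used
    below. *)
Lemma cexp_eq1 z : cexp z = 1 -> 0 < Im z < pi *+ 4 -> z = 0 +i* (pi *+ 2).
Proof.
move=> z1; have /(congr1 (@ln R)) : expR (Re z) = 1.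
  by rewrite -normc_cexp z1 ComplexField.Normc.normc1.
rewrite expRK ln1 => r0; move: z1; rewrite cexpE r0 expR0 !mul1r => z1.
have /= c1 := congr1 (fun w : R[i] => Re w) z1.
by move=> h; apply: eq_complexP => //=; exact: cos_eq1.
Qed.

Lemma cexp_2pi (n : int) : cexp (0 +i* (n%:~R * (pi *+ 2)) : R[i]) = 1.
Proof.
have nat_case (m : nat) : cexp (0 +i* (m%:R * (pi *+ 2)) : R[i]) = 1.
  rewrite cexpE /= expR0 !mul1r mulr_natl.
  have /= := periodicn (@cosD2pi R) m 0; rewrite add0r cos0 => ->.
  by have /= := periodicn (@sinD2pi R) m 0; rewrite add0r sin0 => ->.
case: n => m; first by rewrite -pmulrn nat_case.
rewrite NegzE mulrNz mulNr (_ : 0 +i* _ = - (0 +i* (m.+1%:R * (pi *+ 2)))).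
  by rewrite cexpN nat_case invr1.
by apply: eq_complexP; rewrite ?ReN ?ImN /= ?oppr0.
Qed.

End exponential.

Section logarithm.
Context {R : realType}.
Implicit Types (z w : R[i]) (g : R).

Definition clog z : R[i] := ln (normc z) +i* atan (Im z / Re z).

Lemma normc_gt0_Re z : 0 < Re z -> 0 < normc z.
Proof. by move=> z0; rewrite (lt_le_trans z0)// (le_trans (ler_norm _))// normc_Re. Qed.

Lemma Re_gt0_neq0 z : 0 < Re z -> z != 0.
Proof. by move=> z0; rewrite -normc_gt0 normc_gt0_Re. Qed.

Lemma clogK z : 0 < Re z -> cexp (clog z) = z.
Proof.
move=> z0; have n0 := normc_gt0_Re z0.
rewrite cexpE /= lnK ?posrE//.
have ct := cos_atan (Im z / Re z).
have c0 : cos (atan (Im z / Re z)) != 0.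
  by rewrite ct invr_neq0// sqrtr_eq0 -ltNge ltr_pwDl// sqr_ge0.
have st : sin (atan (Im z / Re z)) = Im z / Re z * cos (atan (Im z / Re z)).
  by rewrite -{2}(atanK (Im z / Re z)) /tan divfK.
have nE : normc z = Re z * Num.sqrt (1 + (Im z / Re z) ^+ 2).
  rewrite -{1}(ger0_norm (ltW z0)) -sqrtr_sqr -sqrtrM ?sqr_ge0//.
  rewrite mulrDr mulr1 -exprMn mulrC divfK ?gt_eqF//.
  by rewrite -normc_sqr sqrtr_sqr ger0_norm// normc_ge0.
have s0 : Num.sqrt (1 + (Im z / Re z) ^+ 2) != 0.
  by rewrite sqrtr_eq0 -ltNge ltr_pwDl// sqr_ge0.
by rewrite st ct nE; apply: eq_complexP => /=; field; rewrite ?s0 ?gt_eqF.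
Qed.

Lemma ccont_clog z : 0 < Re z -> ccont clog z.
Proof.
move=> z0 e e0; have n0 := normc_gt0_Re z0; have e20 : 0 < e / 2 by rewrite divr_gt0.
have [d1 d10 h1] := (cvgrPdist_lt _ _).1 (continuous_ln n0) _ e20.
have [d2 d20 h2] := (cvgrPdist_lt _ _).1 (@continuous_atan R (Im z / Re z)) _ e20.
rewrite /= in d10 d20.
pose K := 2 * (Re z + `|Im z|) / Re z ^+ 2.
have K0 : 0 < K by rewrite divr_gt0 ?exprn_gt0// mulr_gt0// ltr_pwDl.
exists (Num.min d1 (Num.min (Re z / 2) (d2 / K))).
  by rewrite !lt_min; apply/and3P; split => //; exact: divr_gt0.
move=> w; rewrite !lt_min => /and3P[w1 w2 w3].
have hr := normc_Re (w - z); have hi := normc_Im (w - z).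
rewrite ReD ReN in hr; rewrite ImD ImN in hi.
have wr : Re z / 2 < Re w.
  by have := le_lt_trans hr w2; rewrite ltr_distlC => /andP[]; lra.
have w0 : 0 < Re w by lra.
apply: (le_lt_trans (normc_le_ReIm _)); rewrite ReD ImD ReN ImN /= [ltRHS]splitr.
apply: ltrD; rewrite distrC.
  apply: h1; rewrite /ball_ /= distrC (le_lt_trans _ w1)// ler_norml; apply/andP; split.
    by rewrite lerNl opprB normcB lerB_normc.
  exact: lerB_normc.
apply: h2; rewrite /ball_ /= distrC.
rewrite ltr_pdivlMr// in w3; apply: le_lt_trans w3.
have -> : Im w / Re w - Im z / Re z = ((Im w - Im z) * Re z - Im z * (Re w - Re z)) / (Re w * Re z).
  by field; rewrite !gt_eqF.
have wz : 0 < Re w * Re z by rewrite mulr_gt0.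
rewrite normrM normfV (gtr0_norm wz) ler_pdivrMr//.
apply: (@le_trans _ _ (normc (w - z) * (Re z + `|Im z|))).
  rewrite (le_trans (ler_normB _ _))// !normrM (gtr0_norm z0) mulrDr.
  by apply: lerD; rewrite ?[_ * `|Im z|]mulrC; rewrite ?ler_wpM2r ?ler_wpM2l// ltW.
rewrite -mulrA; apply: ler_wpM2l; first exact: normc_ge0.
have -> : K * (Re w * Re z) = (Re z + `|Im z|) * (2 * Re w / Re z).
  by rewrite /K; field; rewrite gt_eqF.
rewrite ler_peMr ?addr_ge0 ?(ltW z0)// ler_pdivlMr//; lra.
Qed.

(** A continuous right inverse of a map with invertible derivative. *)
Lemma cderiv_clog z : 0 < Re z -> cderiv clog z z^-1.
Proof.
move=> z0; have zn0 : z != 0 by rewrite -normc_gt0 normc_gt0_Re.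
have nz := normc_gt0_Re z0.
move=> e e0.
pose e1 := Num.min (1 / 2) (e * normc z / 2).
have e10 : 0 < e1 by rewrite lt_min !divr_gt0// mulr_gt0.
have [d1 d10 h1] := @cderiv_cexp0 R e1 e10.
have [d2 d20 h2] := ccont_clog z0 d10.
exists (Num.min d2 (Re z)); first by rewrite lt_min d20.
move=> w; rewrite lt_min => /andP[/h2 w1 w2].
have w0 : 0 < Re w.
  have := le_lt_trans (normc_Re _) w2; rewrite ReD ReN ltr_distlC => /andP[]; lra.
set t := clog w - clog z in w1 *.
have te : cexp t = w / z by rewrite /t cexpB !clogK.
have := h1 t; rewrite subr0 => /(_ w1); rewrite te cexp0 mul1r => H.
have tE : t - z^-1 * (w - z) = - (w / z - 1 - t) by field.
rewrite tE normcN.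
have n1 : normc (w / z - 1) = normc (w - z) / normc z.
  by rewrite -normcV -normcM mulrBl divff.
have ee : e1 <= 1 / 2 by rewrite /e1 ge_min lexx.
have ee2 : e1 <= e * normc z / 2 by rewrite /e1 ge_min lexx orbT.
have t2 : normc t <= 2 * (normc (w - z) / normc z).
  have := lerB_normc t (w / z - 1); rewrite -[X in _ <= X]normcN opprB n1.
  have : e1 * normc t <= 1 / 2 * normc t by rewrite ler_wpM2r ?normc_ge0.
  by lra.
apply: (le_trans H); apply: (@le_trans _ _ (e1 * (2 * (normc (w - z) / normc z)))).
  by rewrite ler_wpM2l// ltW.
have q0 : 0 <= 2 * (normc (w - z) / normc z) by rewrite mulr_ge0// divr_ge0 ?normc_ge0.
apply: (le_trans (ler_wpM2r q0 ee2)).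
by rewrite le_eqVlt; apply/orP; left; apply/eqP; field; rewrite gt_eqF.
Qed.

Definition cpow z g : R[i] := cexp (g%:C * clog z).

Lemma normc_cpow z g : normc (cpow z g) = expR (g * ln (normc z)).
Proof. by rewrite normc_cexp ReM /= mul0r subr0. Qed.

Lemma cderiv_cpow z g : 0 < Re z -> cderiv (cpow^~ g) z (g%:C * cpow z (g - 1)).
Proof.
move=> z0; have zn0 : z != 0 by rewrite -normc_gt0 normc_gt0_Re.
have := @cderiv_comp _ cexp (fun w => g%:C * clog w) z _ _
  (cderiv_cexp (g%:C * clog z)) (cderivZ g%:C (cderiv_clog z0)).
have -> // : cexp (g%:C * clog z) * (g%:C * z^-1) = g%:C * cpow z (g - 1).
rewrite /cpow [(g - 1)%:C]rmorphB /= mulrBl mul1r cexpB clogK//.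
by field.
Qed.

End logarithm.

(** * Off the spiral: a Mellin-Barnes resolvent *)

Section shifting_lines.
Context {R : realType}.
Local Notation leb := (@lebesgue_measure R).
Implicit Types (f g h q F : R[i] -> R[i]) (z w : R[i]).

(** At a simple zero of h the quotient g / h has residue g / h'. *)
Lemma simple_pole_residue g h z D : ccont g z -> cderiv h z D -> h z = 0 -> D != 0 ->
  forall e, 0 < e -> exists2 r, 0 < r & forall w, 0 < normc (w - z) < r ->
    normc ((w - z) * (g w / h w) - g z / D) <= e.
Proof.
move=> cg dh h0 D0 e e0; have nD : 0 < normc D by rewrite normc_gt0.
have G1 : 0 < 4 * (normc (g z) + 1) by rewrite mulr_gt0// ltr_wpDl// normc_ge0.
pose eta := Num.min (normc D / 2) (e * normc D ^+ 2 / (4 * (normc (g z) + 1))).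
have eta0 : 0 < eta by rewrite lt_min !divr_gt0// mulr_gt0// exprn_gt0.
have ed0 : 0 < e * normc D / 4 by rewrite divr_gt0// mulr_gt0.
have [r1 r10 H1] := dh eta eta0; have [r2 r20 H2] := cg _ ed0.
exists (Num.min r1 r2); first by rewrite lt_min r10.
move=> w /andP[w0]; rewrite lt_min => /andP[/H1 + /H2]; rewrite h0 subr0.
move: w0; set v := w - z => v0 A B.
have etaD : eta <= normc D / 2 by rewrite /eta ge_min lexx.
have etaE : eta * (4 * (normc (g z) + 1)) <= e * normc D ^+ 2.
  by rewrite -ler_pdivlMr// /eta ge_min lexx orbT.
have hw : normc D / 2 * normc v <= normc (h w).
  have := lerB_normc (D * v) (h w); rewrite -[X in _ <= X]normcN opprB normcM.
  have : eta * normc v <= normc D / 2 * normc v by rewrite ler_wpM2r// normc_ge0.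
  by lra.
have hw0 : 0 < normc (h w) by apply: lt_le_trans hw; rewrite mulr_gt0// divr_gt0.
have hn0 : h w != 0 by rewrite -normc_gt0.
have -> : v * (g w / h w) - g z / D =
    ((g w - g z) * (D * v) - g z * (h w - D * v)) / (h w * D) by field; rewrite ?hn0 ?D0.
rewrite normcM normcV normcM ler_pdivrMr ?mulr_gt0//.
apply: (@le_trans _ _ ((e * normc D / 4) * (normc D * normc v) + normc (g z) * (eta * normc v))).
  rewrite (le_trans (normcD _ _))// normcN !normcM; apply: lerD.
    by rewrite ler_wpM2r ?mulr_ge0 ?normc_ge0// ltW.
  by rewrite ler_wpM2l// normc_ge0.
apply: (@le_trans _ _ (e * (normc D / 2 * normc v * normc D))); last first.
  by rewrite ler_wpM2l ?(ltW e0)// ler_wpM2r ?normc_ge0.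
have : normc (g z) * (eta * 4) * normc v <= e * normc D ^+ 2 * normc v.
  apply: ler_wpM2r; first exact: normc_ge0.
  by apply: le_trans etaE; have := normc_ge0 (g z); nra.
by nra.
Qed.

Lemma integrable_inv_oneDsqr (K : R) :
  leb.-integrable setT (EFin \o (fun y => K / (1 + y ^+ 2))).
Proof.
have i1 : leb.-integrable setT (EFin \o (fun y : R => (1 + y ^+ 2)^-1)).
  apply/integrableP; split.
    apply/measurable_EFinP; apply: continuous_measurable_fun => x.
    exact: continuous_oneDsqrV.
  have p0 (y : R) : 0 <= (1 + y ^+ 2)^-1 by rewrite invr_ge0 addr_ge0 ?sqr_ge0.
  have := @ge0_symfun_integralT R (fun y : R => (1 + y ^+ 2)^-1) p0.
  move=> /(_ (@continuous_oneDsqrV R)) H.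
  have {H} := H (fun y => congr1 (fun t => (1 + t)^-1) (esym (sqrrN y))).
  under eq_integral do rewrite -[(_ ^-1)%R]ger0_norm//.
  move=> ->; have -> : [set x : R | 0 <= x] = `[0, +oo[%classic by rewrite set_itvcy.
  by rewrite integral0y_oneDsqr -EFinM ltry.
by apply: eq_integrable (integrableZl measurableT K i1) => // y _ /=; rewrite EFinM.
Qed.

Lemma measurable_rcont (f : R -> R[i]) : (forall x, rcont f x) ->
  measurable_fun setT (fun x : measurableTypeR R => Re (f x)) /\
  measurable_fun setT (fun x : measurableTypeR R => Im (f x)).
Proof.
move=> cf; split; apply: continuous_measurable_fun => x; apply/cvgrPdist_lt => e e0.
  have [d d0 hd] := cf x e e0; exists d => //= y; rewrite /ball_ /= distrC => /hd.
  by apply: le_lt_trans; rewrite distrC -ReN -ReD normc_Re.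
have [d d0 hd] := cf x e e0; exists d => //= y; rewrite /ball_ /= distrC => /hd.
by apply: le_lt_trans; rewrite distrC -ImN -ImD normc_Im.
Qed.

(** The square makes the tail of a line integral small without a limit theorem: beyond
    N one factor is at most 1 / (1 + N^2) and the other is integrable. *)
Definition decays (f : R -> R[i]) (K : R) := forall y, normc (f y) <= K / (1 + y ^+ 2) ^+ 2.

Lemma oneDsqr_gt0 (y : R) : 0 < 1 + y ^+ 2.
Proof. by rewrite ltr_pwDl// sqr_ge0. Qed.

Lemma decays_ge0 (f : R -> R[i]) K : decays f K -> 0 <= K.
Proof.
by move=> /(_ 0); rewrite expr0n addr0 expr1n divr1; apply: le_trans; exact: normc_ge0.
Qed.

Lemma decays_weaken (f : R -> R[i]) K y : decays f K -> normc (f y) <= K / (1 + y ^+ 2).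
Proof.
move=> fK; apply: (le_trans (fK y)); rewrite expr2 invfM mulrA.
rewrite ler_piMr ?divr_ge0 ?(decays_ge0 fK) ?(ltW (oneDsqr_gt0 y))//.
by rewrite invf_le1 ?oneDsqr_gt0// lerDl sqr_ge0.
Qed.

Lemma cintegrable_line (f : R -> R[i]) K : (forall x, rcont f x) -> decays f K ->
  cintegrable leb setT f.
Proof.
move=> cf fK; have [m1 m2] := measurable_rcont cf.
exact: (cintegrable_le measurableT m1 m2 (integrable_inv_oneDsqr K)
  (fun y _ => decays_weaken y fK)).
Qed.

Lemma cut_line (f : R -> R[i]) K : (forall x, rcont f x) -> decays f K ->
  forall e, 0 < e -> exists N0 : R, forall N, N0 <= N ->
    normc (cint leb setT f - sint f (- N) N) <= e.
Proof.
move=> cf fK e e0; have K0 := decays_ge0 fK.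
have iT := cintegrable_line cf fK; have [m1 m2] := measurable_rcont cf.
pose I : R := (\int[leb]_y (1 / (1 + y ^+ 2)))%R.
have I0 : 0 <= I.
  by apply: Rintegral_ge0 => y _; rewrite divr_ge0// ltW// oneDsqr_gt0.
exists (2 * (K * I) / e + 1) => N hN.
have N1 : 1 <= N by apply: le_trans hN; rewrite lerDr divr_ge0 ?(ltW e0)// !mulr_ge0.
pose fN y : R[i] := if y \in `[- N, N] then f y else 0.
have -> : sint f (- N) N = cint leb setT fN.
  rewrite /sint /cint; congr (_ +i* _); rewrite Rintegral_mkcond; apply: eq_Rintegral => y _;
  by rewrite patchE /fN mem_setE; case: ifP.
have fNK : decays fN K.
  move=> y; rewrite /fN; case: ifP => // _.
  by rewrite ComplexField.Normc.normc0 divr_ge0// exprn_ge0// ltW// oneDsqr_gt0.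
have iN : cintegrable leb setT fN.
  have mN (u : measurableTypeR R -> R) : measurable_fun setT u ->
      measurable_fun setT (fun y : measurableTypeR R => if y \in `[- N, N] then u y else 0).
    move=> mu; apply: measurable_fun_ifT => //.
    by apply: (measurable_fun_bool true); rewrite setTI; exact: measurable_itv.
  have n1 := mN _ m1; have n2 := mN _ m2.
  have q1 : measurable_fun setT (fun y : measurableTypeR R => Re (fN y)).
    by apply: eq_measurable_fun n1 => y _; rewrite /fN; case: ifP.
  have q2 : measurable_fun setT (fun y : measurableTypeR R => Im (fN y)).
    by apply: eq_measurable_fun n2 => y _; rewrite /fN; case: ifP.
  apply: (cintegrable_le measurableT q1 q2 (integrable_inv_oneDsqr K)) => y _.
  exact: decays_weaken.
rewrite -cintB//.
have N2 : 0 < 1 + N ^+ 2 by exact: oneDsqr_gt0.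
have bd y : normc (f y - fN y) <= K / (1 + N ^+ 2) / (1 + y ^+ 2).
  rewrite /fN; case: ifPn => [_|].
    by rewrite subrr ComplexField.Normc.normc0 !divr_ge0// ltW// oneDsqr_gt0.
  rewrite in_itv /= -ler_norml -ltNge subr0 => yN.
  apply: (le_trans (fK y)); rewrite expr2 invfM mulrA ler_wpM2r ?invr_ge0 ?(ltW (oneDsqr_gt0 y))//.
  rewrite ler_wpM2l// lef_pV2 ?posrE ?oneDsqr_gt0// lerD2l -[y ^+ 2]real_normK ?num_real//.
  by rewrite lerXn2r ?nnegrE ?(ltW yN)// (le_trans ler01).
have H := normc_cint_le measurableT (cintegrableB measurableT iT iN)
  (integrable_inv_oneDsqr (K / (1 + N ^+ 2))) (fun y _ => bd y).
apply: (le_trans H).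
have -> : (\int[leb]_y (K / (1 + N ^+ 2) / (1 + y ^+ 2)))%R = K / (1 + N ^+ 2) * I.
  rewrite /I -RintegralZl//; last exact: integrable_inv_oneDsqr.
  by apply: eq_Rintegral => y _; rewrite mul1r.
rewrite (_ : 2 * _ = 2 * (K * I) / (1 + N ^+ 2)); last by ring.
rewrite ler_pdivrMr// [leRHS]mulrC -ler_pdivrMr//.
have := sqr_ge0 (N - 1 / 2); have -> : (N - 1 / 2) ^+ 2 = N ^+ 2 - N + 1 / 4 by field.
lra.
Qed.

(** The residue theorem on [a, b] x [- N, N]; as N grows the horizontal sides vanish. *)
Lemma shift_line q (a b : R) z p (K Y : R) : a < Re z < b -> 0 <= K ->
  (forall x y, a <= x <= b -> x +i* y != z -> exists D, cderiv q (x +i* y) D) ->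
  (forall e, 0 < e -> exists2 r, 0 < r & forall w, 0 < normc (w - z) < r ->
    normc ((w - z) * q w - p) <= e) ->
  (forall x y, a <= x <= b -> Y <= `|y| -> normc (q (x +i* y)) <= K / (1 + y ^+ 2) ^+ 2) ->
  [/\ cintegrable leb setT (fun y => q (a +i* y)),
      cintegrable leb setT (fun y => q (b +i* y)) &
      'i%C * (cint leb setT (fun y => q (b +i* y)) - cint leb setT (fun y => q (a +i* y))) =
      p * residue_constant].
Proof.
move=> /andP[az zb] K0 dq rq bq; have ab : a <= b by rewrite (le_trans (ltW az))// ltW.
have line x : a <= x <= b -> x != Re z ->
    (forall y, rcont (fun t => q (x +i* t)) y) /\ exists K', decays (fun y => q (x +i* y)) K'.
  move=> xab xz; have cx y : rcont (fun t => q (x +i* t)) y.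
    apply: ccont_vert; have [|D hD] := dq x y xab; last exact: cderiv_ccont hD.
    by apply: contra_neq xz => <-.
  split=> //; pose Y' := Num.max Y 0.
  have [M hM] := @rcont_bounded _ (fun t => q (x +i* t)) (- Y') Y' (fun y _ => cx y).
  have Y0 : 0 <= Y' by rewrite le_max lexx orbT.
  have M0 : 0 <= M by apply: le_trans (hM 0 _); rewrite ?normc_ge0// oppr_le0 Y0.
  exists (K + M * (1 + Y' ^+ 2) ^+ 2) => y.
  have y2 : 0 < (1 + y ^+ 2) ^+ 2 by rewrite exprn_gt0// oneDsqr_gt0.
  have [Yy|yY] := leP Y' `|y|.
    apply: (le_trans (bq x y xab _)); first by apply: le_trans Yy; rewrite le_max lexx.
    rewrite ler_wpM2r ?invr_ge0 ?(ltW y2)// lerDl mulr_ge0// exprn_ge0//.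
    by rewrite ltW// oneDsqr_gt0.
  apply: (le_trans (hM y _)); first by rewrite -ler_norml ltW.
  rewrite ler_pdivlMr// (le_trans _ (_ : M * (1 + Y' ^+ 2) ^+ 2 <= _)) ?lerDr//.
  rewrite ler_wpM2l// lerXn2r ?nnegrE ?(ltW (oneDsqr_gt0 _))// lerD2l.
  by rewrite -[y ^+ 2]real_normK ?num_real// lerXn2r ?nnegrE ?(ltW yY).
have aab : a <= a <= b by rewrite lexx ab.
have bab : a <= b <= b by rewrite lexx ab.
have anz : a != Re z by rewrite lt_eqF.
have bnz : b != Re z by rewrite gt_eqF.
have [ca [Ka dka]] := line a aab anz; have [cb [Kb dkb]] := line b bab bnz.
have ia := cintegrable_line ca dka; have ib := cintegrable_line cb dkb.
split => //; apply/eqP; rewrite -subr_eq0 -normc_eq0 eq_le normc_ge0 andbT.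
apply/ler_addgt0Pr => e e0; rewrite add0r.
have e40 : 0 < e / 4 by rewrite divr_gt0.
have [Na hNa] := cut_line ca dka e40; have [Nb hNb] := cut_line cb dkb e40.
(* The last entry makes the horizontal sides contribute at most e / 2. *)
pose N := Num.max (Num.max Na Nb) (Num.max (Num.max Y (`|Im z| + 1)) (4 * K * (b - a) / (e / 2) + 1)).
have NaN : Na <= N by rewrite /N !le_max lexx.
have NbN : Nb <= N by rewrite /N !le_max lexx orbT.
have NY : Y <= N by rewrite /N !le_max lexx !orbT.
have Nz : `|Im z| + 1 <= N by rewrite /N !le_max lexx !orbT.
have Ne : 4 * K * (b - a) / (e / 2) + 1 <= N by rewrite /N !le_max lexx !orbT.
have {}hNa := hNa _ NaN; have {}hNb := hNb _ NbN; clearbody N.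
have N1 : 1 <= N by apply: le_trans Nz; rewrite lerDr.
have NN : - N <= N by lra.
have zN : - N < Im z < N by rewrite -ltr_norml; lra.
have box : cderiv_box q a b (- N) N z by move=> x y xab _; exact: dq.
have azb : a < Re z < b by rewrite az zb.
have := rect_residue azb zN box rq; rewrite /rect => <-.
have sub (f : R -> R[i]) : cintegrable leb setT f -> cintegrable leb `[- N, N] f.
  have mN : measurable (`[- N, N]%classic : set (measurableTypeR R)) by exact: measurable_itv.
  by move=> [f1 f2]; split; [exact: integrableS measurableT mN _ f1|exact: integrableS measurableT mN _ f2].
rewrite {1}/sint cintB//; [|exact: sub|exact: sub].
have hN y : `|y| = N -> hcont q y a b /\ forall x, a <= x <= b -> normc (q (x +i* y)) <= K / N.
  move=> yN; split=> x xab.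
    have [|D hD] := dq x y xab; last exact: cderiv_ccont hD.
    by apply/eqP => E; move: zN; rewrite -E /= -ltr_norml yN ltxx.
  have [y1 y2] : N <= 1 + y ^+ 2 /\ 1 <= 1 + y ^+ 2.
    rewrite -[y ^+ 2]real_normK ?num_real// yN.
    have := sqr_ge0 (N - 1 / 2); have -> : (N - 1 / 2) ^+ 2 = N ^+ 2 - N + 1 / 4 by field.
    have := sqr_ge0 N; lra.
  have Np : 0 < N by rewrite (lt_le_trans ltr01).
  apply: (le_trans (bq x y xab _)); first by rewrite yN.
  rewrite ler_wpM2l// lef_pV2 ?posrE ?exprn_gt0 ?oneDsqr_gt0//.
  by rewrite (le_trans y1)// expr2 ler_peMr// ltW// oneDsqr_gt0.
have [h1 b1] : hcont q N a b /\ forall x, a <= x <= b -> normc (q (x +i* N)) <= K / N.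
  by apply: hN; rewrite ger0_norm// (le_trans ler01).
have [h2 b2] : hcont q (- N) a b /\ forall x, a <= x <= b -> normc (q (x +i* - N)) <= K / N.
  by apply: hN; rewrite normrN ger0_norm// (le_trans ler01).
have Hb : normc (sint (fun x => q (x +i* N) - q (x +i* - N)) a b) <= e / 2.
  have bd x : a <= x <= b -> normc (q (x +i* N) - q (x +i* - N)) <= K / N + K / N.
    by move=> xab; rewrite (le_trans (normcD _ _))// normcN lerD ?b1 ?b2.
  have mI : measurable (`[a, b]%classic : set (measurableTypeR R)) by exact: measurable_itv.
  have iI := cintegrableB mI (hcont_int h1) (hcont_int h2).
  apply: (le_trans (normc_sint_le ab iI bd)).
  have Np : 0 < N by rewrite (lt_le_trans ltr01).
  rewrite (_ : 2 * _ * _ = 4 * K * (b - a) / N); last by ring.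
  rewrite ler_pdivrMr// [leRHS]mulrC -ler_pdivrMr ?divr_gt0//; lra.
rewrite /sint in hNa hNb *.
move: hNa hNb Hb; rewrite /sint.
set A := cint leb setT _; set B := cint leb setT _; set A' := cint _ _ _; set B' := cint _ _ _.
set H := cint _ _ _ => hA hB hH.
have -> : 'i%C * (B - A) - ('i%C * (B' - A') - H) = 'i%C * (B - B') - 'i%C * (A - A') + H by ring.
rewrite (le_trans (normcD _ _))// (_ : e = e / 4 + e / 4 + e / 2); last by field.
apply: lerD => //; rewrite (le_trans (normcD _ _))// normcN !normcM normc_i !mul1r.
exact: lerD.
Qed.

End shifting_lines.

Section mellin_barnes_kernel.
Context {R : realType}.
Local Notation leb := (@lebesgue_measure R).
Variables (s0 tau l : R[i]).
Hypothesis s0_gt0 : 0 < Re s0.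
Implicit Types (z w : R[i]).

(** The kernel below has the multiplier 1 / l and a denominator of period s0. The number
    beta is the imaginary part of omega, hence the width of the strip for tau. *)
Definition omega : R[i] := (0 +i* (pi *+ 2)) / s0.
Definition beta : R := pi *+ 2 * Re s0 / normc s0 ^+ 2.
Hypothesis tau_strip : - beta < Im tau < 0.
Hypothesis tauE : cexp (- s0 * tau) = l.

Lemma omega_s0 : omega * s0 = 0 +i* (pi *+ 2).
Proof. by rewrite /omega divfK// Re_gt0_neq0. Qed.

Lemma Im_omega : Im omega = beta.
Proof.
have n0 : normc s0 ^+ 2 != 0 by rewrite expf_neq0// gt_eqF// normc_gt0_Re.
have := congr1 (fun w => Re s0 * Im w - Im s0 * Re w) omega_s0; rewrite ReM ImM /= mulr0 subr0.
move=> H; apply: (mulIf n0); rewrite [RHS]divfK// [RHS]mulrC -H normc_sqr; ring.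
Qed.

Lemma beta_gt0 : 0 < beta.
Proof.
by rewrite divr_gt0 ?exprn_gt0 ?normc_gt0_Re// mulr_gt0// pmulrn_lgt0// pi_gt0.
Qed.

Lemma omega_neq0 : omega != 0.
Proof. by apply: contraTneq beta_gt0; rewrite -Im_omega => ->; rewrite ltxx. Qed.

Lemma cexp_omega_s0 : cexp (- omega * s0) = 1.
Proof.
rewrite mulNr omega_s0 cexpN (_ : _ +i* _ = 0 +i* (1%:~R * (pi *+ 2))); last by rewrite mul1r.
by rewrite cexp_2pi invr1.
Qed.

Definition mb_kernel z : R[i] := cexp (tau * z) / (1 - cexp (- omega * z)).

Lemma mb_kernel_period z : mb_kernel (z + s0) = l^-1 * mb_kernel z.
Proof.
rewrite /mb_kernel !mulrDr !cexpD cexp_omega_s0 mulr1 -tauE [- s0 * tau]mulNr [cexp (- (s0 * tau))]cexpN invrK [s0 * tau]mulrC.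
by move: (cexp (tau * z)) (cexp _) (_^-1) => a b c; ring.
Qed.

(** If e^(- omega z) = 1 then z = t s0 with t real, and the abscissa of z confines t to
    [1/2, 3/2]. *)
Lemma mb_kernel_pole z : Re s0 / 2 <= Re z <= Re s0 / 2 + Re s0 ->
  1 - cexp (- omega * z) = 0 -> z = s0.
Proof.
move=> zs /subr0_eq/esym/(congr1 (fun w => w^-1)); rewrite invr1 mulNr cexpN invrK => e1.
have /(congr1 (@ln R)) : expR (Re (omega * z)) = 1.
  by rewrite -normc_cexp e1 ComplexField.Normc.normc1.
rewrite expRK ln1 => r0; pose t := Im (omega * z) / (pi *+ 2).
have p0 : 0 < pi *+ 2 :> R by rewrite pmulrn_lgt0// pi_gt0.
have zE : z = t%:C * s0.
  apply: (mulfI omega_neq0); rewrite mulrCA omega_s0.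
  apply: eq_complexP; first by rewrite r0 ReM /= mul0r mulr0 subr0.
  by rewrite [RHS]ImM /= mul0r addr0 /t divfK// gt_eqF.
have tE : t = 1.
  have Ip : 0 < Im (omega * z) < pi *+ 4.
    have -> : Im (omega * z) = t * (pi *+ 2) by rewrite /t divfK// gt_eqF.
    move: zs; rewrite {1 2}zE ReM /= mul0r subr0 => /andP[t1 t2].
    have {}t1 : 1 / 2 <= t by rewrite -(ler_pM2r s0_gt0); lra.
    have {}t2 : t <= 3 / 2 by rewrite -(ler_pM2r s0_gt0); lra.
    rewrite mulr_gt0//=; last by lra.
    have -> : pi *+ 4 = 2 * (pi *+ 2) :> R by rewrite -[pi *+ 4]mulr_natr -[pi *+ 2]mulr_natr; ring.
    by rewrite ltr_pM2r//; lra.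
  by rewrite /t (cexp_eq1 e1 Ip) /= divff// gt_eqF.
by rewrite zE tE mul1r.
Qed.

End mellin_barnes_kernel.

Section mellin_barnes_decay.
Context {R : realType}.
Local Notation leb := (@lebesgue_measure R).

Lemma exp_decay (delta : R) : 0 < delta -> exists2 K : R, 0 <= K &
  forall y, expR (- (delta * `|y|)) <= K / (1 + y ^+ 2) ^+ 2.
Proof.
move=> d0; pose a := delta / 4; have a0 : 0 < a by rewrite divr_gt0.
pose m := Num.min 1 (a ^+ 2).
have m0 : 0 < m by rewrite lt_min ltr01 exprn_gt0.
have m1 : m <= 1 by rewrite ge_min lexx.
have m2 : m <= a ^+ 2 by rewrite ge_min lexx orbT.
exists (m ^- 2); first by rewrite invr_ge0 exprn_ge0// ltW.
move=> y; have y2 := oneDsqr_gt0 y.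
rewrite expRN -invfM lef_pV2 ?posrE ?expR_gt0 ?mulr_gt0 ?exprn_gt0//.
have ay : 0 <= a * `|y| by rewrite mulr_ge0// ltW.
have -> : delta * `|y| = (a * `|y|) *+ 4 by rewrite /a -mulr_natr; field.
rewrite -mulr_natr expRM_natr -[4%N]/(2 * 2)%N exprM -exprMn.
have h : m * (1 + y ^+ 2) <= expR (a * `|y|) ^+ 2.
  have e1 := expR_ge1Dx (a * `|y|).
  apply: (@le_trans _ _ ((1 + a * `|y|) ^+ 2)); last first.
    by rewrite lerXn2r ?nnegrE ?expR_ge0// addr_ge0.
  have : a ^+ 2 * y ^+ 2 = (a * `|y|) ^+ 2 by rewrite [(a * _) ^+ 2]exprMn real_normK ?num_real.
  have : m * y ^+ 2 <= a ^+ 2 * y ^+ 2 by rewrite ler_wpM2r ?sqr_ge0.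
  move: (a * `|y|) ay => t t0; move: (y ^+ 2) => s; nra.
by rewrite lerXn2r// nnegrE ?exprn_ge0 ?expR_ge0// mulr_ge0 ?ltW.
Qed.

Variables (s0 tau l : R[i]).
Hypothesis s0_gt0 : 0 < Re s0.
Hypothesis tau_strip : - beta s0 < Im tau < 0.
Local Notation kk := (mb_kernel s0 tau).

(** The numerator loses to the denominator upwards and decays by itself
    downwards, exactly because tau lies in the strip. *)
Lemma mb_kernel_decay : exists K Y : R, 0 <= K /\ forall x y,
  Re s0 / 2 <= x <= Re s0 / 2 + Re s0 -> Y <= `|y| ->
  normc (kk (x +i* y)) <= K / (1 + y ^+ 2) ^+ 2.
Proof.
have b0 := beta_gt0 s0_gt0; move: tau_strip => /andP[t1 t2].
pose P := (`|Re tau| + `|Re (omega s0)|) * (Re s0 / 2 + Re s0).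
pose delta := Num.min (beta s0 + Im tau) (- Im tau).
have d0 : 0 < delta by rewrite lt_min; apply/andP; split; lra.
have dl1 : delta <= beta s0 + Im tau by rewrite ge_min lexx.
have dl2 : delta <= - Im tau by rewrite ge_min lexx orbT.
have [K K0 hK] := exp_decay d0.
exists (2 * expR P * K), ((P + 1) / beta s0); split.
  by rewrite !mulr_ge0// expR_ge0.
move=> x y /andP[x1 x2]; rewrite ler_pdivrMr// => yY.
have x0 : 0 <= x by rewrite (le_trans _ x1)// divr_ge0// ltW.
have bnd (u : R) : `|u * x| <= `|u| * (Re s0 / 2 + Re s0).
  by rewrite normrM (ger0_norm x0) ler_wpM2l.
have := bnd (Re tau); rewrite ler_norml => /andP[p1 p2].
have := bnd (Re (omega s0)); rewrite ler_norml => /andP[q1 q2].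
have PE : P = `|Re tau| * (Re s0 / 2 + Re s0) + `|Re (omega s0)| * (Re s0 / 2 + Re s0).
  by rewrite /P mulrDl.
have r0 : 0 <= `|Re tau| * (Re s0 / 2 + Re s0) by rewrite mulr_ge0// addr_ge0// ?divr_ge0// ltW.
have r1 : 0 <= `|Re (omega s0)| * (Re s0 / 2 + Re s0) by rewrite mulr_ge0// addr_ge0// ?divr_ge0// ltW.
set E := cexp (- omega s0 * (x +i* y)).
have nE : normc E = expR (beta s0 * y - Re (omega s0) * x).
  by rewrite normc_cexp ReM ReN ImN /= (Im_omega s0_gt0); congr expR; ring.
have nT : normc (cexp (tau * (x +i* y))) = expR (Re tau * x - Im tau * y).
  by rewrite normc_cexp ReM.
rewrite /mb_kernel -/E normcM normcV nT.
have e2 : 2 <= expR 1 :> R by have := expR_ge1Dx (1 : R).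
have key : normc (1 - E) != 0 /\ expR (Re tau * x - Im tau * y) / normc (1 - E) <=
    2 * expR (P - delta * `|y|).
  have [y0|y0] := leP 0 y.
    rewrite ger0_norm// in yY *.
    have E2 : 2 <= normc E by rewrite nE (le_trans e2)// ler_expR; lra.
    have := lerB_normc E 1; rewrite ComplexField.Normc.normc1 normcB => E3.
    have E4 : normc E / 2 <= normc (1 - E) by lra.
    have n0 : 0 < normc (1 - E) by lra.
    split; first by rewrite gt_eqF.
    rewrite ler_pdivrMr// (le_trans _ (ler_wpM2l _ E4))// ?mulr_ge0 ?expR_ge0//.
    have -> : 2 * expR (P - delta * y) * (normc E / 2) = expR (P - delta * y) * normc E by field.
    rewrite nE -expRD ler_expR.
    have : delta * y <= (beta s0 + Im tau) * y by rewrite ler_wpM2r.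
    lra.
  rewrite ltr0_norm// in yY *.
  have E2 : normc E <= 1 / 2.
    have h1 : expR (beta s0 * y - Re (omega s0) * x) <= expR (- 1) by rewrite ler_expR; lra.
    have h2 : expR (- 1) <= 1 / 2 :> R by rewrite expRN div1r lef_pV2 ?posrE ?expR_gt0.
    by rewrite nE (le_trans h1).
  have := lerB_normc 1 E; rewrite ComplexField.Normc.normc1 => E3.
  have n0 : 0 < normc (1 - E) by lra.
  split; first by rewrite gt_eqF.
  rewrite ler_pdivrMr//.
  apply: (@le_trans _ _ (expR (P - delta * - y))).
    rewrite ler_expR.
    have : delta * - y <= - Im tau * - y by rewrite ler_wpM2r// oppr_ge0 ltW.
    lra.
  by rewrite -mulrA mulrCA ler_peMr ?expR_ge0//; lra.
have [_] := key => /le_trans; apply.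
by rewrite expRD -!mulrA !ler_wpM2l ?expR_ge0.
Qed.

Lemma cderiv_mb_kernel z : 1 - cexp (- omega s0 * z) != 0 -> exists D, cderiv kk z D.
Proof.
move=> z0.
have d1 (w : R[i]) := cderiv_comp (cderiv_cexp (w * z)) (cderivZ w (cderiv_id z)).
have d2 := cderivB (cderiv_cst 1 z) (d1 (- omega s0)).
have d3 := @cderivV _ (fun w => 1 - cexp (- omega s0 * w)) _ _ z0 d2.
eexists; exact: (cderivM (d1 tau) d3).
Qed.

End mellin_barnes_decay.

Section off_spiral.
Context {R : realType} (nu : zenMeasure R).
Local Notation leb := (@lebesgue_measure R).
Variables (s0 tau l : R[i]).
Hypothesis s0_gt0 : 0 < Re s0.
Hypothesis tau_strip : - beta s0 < Im tau < 0.
Hypothesis tauE : cexp (- s0 * tau) = l.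
Local Notation kk := (mb_kernel s0 tau).
Local Notation a := (Re s0 / 2).
Local Notation b := (Re s0 / 2 + Re s0).

Lemma mb_line_spec : a < Re s0 < b.
Proof. by move: s0_gt0 => h; apply/andP; split; lra. Qed.

Lemma cderiv_mb_strip x y : a <= x <= b -> x +i* y != s0 -> exists D, cderiv kk (x +i* y) D.
Proof.
move=> xab xy; apply: cderiv_mb_kernel; apply: contra_neq xy => h.
exact: mb_kernel_pole h.
Qed.

Definition mb_residue (F : R[i] -> R[i]) z : R[i] :=
  cexp (tau * s0) * F (z + s0) / omega s0.

(** Since F is bounded on the strip, the product with the kernel keeps the decay and the
    simple pole at s0. *)
Lemma mb_shift F z K0 : 0 < Re z -> holo F -> (forall w, Re z <= Re w -> normc (F w) <= K0) ->
  [/\ cintegrable leb setT (fun y => kk (a +i* y) * F (z + (a +i* y))),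
      cintegrable leb setT (fun y => kk (b +i* y) * F (z + (b +i* y))) &
      'i%C * (cint leb setT (fun y => kk (b +i* y) * F (z + (b +i* y))) -
              cint leb setT (fun y => kk (a +i* y) * F (z + (a +i* y)))) =
      mb_residue F z * residue_constant].
Proof.
move=> z0 hF FK; have [K [Y [K_ge0 hK]]] := mb_kernel_decay s0_gt0 tau_strip.
have K00 : 0 <= K0 := le_trans (normc_ge0 _) (FK z (lexx _)).
have w0 : omega s0 != 0 := omega_neq0 s0_gt0.
have e1 := cexp_omega_s0 s0_gt0.
have dF w : 0 < Re w -> exists D, cderiv (fun u => F (z + u)) w D.
  move=> h; have [|D hD] := hF (z + w); first by rewrite ReD addr_gt0.
  by eexists; exact: cderiv_comp hD (cderivD (cderiv_cst z w) (cderiv_id w)).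
have apos : 0 < a by rewrite divr_gt0.
apply: (@shift_line _ (fun w => kk w * F (z + w)) _ _ s0 _ (K * K0) Y) => //.
- exact: mb_line_spec.
- exact: mulr_ge0.
- move=> x y xab xy; have [D1 h1] := cderiv_mb_strip xab xy.
  have [|D2 h2] := dF (x +i* y); first by move: xab => /= /andP[h _]; apply: lt_le_trans h.
  by eexists; exact: cderivM h1 h2.
- have [D2 h2] := dF _ s0_gt0.
  have d1 (w : R[i]) := cderiv_comp (cderiv_cexp (w * s0)) (cderivZ w (cderiv_id s0)).
  have cg := cderiv_ccont (cderivM (d1 tau) h2).
  have dh := cderivB (cderiv_cst 1 s0) (d1 (- omega s0)).
  rewrite e1 mul1r mulr1 sub0r opprK in dh.
  move=> e e0; have [|r r0 hr] := simple_pole_residue cg dh _ w0 e0; first by rewrite e1 subrr.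
  exists r => // w /hr; congr (_ <= e); congr (normc (_ - _)).
  by congr (_ * _); rewrite /mb_kernel mulrAC.
- move=> x y xab yY; rewrite normcM mulrAC; apply: ler_pM; rewrite ?normc_ge0 ?hK//.
  by apply: FK; rewrite ReD /= lerDl; move: xab => /andP[h _]; rewrite (le_trans _ h)// ltW.
Qed.

End off_spiral.

Section resolvent_off_spiral.
Context {R : realType} (nu : zenMeasure R).
Local Notation leb := (@lebesgue_measure R).

(** Two solutions of e^(- s0 tau) = l differ by a multiple of omega, of imaginary part
    beta, so one has imaginary part in [- beta, 0). The value - beta would make the
    next solution real; it is nonnegative as |l| <= 1, and l lies on the spiral. *)
Lemma mb_parameter (s0 l : R[i]) : 0 < Re s0 -> l != 0 -> normc l <= 1 ->
  (forall t : R, 0 <= t -> cexp (- s0 * t%:C) != l) ->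
  exists2 tau : R[i], - beta s0 < Im tau < 0 & cexp (- s0 * tau) = l.
Proof.
move=> s0_gt0 l0 l1 off; have [w wl] := cexp_surj l0.
have b0 := beta_gt0 s0_gt0; have sn0 := Re_gt0_neq0 s0_gt0.
pose tau (n : int) : R[i] := - w / s0 + n%:~R%:C * omega s0.
have tauE n : cexp (- s0 * tau n) = l.
  have -> : - s0 * tau n = w - n%:~R%:C * (omega s0 * s0) by rewrite /tau; field.
  rewrite cexpB wl (omega_s0 s0_gt0).
  rewrite (_ : _%:C * _ = 0 +i* (n%:~R * (pi *+ 2))) ?cexp_2pi ?divr1//.
  by apply: eq_complexP; rewrite ?ReM ?ImM /= ?mulr0 ?mul0r ?subr0 ?addr0.
have tauI n : Im (tau n) = Im (- w / s0) + n%:~R * beta s0.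
  by rewrite ImD [X in _ + X]ImM /= mul0r addr0 (Im_omega s0_gt0).
set y := Im (- w / s0) in tauI; pose n := Num.floor (y / beta s0).
have := floor_itv (y / beta s0); rewrite -/n => /andP[].
rewrite ler_pdivlMr// ltr_pdivrMr// intrD mulrDl mul1r => n1 n2.
(* In the excluded case y is a multiple of beta and a real solution exists. *)
have [E|E] := eqVneq y (n%:~R * beta s0); last first.
  exists (tau (- n - 1)); last exact: tauE.
  rewrite tauI intrB mulrNz; apply/andP; split; last by lra.
  have : n%:~R * beta s0 < y by rewrite lt_neqAle eq_sym E.
  lra.
have I0 : Im (tau (- n)) = 0 by rewrite tauI E mulrNz mulNr subrr.
have tR : tau (- n) = (Re (tau (- n)))%:C by apply: eq_complexP.
have := tauE (- n); rewrite tR; have [t0|t0] := leP 0 (Re (tau (- n))).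
  by move/eqP; rewrite (negPf (off _ t0)).
move=> lE; move: l1; rewrite -lE normc_cexp ReM ReN /= mulr0 subr0 leNgt.
by rewrite expR_gt1 mulNr oppr_gt0 pmulr_rlt0// t0.
Qed.

Lemma cintegrable_normc (f : R -> R[i]) : (forall x, rcont f x) ->
  cintegrable leb setT f -> leb.-integrable setT (EFin \o (fun x => normc (f x))).
Proof.
move=> cf [f1 f2].
have i1 := integrable_norm f1; have i2 := integrable_norm f2.
apply: (le_integrable measurableT _ _ (integrableD measurableT i1 i2)).
  by apply/measurable_EFinP; apply: continuous_measurable_fun => x; exact: rcont_normc.
move=> x _ /=; rewrite lee_fin ger0_norm ?normc_ge0// ger0_norm ?addr_ge0//.
exact: normc_le_ReIm.
Qed.

Variables (s0 tau l : R[i]).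
Hypothesis s0_gt0 : 0 < Re s0.
Hypothesis tau_strip : - beta s0 < Im tau < 0.
Hypothesis tauE : cexp (- s0 * tau) = l.
Local Notation a := (Re s0 / 2).
Local Notation b := (Re s0 / 2 + Re s0).

Definition mb_line (y : measurableTypeR R) : R[i] := mb_kernel s0 tau (a +i* y).
Definition mb_path (y : measurableTypeR R) : R[i] := a +i* y.

Lemma rcont_mb_line y : rcont mb_line y.
Proof.
have aab : a <= a <= b by move: s0_gt0 => h; rewrite lexx /=; lra.
have ys : a +i* y != s0.
  by apply: contraTneq s0_gt0 => /(congr1 (fun w => Re w)) /= E; rewrite -leNgt; lra.
have [D hD] := cderiv_mb_strip tau s0_gt0 aab ys.
exact: ccont_vert (cderiv_ccont hD).
Qed.

Lemma cintegrable_mb_line : cintegrable leb setT mb_line.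
Proof.
have hF : holo (fun _ : R[i] => 1) by move=> z _; exists 0; exact: cderiv_cst.
have z0 : 0 < Re (1 : R[i]) by rewrite /=.
have bF (w : R[i]) : Re (1 : R[i]) <= Re w -> normc (1 : R[i]) <= 1.
  by rewrite ComplexField.Normc.normc1.
have [i1 _ _] := mb_shift s0_gt0 tau_strip z0 hF bF.
by apply: (eq_cintegrable measurableT _ i1) => y _; rewrite mulr1.
Qed.

Lemma measurable_mb_path_Re : measurable_fun setT (fun y => Re (mb_path y)).
Proof. exact: measurable_cst. Qed.

Lemma measurable_mb_path : measurable_fun setT (fun y => Im (mb_path y)).
Proof. exact: measurable_id. Qed.

Lemma mb_path_ge0 y : 0 <= Re (mb_path y).
Proof. by rewrite /= divr_ge0// ltW. Qed.

Definition mb_op : zenSpace nu -> zenSpace nu :=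
  conv_op (mu := leb) (measurable_rcont rcont_mb_line).1 (measurable_rcont rcont_mb_line).2
  measurable_mb_path_Re measurable_mb_path mb_path_ge0
  (cintegrable_normc rcont_mb_line cintegrable_mb_line) (nu := nu).
HB.instance Definition _ := GRing.Linear.on mb_op.

Definition mb_constant : R[i] := l * (cexp (tau * s0) / omega s0 * residue_constant / 'i%C).

Lemma mb_constant_neq0 : mb_constant != 0.
Proof.
have w0 := omega_neq0 s0_gt0.
have n0 : 'i%C != 0 :> R[i] by rewrite -normc_gt0 normc_i ltr01.
rewrite /mb_constant -tauE.
apply: mulf_neq0; first exact: cexp_neq0.
apply: mulf_neq0; last by rewrite invr_neq0.
apply: mulf_neq0; last exact: residue_constant_neq0.
by apply: mulf_neq0; [exact: cexp_neq0|rewrite invr_neq0].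
Qed.

(** Translating the line by s0 multiplies the kernel by 1 / l and crosses the
    pole at s0 exactly once. *)
Lemma mb_op_equation (f : zenSpace nu) z : 0 < Re z ->
  ext0 (zen_fun (mb_op f)) (z + s0) - l * ext0 (zen_fun (mb_op f)) z =
  mb_constant * ext0 f (z + s0).
Proof.
move=> z0; have zs : 0 < Re (z + s0) by rewrite ReD addr_gt0.
have [K hK] := zen_bounded_inside (zen_funP f) z0.
have [i1 i2 i12] := mb_shift s0_gt0 tau_strip z0 (holomorphic_holo (@zen_holo _ _ f)) hK.
have l0 : l != 0 by rewrite -tauE cexp_neq0.
have n0 : 'i%C != 0 :> R[i] by rewrite -normc_gt0 normc_i ltr01.
rewrite !ext0_conv//.
have -> : conv_at leb mb_line mb_path f (z + s0) =
    l * cint leb setT (fun y => mb_kernel s0 tau (b +i* y) * ext0 f (z + (b +i* y))).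
  rewrite -(cintZ measurableT l i2).
  rewrite -(cint_translate (Im s0) measurableT (cintegrableZ measurableT l i2)) preimage_setT.
  apply: eq_cint => y _; rewrite /mb_line /mb_path.
  have -> : b +i* (y + Im s0) = (a +i* y) + s0 by apply: eq_complexP; rewrite ?ReD ?ImD.
  by rewrite (mb_kernel_period s0_gt0 tauE) -[z + s0 + _]addrA [s0 + _]addrC mulrA mulVKf.
rewrite -mulrBr /mb_constant -mulrA; congr (_ * _); apply: (mulfI n0); rewrite i12 /mb_residue.
have w0 := omega_neq0 s0_gt0.
move: (cexp _) (ext0 _ _) (omega _) residue_constant 'i%C w0 n0 => u v w r i w0 n0.
by field; rewrite ?w0 ?n0.
Qed.

(** The inverse of T - l is (S / K - 1) / l, where T S - l S = K T. *)
Lemma mb_not_spectrum (Re_s0 : 0 <= Re s0) : ~ spectrum (comp_translate Re_s0 (nu := nu)) l.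
Proof.
set T := (comp_translate Re_s0 (nu := nu) : {linear zenSpace nu -> zenSpace nu}).
have K0 := mb_constant_neq0.
have l0 : l != 0 by rewrite -tauE cexp_neq0.
have eqn f : T (mb_op f) - l *: mb_op f = mb_constant *: T f.
  apply: zen_eq => z z0; rewrite ext0_zenB !ext0_zenZ !ext0_comp_translate//.
  exact: mb_op_equation.
have comm f : mb_op (T f) = T (mb_op f) by exact: conv_op_comp_translate.
pose S := (l^-1 \*: (mb_constant^-1 \*: mb_op \- idfun))%R.
have SE f : S f = l^-1 *: (mb_constant^-1 *: mb_op f - f) by [].
have right_inv f : T (S f) - l *: S f = f.
  rewrite !SE linearZ linearB linearZ /= [l *: _]scalerA divff// scale1r.
  have /eqP := eqn f; rewrite subr_eq => /eqP ->.
  rewrite (scalerDr mb_constant^-1) [_ *: (_ *: T f)]scalerA mulVf// scale1r addrAC subrr add0r.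
  by rewrite !scalerA mulrAC mulVf// mul1r opprB addrC subrK.
apply: (@not_spectrum_of_inverse _ _ T S) => //.
- have cm : continuous mb_op by exact: conv_op_continuous.
  move=> f; have c1 := cvgZl_tmp (k := mb_constant^-1) (cm f) _.
  have cid : idfun x @[x --> f] --> f by exact: cvg_id.
  exact: cvgZl_tmp (cvgB (c1 _) cid).
- move=> f; have SB g h : S (g - h) = S g - S h by exact: linearB.
  have SZ g : S (l *: g) = l *: S g by exact: linearZZ.
  have TZ k g : T (k *: g) = k *: T g by exact: linearZZ.
  have TB g h : T (g - h) = T g - T h by exact: linearB.
  have ST : S (T f) = T (S f) by rewrite !SE comm TZ TB TZ.
  by change (S (T f - l *: f) = f); rewrite SB SZ ST right_inv.
Qed.

End resolvent_off_spiral.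

Lemma spectrum_off_spiral {R : realType} (nu : zenMeasure R) (s0 l : R[i]) (Re_s0 : 0 <= Re s0) :
  0 < Re s0 -> l != 0 -> (forall t : R, 0 <= t -> cexp (- s0 * t%:C) != l) ->
  ~ spectrum (comp_translate Re_s0 (nu := nu)) l.
Proof.
move=> s0_gt0 l0 off; have [l1|l1] := leP (normc l) 1; last exact: spectrum_le1.
have [tau h1 h2] := mb_parameter s0_gt0 l0 l1 off.
exact: mb_not_spectrum s0_gt0 h1 h2 _.
Qed.

(** * Finite codimension *)

Section finite_codimension.
Context {K : numFieldType} {E : normedModType K}.

Lemma essential_spectrum_sub (T : {linear E -> E}) : essential_spectrum T `<=` spectrum T.
Proof.
move=> l nF [S [cS fK Kf]]; apply: nF; set f := (fun x => _) in fK Kf *.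
have f0 : f 0 = 0 by rewrite /f linear0 scaler0 subrr.
have rT : range f = setT by apply/seteqP; split => // y _; exists (S y).
have s0 : lin_span [::] (0 : E) by exists (fun=> 0); rewrite big_ord0.
split.
- by exists [::] => x /= fx; rewrite -(fK x) fx -f0 fK.
- by rewrite rT; exact: closedT.
- by exists [::] => x; exists x, 0; rewrite rT addr0.
Qed.

(** Modulo a space spanned by n vectors any n + 1 vectors are linearly dependent. *)
Lemma finite_codim_dependent (T : {linear E -> E}) (l : K) (u : nat -> E) :
  finite_codim (range (fun x => T x - l *: x)) ->
  exists n (a : 'I_n.+1 -> K) f, (exists i, a i != 0) /\
    T f - l *: f = \sum_(i < n.+1) a i *: u i.
Proof.
move=> [s hs]; pose n := size s.
have /choice[w hw] : forall j : nat, exists w : E * ('I_n -> K),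
    u j = (T w.1 - l *: w.1) + \sum_(i < n) w.2 i *: s`_i.
  by move=> j; have [_ [_ [[f _ <-] [c ->] ->]]] := hs (u j); exists (f, c).
pose C : 'M[K]_(n.+1, n) := \matrix_(i, k) (w i).2 k.
have k0 : kermx C != 0.
  by rewrite -mxrank_eq0 mxrank_ker -lt0n subn_gt0 ltnS rank_leq_col.
pose v := nz_row (kermx C).
have v0 : v != 0 by rewrite nz_row_eq0.
have vC : v *m C = 0 by apply/sub_kermxP; exact: nz_row_sub.
exists n, (fun i => v 0 i), (\sum_(i < n.+1) v 0 i *: (w i).1); split.
  have [i hi] : exists i, v 0 i != 0.
    apply/existsP; apply: contraNT v0; rewrite negb_exists => /forallP h.
    by apply/eqP/rowP => i; rewrite mxE; apply/eqP; have := h i; rewrite negbK.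
  by exists i.
rewrite linear_sum scaler_sumr -sumrB.
transitivity (\sum_(i < n.+1) (v 0 i *: u i - v 0 i *: (\sum_(k < n) (w i).2 k *: s`_k))).
  apply: eq_bigr => i _; rewrite -scalerBr hw addrK linearZ /= scalerBr.
  by rewrite !scalerA [l * _]mulrC.
rewrite sumrB [X in _ - X](_ : _ = 0) ?subr0//.
under eq_bigr do rewrite scaler_sumr.
rewrite exchange_big /= big1// => k _.
under eq_bigr do rewrite scalerA.
rewrite -scaler_suml (_ : \sum_i _ = 0) ?scale0r//.
by have /rowP/(_ k) := vC; rewrite !mxE => H; apply: etrans H; apply: eq_bigr => i _; rewrite mxE.
Qed.

End finite_codimension.

(** * Comparison in Zen spaces *)

Section zen_comparison.
Context {R : realType} (nu : zenMeasure R).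
Local Notation leb := (@lebesgue_measure R).
Local Notation M := (measurableTypeR R).
Local Notation C := (R[i]^o).
Implicit Types (z : R[i]) (q : R[i] -> R[i]).

Definition on_half_plane q : Cplus R -> C := fun s => q (val s).

Lemma ext0_on q z : 0 < Re z -> ext0 (on_half_plane q) z = q z.
Proof. by move=> z0; rewrite (ext0_in _ z0). Qed.

Lemma holomorphic_on q : holo q -> holomorphic (on_half_plane q).
Proof.
move=> hq z z0; have z0' : 0 < Re z by [].
have [D hD] := hq z z0; apply: (@cderiv_derivable _ _ _ D).
apply: (eq_cderiv_near z0' _ hD) => w wz.
rewrite ext0_on//; have := le_lt_trans (normc_Re _) wz.
by rewrite ReD ReN ltr_norml => /andP[]; lra.
Qed.

Lemma zen_integral_dominated (F : Cplus R -> C) (g1 g2 : zenSpace nu) (C1 C2 e : R) :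
  holomorphic F -> 0 <= C1 -> 0 <= C2 -> 0 < e ->
  (forall z, 0 < Re z -> normc (ext0 F z) <= C1 * normc (ext0 g1 z) + C2 * normc (ext0 g2 z)) ->
  (zen_integral nu F e <= (2 * C1 ^+ 2)%:E * zen_integral nu g1 e +
     (2 * C2 ^+ 2)%:E * zen_integral nu g2 e)%E.
Proof.
move=> hF c1 c2 e0 bd.
have mH := @measurable_half_space R.
have mF := measurable_half_plane_sqr hF e0.
have m1 := measurable_half_plane_sqr (@zen_holo _ _ g1) e0.
have m2 := measurable_half_plane_sqr (@zen_holo _ _ g2) e0.
have sq0 (H : Cplus R -> C) p : (0 <= (half_plane_normc H e p ^+ 2)%:E)%E.
  by rewrite lee_fin sqr_ge0.
have d1 : 0 <= 2 * C1 ^+ 2 by rewrite mulr_ge0// sqr_ge0.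
have d2 : 0 <= 2 * C2 ^+ 2 by rewrite mulr_ge0// sqr_ge0.
rewrite -(ge0_integralZl_EFin _ _ _ m1 d1)// -(ge0_integralZl_EFin _ _ _ m2 d2)//.
rewrite -ge0_integralD//=; first last.
- by apply: measurable_funeM.
- by move=> p _; rewrite mule_ge0// lee_fin.
- by apply: measurable_funeM.
- by move=> p _; rewrite mule_ge0// lee_fin.
apply: ge0_le_integral => //.
- by move=> p _; exact: (sq0 F).
- by apply: emeasurable_funD; apply: measurable_funeM.
move=> p [/= + _]; rewrite in_itv /= andbT => p0; rewrite -!EFinM -EFinD lee_fin.
have := bd ((p.1 + e) +i* p.2); rewrite /= ltr_wpDl// => /(_ isT).
rewrite -!/(half_plane_normc _ _ _).
have x0 := half_plane_normc_ge0 F e p.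
have y0 := half_plane_normc_ge0 g1 e p; have w0 := half_plane_normc_ge0 g2 e p.
move: (half_plane_normc F e p) (half_plane_normc g1 e p) (half_plane_normc g2 e p) x0 y0 w0.
move=> x y w x0 y0 w0 xyw.
apply: (@le_trans _ _ ((C1 * y + C2 * w) ^+ 2)).
  by rewrite lerXn2r// nnegrE addr_ge0// mulr_ge0.
rewrite -subr_ge0 (_ : _ - _ = (C1 * y - C2 * w) ^+ 2); last by ring.
exact: sqr_ge0.
Qed.

(** Two dominating functions serve to treat large and bounded arguments separately. *)
Lemma zen_dominated (F : Cplus R -> C) (g1 g2 : zenSpace nu) (C1 C2 : R) :
  holomorphic F -> 0 <= C1 -> 0 <= C2 ->
  (forall z, 0 < Re z -> normc (ext0 F z) <= C1 * normc (ext0 g1 z) + C2 * normc (ext0 g2 z)) ->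
  F \in zen_pred nu.
Proof.
move=> hF c1 c2 bd; apply/zen_predP; split => //.
have d1 : 0 <= 2 * C1 ^+ 2 by rewrite mulr_ge0// sqr_ge0.
have d2 : 0 <= 2 * C2 ^+ 2 by rewrite mulr_ge0// sqr_ge0.
apply: (@le_lt_trans _ _ ((2 * C1 ^+ 2)%:E * zen_sqnorm nu g1 +
     (2 * C2 ^+ 2)%:E * zen_sqnorm nu g2)%E).
  apply: ge_ereal_sup => _ [e e0 <-].
  apply: (le_trans (zen_integral_dominated hF c1 c2 e0 bd)).
  by apply: leeD; apply: lee_wpmul2l; rewrite ?lee_fin// zen_integral_le.
by apply: lte_add_pinfty; apply: lte_mul_pinfty; rewrite ?lee_fin// ltey_eq zen_sqnorm_fin.
Qed.

End zen_comparison.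

Section zen_powers.
Context {R : realType} (nu : zenMeasure R).
Local Notation leb := (@lebesgue_measure R).
Local Notation M := (measurableTypeR R).
Local Notation C := (R[i]^o).
Implicit Types (z : R[i]).

Lemma zen_mass_fin (t : R) : nu `[0%R, t[%classic \is a fin_num.
Proof.
have [+ _ _] := zen_regular nu; move=> /(_ `[0, t]%classic (@segment_compact _ _ _)) h.
rewrite ge0_fin_numE ?measure_ge0//; apply: le_lt_trans h.
apply: le_measure; rewrite ?inE; [exact: measurable_itv|exact: measurable_itv|].
by move=> x /=; rewrite !in_itv /= => /andP[-> /ltW].
Qed.

(** Doubling makes the mass of [0, t[ grow at most like a power of t. *)
Lemma zen_doubling_power : exists c : R, 0 <= c /\
  forall n, fine (nu `[0%R, (2 ^+ n)%R[%classic) <= c ^+ n * fine (nu `[0%R, 1%R[%classic).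
Proof.
have [pos] := zen_doubling nu; set S := ereal_sup _ => Sfin.
have ub t : 0 < t -> (nu `[0%R, (2 * t)%R[%classic / nu `[0%R, t[%classic <= S)%E.
  by move=> t0; apply: ereal_sup_ubound; exists t.
have S0 : (0 <= S)%E.
  by apply: le_trans (ub 1 ltr01); rewrite mule_ge0 ?inve_ge0 ?measure_ge0.
have Sf : S \is a fin_num by rewrite ge0_fin_numE.
exists (fine S); split; first exact: fine_ge0.
elim=> [|n IH]; first by rewrite !expr0 mul1r.
have t0 : 0 < 2 ^+ n :> R by exact: exprn_gt0.
apply: (@le_trans _ _ (fine S * fine (nu `[0%R, (2 ^+ n)%R[%classic))); last first.
  by rewrite [in leRHS]exprS -mulrA ler_wpM2l// fine_ge0.
have := ub _ t0; have := pos _ t0; rewrite -exprS.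
rewrite -(fineK (zen_mass_fin (2 ^+ n))) -(fineK (zen_mass_fin (2 ^+ n.+1))) lte_fin => p.
by rewrite inver gt_eqF// -EFinM -[X in (_ <= X)%E -> _](fineK Sf) lee_fin ler_pdivrMr.
Qed.

(** The weight is dominated by a sum of multiples of indicators of [0, 2^(n+1)[. *)
Lemma dyadic_weight (m : nat) (x : R) : 0 <= x -> exists n,
  x < 2 ^+ n.+1 /\ ((1 + x) ^+ (2 * m))^-1 <= ((4 ^+ m)^-1) ^+ n.
Proof.
move=> x0; have ex : exists n, 1 + x < 2 ^+ n.+1.
  have [n hn] := @exists_geometric_lt _ (1 + x) 2 1 ltac:(by rewrite ltr1n) ltr01.
  exists n; move: hn; rewrite ltr_pdivrMr ?exprn_gt0// mul1r => /lt_le_trans; apply.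
  by rewrite exprS ler_peMl ?exprn_ge0// ler1n.
have [n hn min] := ex_minnP ex; exists n; split; first by rewrite (le_lt_trans _ hn)// lerDr.
have h2 : 2 ^+ n <= 1 + x.
  case: n min {hn} => [|n] min; first by rewrite expr0 lerDl.
  by rewrite leNgt; apply/negP => /min; rewrite ltnn.
rewrite exprVn lef_pV2 ?posrE ?exprn_gt0 ?ltr_pwDl//.
have -> : 4 ^+ m ^+ n = (2 ^+ n) ^+ (2 * m) :> R.
  rewrite (_ : 4 = 2 ^+ 2); last by rewrite -natrX.
  rewrite -!exprM; congr (_ ^+ _).
  by rewrite ?mulnA mulnC ?mulnA.
by rewrite lerXn2r// nnegrE ?exprn_ge0// addr_ge0.
Qed.

Lemma measurable_fun_inv_power (k : nat) :
  measurable_fun (`[0%R, +oo[%classic : set M) (fun x : M => ((1 + x) ^+ k)^-1).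
Proof.
have m : measurable_fun setT (fun x : M => (1 + `|x|)^-1 : R).
  apply: continuous_measurable_fun => x; apply: cvgV; first by rewrite gt_eqF// ltr_pwDl.
  by apply: cvgD; [exact: cvg_cst|exact: norm_continuous].
have mk : measurable_fun (`[0%R, +oo[%classic : set M) (fun x : M => (1 + `|x|)^-1 ^+ k).
  by apply: measurable_funX; exact: measurable_funTS.
apply: eq_measurable_fun mk => x; rewrite inE /= in_itv /= andbT => x0.
by rewrite ger0_norm// exprVn.
Qed.

Lemma zen_power_mass : exists m : nat,
  (\int[nu]_(x in `[0%R, +oo[) (((1 + x) ^+ (2 * m))^-1)%:E < +oo)%E.
Proof.
have [c [c0 hc]] := zen_doubling_power; set v := fine (nu `[0%R, 1%R[%classic) in hc.
have v0 : 0 <= v by exact/fine_ge0/measure_ge0.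
have [m hm] := @exists_geometric_lt _ c 4 (1 / 2) ltac:(by rewrite ltr1n) ltac:(by rewrite divr_gt0).
exists m.
pose h n (x : M) : \bar R := ((((4 ^+ m)^-1) ^+ n)%:E * (\1_(`[0%R, (2 ^+ n.+1)%R[%classic : set M) x)%:E)%E.
have q0 : 0 <= ((4 : R) ^+ m)^-1 by rewrite invr_ge0 exprn_ge0.
have h0 n x : (0 <= h n x)%E by rewrite mule_ge0 ?lee_fin ?exprn_ge0.
have mi n : measurable_fun (`[0%R, +oo[%classic : set M)
    (fun x => (\1_(`[0%R, (2 ^+ n.+1)%R[%classic : set M) x : R)%:E).
  apply/measurable_EFinP; exact: measurable_indic (measurable_itv _).
have mh n : measurable_fun (`[0%R, +oo[%classic : set M) (h n).
  exact: measurable_funeM.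
apply: (@le_lt_trans _ _ (\int[nu]_(x in (`[0%R, +oo[%classic : set M)) (\sum_(n <oo) h n x))%E).
  apply: ge0_le_integral => //.
  - move=> x; rewrite /= in_itv /= andbT => x0.
    by rewrite lee_fin invr_ge0 exprn_ge0// addr_ge0.
  - apply/measurable_EFinP.
    exact: measurable_fun_inv_power.
  - exact: ge0_emeasurable_sum.
  - move=> x /=; rewrite in_itv /= andbT => x0.
    have [n [n1 n2]] := dyadic_weight m x0.
    rewrite (nneseriesD1 (n := n))// (le_trans (_ : _ <= h n x)%E)//.
      by rewrite /h indicE mem_setE in_itv /= x0 n1 mule1 lee_fin.
    by rewrite leeDl// nneseries_ge0.
rewrite integral_nneseries//.
have K0 : 0 <= 2 * (c * v) by rewrite !mulr_ge0.
apply: le_lt_trans (_ : _ <= (2 * (c * v))%:E)%E (ltry _).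
apply: le_trans (epsilon_trick0 _ K0); apply: lee_nneseries => [n _ _|n _].
  exact: integral_ge0.
rewrite (ge0_integralZl_EFin _ _ _ (mi n)) ?exprn_ge0//.
rewrite integral_indic//.
rewrite setIidl; last by move=> x /=; rewrite !in_itv /= andbT => /andP[].
rewrite -(fineK (zen_mass_fin _)) -EFinM lee_fin.
apply: (le_trans (ler_wpM2l _ (hc n.+1))); first by rewrite exprn_ge0.
set q := _^-1 in q0 hm *.
have -> : q ^+ n * (c ^+ n.+1 * v) = (c * q) ^+ n * (c * v) by rewrite exprMn exprS; ring.
have -> : 2 * (c * v) / (2 ^ n.+1)%:R = (1 / 2) ^+ n * (c * v).
  by rewrite natrX exprS div1r exprVn; field; rewrite expf_neq0.
rewrite ler_wpM2r ?mulr_ge0// lerXn2r ?nnegrE ?mulr_ge0// ?divr_ge0//.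
exact: ltW.
Qed.

(** The integrand at x + i y is at most a product of a power of 1 + x and of
    1 / (1 + y^2). *)
Lemma power_zen : exists k : nat, on_half_plane (fun z => (z + 1)^-1 ^+ k) \in zen_pred nu.
Proof.
have [m hm] := zen_power_mass; exists m.+1; apply/zen_predP.
have hol : holomorphic (on_half_plane (fun z : R[i] => (z + 1)^-1 ^+ m.+1)).
  apply: holomorphic_on => z z0; apply: cderivX; apply: cderivV.
    by apply: contraTneq z0 => /(congr1 (fun w => Re w)); rewrite ReD /= => h; rewrite -leNgt; lra.
  exact: cderivD (cderiv_id z) (cderiv_cst 1 z).
split=> //.
pose I : \bar R := (\int[leb]_y ((1 + y ^+ 2)^-1)%:E)%E.
have mI : measurable_fun setT (fun y : M => ((1 + y ^+ 2)^-1)%:E).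
  apply/measurable_EFinP; apply: continuous_measurable_fun => x; exact: continuous_oneDsqrV.
have I0 (y : R) : (0 <= ((1 + y ^+ 2)^-1)%:E)%E by rewrite lee_fin invr_ge0 ltW// oneDsqr_gt0.
have Ifin : (I < +oo)%E.
  have := integrable_inv_oneDsqr (1 : R) => /integrableP[_]; apply: le_lt_trans.
  rewrite le_eqVlt; apply/orP; left; apply/eqP; apply: eq_integral => y _ /=.
  by rewrite ger0_norm mul1r// invr_ge0 ltW// oneDsqr_gt0.
apply: (@le_lt_trans _ _ (I * \int[nu]_(x in `[0%R, +oo[) (((1 + x) ^+ (2 * m))^-1)%:E)%E); last first.
  by apply: lte_mul_pinfty => //; [exact: integral_ge0|rewrite ge0_fin_numE//; exact: integral_ge0].
apply: ge_ereal_sup => _ [e + <-] => /= e0; rewrite zen_integralE//.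
have w0 (x : M) : (`[0%R, +oo[%classic : set M) x -> (0 <= (((1 + x) ^+ (2 * m))^-1)%:E)%E.
  by rewrite /= in_itv /= andbT => x0; rewrite lee_fin invr_ge0 exprn_ge0// addr_ge0.
have mw : measurable_fun (`[0%R, +oo[%classic : set M) (fun x : M => (((1 + x) ^+ (2 * m))^-1)%:E).
  by apply/measurable_EFinP; exact: measurable_fun_inv_power.
rewrite -ge0_integralZl//; last exact: integral_ge0.
apply: ge0_le_integral => //.
- by move=> x _; exact: line_sqnorm_ge0.
- exact: measurable_line_sqnorm.
- exact: measurable_funeM.
move=> x xP; have x0 : 0 <= x by move: xP; rewrite /= in_itv /= andbT.
rewrite muleC -ge0_integralZl//; last exact: w0.
apply: ge0_le_integral => //.
- by move=> y _; rewrite lee_fin sqr_ge0.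
- apply: eq_measurable_fun (measurable_clamp_sqr1 (x + e) hol e0) => y _.
  by rewrite clamp_sqrE// lerDr.
- exact: measurable_funeM.
move=> y _; have xe : 0 < Re ((x + e) +i* y) by rewrite /= ltr_wpDl.
rewrite ext0_on// -EFinM lee_fin normcX normcV exprVn exprVn -exprM mulnC exprM.
rewrite -invfM normc_sqr ReD ImD /= addr0.
have b1 : 1 + y ^+ 2 <= (x + e + 1) ^+ 2 + y ^+ 2.
  by rewrite lerD2r -[leLHS](expr1n _ 2) lerXn2r ?nnegrE//; lra.
have b2 : (1 + x) ^+ 2 <= (x + e + 1) ^+ 2 + y ^+ 2.
  have : (1 + x) ^+ 2 <= (x + e + 1) ^+ 2 by rewrite lerXn2r ?nnegrE//; lra.
  by have := sqr_ge0 y; lra.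
have y0 := oneDsqr_gt0 y; have x2 : 0 < (1 + x) ^+ 2 by rewrite exprn_gt0// ltr_pwDl.
have A0 := lt_le_trans y0 b1.
rewrite lef_pV2 ?posrE ?exprn_gt0//; last by rewrite mulr_gt0// exprn_gt0// ltr_pwDl.
rewrite [leRHS]exprSr [(1 + x) ^+ (2 * m)]exprM; apply: ler_pM => //; first by rewrite exprn_ge0// ltW.
  exact: ltW.
by rewrite lerXn2r// nnegrE ltW.
Qed.

End zen_powers.

(** * The point 0 *)

Section zero_in_essential_spectrum.
Context {R : realType} (nu : zenMeasure R).
Implicit Types (z w : R[i]).

Lemma ext0_zen_sum n (a : 'I_n -> R[i]) (u : 'I_n -> zenSpace nu) z :
  ext0 (zen_fun (\sum_(i < n) a i *: u i)) z = \sum_(i < n) a i * ext0 (u i) z.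
Proof.
have z0 : ext0 (zen_fun (0 : zenSpace nu)) z = 0.
  by rewrite -(scale0r (0 : zenSpace nu)) ext0_zenZ mul0r.
rewrite (big_morph (fun f : zenSpace nu => ext0 f z) (fun f g => ext0_zenD f g z) z0).
by apply: eq_bigr => i _; rewrite ext0_zenZ.
Qed.

(** The moduli of s + a and s + 1 are comparable on the half-plane. *)
Lemma inv_power_zen (a : R) : 0 < a -> exists k : nat, forall j : nat,
  on_half_plane (fun z => (z + a%:C)^-1 ^+ (k.+1 + j)) \in zen_pred nu.
Proof.
move=> a0; have [k hk] := power_zen nu; exists k => j.
have za z : 0 < Re z -> 0 < Re (z + a%:C) by move=> z0; rewrite ReD /= addr_gt0.
have z1 z : 0 < Re z -> 0 < Re (z + 1) by move=> z0; rewrite ReD /= addr_gt0.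
have hol : holomorphic (on_half_plane (fun z => (z + a%:C)^-1 ^+ (k.+1 + j))).
  apply: holomorphic_on => z z0; apply: cderivX; apply: cderivV.
    exact/Re_gt0_neq0/za.
  exact: cderivD (cderiv_id z) (cderiv_cst a%:C z).
pose c := Num.min a 1; have c0 : 0 < c by rewrite lt_min a0 ltr01.
have ca : c <= a by rewrite ge_min lexx.
have c1 : c <= 1 by rewrite ge_min lexx orbT.
apply: (zen_dominated (g1 := ZenSpace hk) (g2 := ZenSpace hk) (C1 := c^-1 ^+ (k.+1 + j)) (C2 := 0) hol) => //.
  by rewrite exprn_ge0// invr_ge0 ltW.
move=> z z0; rewrite mul0r addr0 !ext0_on// !normcX !normcV.
have n1 : 1 <= normc (z + 1).
  by rewrite (le_trans _ (normc_Re _))// (le_trans _ (ler_norm _))// ReD /= lerDr ltW.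
have n1' : 0 < normc (z + 1) by rewrite (lt_le_trans ltr01).
have cz : c * normc (z + 1) <= normc (z + a%:C).
  rewrite -(@ler_pXn2r _ 2) ?nnegrE ?mulr_ge0 ?normc_ge0 ?(ltW c0)//.
  rewrite exprMn !normc_sqr !ReD !ImD /= !addr0 mulrDr; apply: lerD.
    rewrite -exprMn lerXn2r ?nnegrE ?mulr_ge0 ?addr_ge0 ?(ltW c0) ?(ltW a0) ?(ltW z0)//.
    by rewrite mulrDr mulr1 lerD// ler_piMl// ltW.
  by rewrite ler_piMl ?sqr_ge0// expr_le1// ltW.
apply: (@le_trans _ _ ((c * normc (z + 1))^-1 ^+ (k.+1 + j))).
  rewrite lerXn2r ?nnegrE ?invr_ge0 ?mulr_ge0 ?normc_ge0 ?(ltW c0)//.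
  by rewrite lef_pV2 ?posrE ?mulr_gt0// (lt_le_trans _ cz)// mulr_gt0.
rewrite invfM exprMn; apply: ler_wpM2l; first by rewrite exprn_ge0// invr_ge0 ltW.
by apply: ler_wiXn2l; rewrite ?invr_ge0 ?normc_ge0 ?invf_le1// addSnnS leq_addr.
Qed.

(** A function F with F (s + s0) a combination of negative powers of s + a would
    have a pole inside the half-plane. *)
Lemma zero_not_finite_codim (s0 : R[i]) (Re_s0 : 0 <= Re s0) : 0 < Re s0 ->
  let T : {linear zenSpace nu -> zenSpace nu} := comp_translate Re_s0 (nu := nu) in
  ~ finite_codim (range (fun f => T f - 0 *: f)).
Proof.
move=> s0_gt0 T fc; pose a := Re s0 / 2; have a0 : 0 < a by rewrite divr_gt0.
have [k hk] := inv_power_zen a0; pose u j : zenSpace nu := ZenSpace (hk j).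
have [n [c [f [[i0 ci0] eqn]]]] := finite_codim_dependent u fc.
pose zs := s0 - a%:C.
have zsRe : Re zs = a by rewrite ReD ReN /= /a; field.
(* The strongest pole *)
case: (@arg_maxnP _ i0 (fun i => c i != 0) (fun i : 'I_n.+1 => i : nat) ci0) => J cJ maxJ.
pose q z : R[i] := ext0 f z * (z - zs) ^+ (k.+1 + J) - \sum_(i < n.+1) c i * (z - zs) ^+ (J - i).
have dz z : cderiv (fun w => w - zs) z (1 - 0) := cderivB (cderiv_id z) (cderiv_cst zs z).
have hq : holo q.
  move=> z z0; have [D1 h1] := holomorphic_holo (@zen_holo _ _ f) z0.
  have [D2 h2] := cderivX (k.+1 + J) (dz z).
  have [D h3] := choice (fun i : 'I_n.+1 => cderivX (J - i) (dz z)).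
  have h4 := cderiv_sum (index_enum 'I_n.+1) (fun i => cderivZ (c i) (h3 i)).
  by eexists; exact: cderivB (cderivM h1 h2) h4.
have q0 z : Re s0 < Re z -> q z = 0.
  move=> zr; pose w := z - s0.
  have w0 : 0 < Re w by rewrite ReD ReN subr_gt0.
  have wz : w + s0 = z by rewrite subrK.
  have v0 : z - zs != 0 by apply: Re_gt0_neq0; rewrite ReD ReN zsRe /a; lra.
  have := congr1 (fun g : zenSpace nu => ext0 g w) eqn.
  rewrite ext0_zenB ext0_zenZ mul0r subr0 ext0_comp_translate// wz ext0_zen_sum /q => ->.
  rewrite mulr_suml; apply/eqP; rewrite subr_eq0; apply/eqP; apply: eq_bigr => i _.
  have [->|ci] := eqVneq (c i) 0; first by rewrite !mul0r.
  have iJ : (i <= J)%N by exact: maxJ.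
  rewrite ext0_on// (_ : w + a%:C = z - zs); last by rewrite /w /zs; ring.
  rewrite -mulrA; congr (_ * _).
  have -> : (k.+1 + J = (k.+1 + i) + (J - i))%N by rewrite -addnA subnKC.
  by rewrite [X in _ * X]exprD mulrA -exprMn mulVf// expr1n mul1r.
have := identity_theorem hq q0 (z := zs); rewrite zsRe => /(_ a0).
rewrite /q subrr expr0n /= mulr0 sub0r (bigD1 J)//= subnn expr0 mulr1 big1 ?addr0; last first.
  move=> i iJ; have [->|ci] := eqVneq (c i) 0; first by rewrite mul0r.
  have : (i <= J)%N := maxJ i ci; rewrite leq_eqVlt => /orP[/eqP E|lt]; first by rewrite (ord_inj E) eqxx in iJ.
  by rewrite expr0n subn_eq0 leqNgt lt mulr0.
by move/eqP; rewrite oppr_eq0 (negPf cJ).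
Qed.

End zero_in_essential_spectrum.

(** * Powers damped by an exponential *)

Section damped_powers.
Context {R : realType} (nu : zenMeasure R).
Local Notation M := (measurableTypeR R).
Implicit Types (z w : R[i]) (g : R).
Variable t0 : R.
Hypothesis t0_ge0 : 0 <= t0.

Definition damped_power g z : R[i] := cexp (- t0%:C * z) * cpow (z + 1) (- g).

Lemma Re_gt0D1 z : 0 < Re z -> 0 < Re (z + 1).
Proof. by move=> z0; rewrite ReD /= addr_gt0. Qed.

Lemma normcD1_gt1 z : 0 < Re z -> 1 < normc (z + 1).
Proof.
by move=> z0; rewrite (lt_le_trans _ (normc_Re _))// (lt_le_trans _ (ler_norm _))// ReD /= ltrDr.
Qed.

Lemma holo_damped_power g : holo (damped_power g).
Proof.
move=> z z0; have d1 := cderiv_comp (cderiv_cexp (- t0%:C * z)) (cderivZ (- t0%:C) (cderiv_id z)).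
have d3 : cderiv (fun w => w + 1) z (1 + 0) := cderivD (cderiv_id z) (cderiv_cst 1 z).
have d2 := @cderiv_comp _ (cpow^~ (- g)) _ z _ _ (cderiv_cpow (- g) (Re_gt0D1 z0)) d3.
by eexists; exact: cderivM d1 d2.
Qed.

Lemma normc_damped_power g z :
  normc (damped_power g z) = expR (- t0 * Re z) * expR (- g * ln (normc (z + 1))).
Proof.
by rewrite normcM normc_cexp normc_cpow ReM ReN ImN /= oppr0 mul0r subr0.
Qed.

Definition in_zen g := on_half_plane (damped_power g) \in zen_pred nu.

Lemma in_zen_upward g g' : g <= g' -> in_zen g -> in_zen g'.
Proof.
move=> gg gz; apply: (zen_dominated (g1 := ZenSpace gz) (g2 := ZenSpace gz) (C1 := 1) (C2 := 0)) => //.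
  exact: holomorphic_on (holo_damped_power g').
move=> z z0; rewrite mul0r addr0 mul1r !ext0_on// !normc_damped_power.
rewrite ler_wpM2l ?expR_ge0// ler_expR ler_wpM2r ?lerN2// ln_ge0// ltW//.
exact: normcD1_gt1.
Qed.

Lemma in_zen_large : exists k : nat, in_zen k%:R.
Proof.
have [k hk] := power_zen nu; exists k.
apply: (zen_dominated (g1 := ZenSpace hk) (g2 := ZenSpace hk) (C1 := 1) (C2 := 0)) => //.
  exact: holomorphic_on (holo_damped_power _).
move=> z z0; rewrite mul0r addr0 mul1r !ext0_on// normc_damped_power normcX normcV.
have n0 : 0 < normc (z + 1) by rewrite (lt_trans ltr01)// normcD1_gt1.
rewrite [- k%:R * _]mulNr [X in _ * X]expRN expRM_natl lnK ?posrE// exprVn.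
rewrite ler_piMl ?invr_ge0 ?exprn_ge0 ?normc_ge0// -expR0 ler_expR mulNr oppr_le0.
by rewrite mulr_ge0// ltW.
Qed.

(** Along a vertical line the exponential has constant modulus. *)
Lemma not_in_zen0 : ~ in_zen 0.
Proof.
move=> /zen_predP[hF]; apply/negP; rewrite -leNgt leye_eq; apply/eqP.
apply/eqP; rewrite -leye_eq (le_trans _ (zen_integral_le nu _ (ltr01 : 0 < 1 :> R)))//.
rewrite zen_integralE//.
have lebT : @lebesgue_measure R setT = +oo%E by rewrite -set_itvNyy lebesgue_measure_itv.
have lineE (x : R) : 0 <= x -> line_sqnorm (on_half_plane (damped_power 0)) (x + 1) = +oo%E.
  move=> x0; rewrite /line_sqnorm.
  have -> : (\int[@lebesgue_measure R]_y ((normc (ext0 (on_half_plane (damped_power 0)) ((x + 1) +i* y))) ^+ 2)%:E =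
     \int[@lebesgue_measure R]_y (cst ((expR (- t0 * (x + 1)) ^+ 2)%:E) y))%E.
    apply: eq_integral => y _; have xp : 0 < Re ((x + 1) +i* y) by rewrite /= ltr_wpDl.
    by rewrite (ext0_on _ xp) normc_damped_power oppr0 mul0r expR0 mulr1.
  rewrite integral_cst//= lebT mulry gtr0_sg ?mul1e// exprn_gt0//.
  exact: expR_gt0.
have -> : (\int[zen_sf nu]_(x in `[0%R, +oo[) line_sqnorm (on_half_plane (damped_power 0)) (x + 1)%R =
   \int[zen_sf nu]_(x in `[0%R, +oo[) (cst +oo%E x))%E.
  by apply: eq_integral => x; rewrite inE /= in_itv /= andbT => x0; rewrite lineE.
rewrite integral_cst//= -/(cst _).
have [pos _] := zen_doubling nu.
rewrite gt0_mulye// (lt_le_trans (pos 1 ltr01))//; apply: le_measure; rewrite ?inE.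
- exact: measurable_itv.
- exact: measurable_itv.
- by move=> x /=; rewrite !in_itv /= andbT => /andP[].
Qed.

(** The least half integer exponent that is admissible; admissible exponents within 1/2
    above it become inadmissible once lowered by 1. *)
Lemma in_zen_threshold : exists n : nat,
  in_zen (n.+1%:R / 2) /\ ~ in_zen (n%:R / 2).
Proof.
have ex : exists n : nat, `[< in_zen (n%:R / 2) >].
  have [k hk] := in_zen_large; exists (k * 2)%N; apply/asboolP.
  by rewrite natrM mulfK.
have [[|n] /asboolP hn min] := ex_minnP ex.
  by exfalso; apply: not_in_zen0; rewrite mul0r in hn.
by exists n; split => // h; have := min n (asboolT h); rewrite ltnn.
Qed.

End damped_powers.

Section dominant_power.
Context {R : realType} (m : nat).
Implicit Types (w : R[i]).
Variables (b : 'I_m -> R[i]) (e : 'I_m -> R) (i0 : 'I_m).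
Hypothesis e_inj : injective e.
Hypothesis b0 : b i0 != 0.

Lemma power_dominates (d beta eta : R) : 0 < d -> 0 <= beta -> 0 < eta ->
  exists rho : R, forall x, rho <= x -> 0 < x -> forall a : R,
    beta * expR ((a - d) * ln x) <= eta * expR (a * ln x).
Proof.
move=> d0 beta0 eta0; exists (expR (beta / (eta * d))) => x hx x0 a.
have -> : a * ln x = (a - d) * ln x + d * ln x by ring.
rewrite expRD mulrCA [leLHS]mulrC ler_wpM2l ?expR_ge0//.
have : beta / (eta * d) <= ln x by rewrite -[leLHS]expRK ler_ln ?posrE ?expR_gt0.
rewrite ler_pdivrMr ?mulr_gt0// => h.
apply: (@le_trans _ _ (eta * (1 + d * ln x))); last by rewrite ler_wpM2l ?(ltW eta0)// expR_ge1Dx.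
by apply: (le_trans h); rewrite mulrDr mulr1 mulrCA [d * _]mulrC; lra.
Qed.

(** Among finitely many distinct powers the largest one with a nonzero coefficient
    dominates any linear combination at infinity. *)
Lemma dominant_power : exists J, e i0 <= e J /\ exists rho B : R, [/\ 1 <= rho, 0 <= B &
  forall w, rho <= normc w -> normc (cpow w (e J)) <= B * normc (\sum_(i < m) b i * cpow w (e i))].
Proof.
case: (@arg_maxP _ _ _ i0 (fun i => b i != 0) e b0) => J bJ maxJ; exists J; split; first exact: maxJ.
have nb : 0 < normc (b J) by rewrite normc_gt0.
have m0 : 0 < m%:R :> R by rewrite ltr0n (leq_ltn_trans _ (ltn_ord i0)).
pose eta := normc (b J) / (2 * m%:R).
have eta0 : 0 < eta by rewrite divr_gt0// mulr_gt0.
have /choice[rho hrho] : forall i, exists rho : R, forall w, rho <= normc w -> 0 < normc w ->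
    i != J -> normc (b i * cpow w (e i)) <= eta * normc (cpow w (e J)).
  move=> i; have [->|iJ] := eqVneq i J; first by exists 0.
  have [bi|bi] := eqVneq (b i) 0.
    exists 0 => w _ _ _; rewrite bi mul0r ComplexField.Normc.normc0.
    by rewrite mulr_ge0 ?normc_ge0// ltW.
  have d0 : 0 < e J - e i.
    by rewrite subr_gt0 lt_neqAle (contra_neq (@e_inj _ _) iJ)//=; exact: maxJ.
  have [r hr] := power_dominates d0 (normc_ge0 (b i)) eta0.
  exists r => w rw w0 _; rewrite normcM !normc_cpow.
  by have := hr _ rw w0 (e J); rewrite subKr.
exists (\sum_i `|rho i| + 1), (2 / normc (b J)); split.
- by rewrite lerDr sumr_ge0.
- by rewrite divr_ge0// ltW.
move=> w hw; have w0 : 0 < normc w by rewrite (lt_le_trans _ hw)// ltr_pwDr// sumr_ge0.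
have rw i : rho i <= normc w.
  rewrite (le_trans _ hw)// (le_trans (ler_norm _))// (bigD1 i)//= -addrA lerDl.
  by rewrite addr_ge0// sumr_ge0.
set X := normc (cpow w (e J)); set S := \sum_i _.
have X0 : 0 <= X by exact: normc_ge0.
have : normc (b J) * X <= normc S + m%:R * (eta * X).
  have -> : normc (b J) * X = normc (b J * cpow w (e J)) by rewrite normcM.
  have -> : b J * cpow w (e J) = S - \sum_(i < m | i != J) b i * cpow w (e i).
    by rewrite /S (bigD1 J)//= addrK.
  rewrite (le_trans (normcD _ _))// normcN lerD2l (le_trans (normc_sum _ _ _))//.
  apply: (@le_trans _ _ (\sum_(i < m | i != J) eta * X)).
    by apply: ler_sum => i iJ; exact: hrho.
  apply: (@le_trans _ _ (\sum_(i < m) eta * X)).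
    by rewrite [leRHS](bigD1 J)//= lerDr mulr_ge0// ltW.
  by rewrite sumr_const card_ord mulr_natl.
have -> : m%:R * (eta * X) = normc (b J) * X / 2 by rewrite /eta; field; rewrite gt_eqF.
move=> h; rewrite mulrAC ler_pdivlMr//; lra.
Qed.

End dominant_power.

(** * The points of the spiral *)

Section vanishing_derivative.
Context {R : realType}.
Implicit Types (q F : R[i] -> R[i]) (z w v : R[i]).

Lemma is_derive0 (f : R -> R) x : (forall e : R, 0 < e -> exists2 d : R, 0 < d &
    forall h : R, `|h| < d -> `|f (x + h) - f x| <= e * `|h|) -> is_derive x (1 : R) f 0.
Proof.
move=> hf.
have cv : (fun h : R => h^-1 *: ((f \o shift x) (h *: (1 : R)) - f x)) h @[h --> 0^'] --> (0 : R).
  apply/cvgrPdist_le => e e0; have [d d0 hd] := hf e e0.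
  exists d => //= h; rewrite /ball_ /= sub0r normrN => hh h0.
  rewrite sub0r normrN [h *: 1]mulr1 [h + x]addrC normrM normfV ler_pdivrMl ?normr_gt0//.
  by rewrite mulrC; exact: hd.
apply: DeriveDef; first by apply/cvg_ex; exists 0.
exact: cvg_lim cv.
Qed.

Lemma cderiv0_constant q : (forall z, 0 < Re z -> cderiv q z 0) ->
  forall z w, 0 < Re z -> 0 < Re w -> q z = q w.
Proof.
move=> dq z w z0 w0; pose v := w - z.
have line (t : R) : 0 <= t <= 1 -> 0 < Re (z + t%:C * v).
  move=> /andP[t0 t1]; rewrite ReD ReM /= mul0r subr0 ReD ReN.
  have -> : Re z + t * (Re w - Re z) = (1 - t) * Re z + t * Re w by ring.
  move: t0; rewrite le_eqVlt => /predU1P[<-|t0]; first by rewrite subr0 mul1r mul0r addr0.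
  by rewrite ltr_wpDl ?mulr_gt0// mulr_ge0 ?(ltW z0)// subr_ge0.
have small (t : R) : 0 <= t <= 1 -> forall e : R, 0 < e -> exists2 d : R, 0 < d &
    forall h : R, `|h| < d ->
      normc (q (z + (t + h)%:C * v) - q (z + t%:C * v)) <= e * `|h|.
  move=> tt e e0; have v1 : 0 < normc v + 1 by rewrite ltr_wpDl ?normc_ge0.
  have [d d0 hd] := dq _ (line t tt) (e / (normc v + 1)) ltac:(by rewrite divr_gt0).
  exists (d / (normc v + 1)); first by rewrite divr_gt0.
  move=> h; rewrite ltr_pdivlMr// => hh.
  have E : z + (t + h)%:C * v - (z + t%:C * v) = h%:C * v by rewrite rmorphD /=; ring.
  have nE : normc (h%:C * v) = `|h| * normc v by rewrite normcM normc_real.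
  have hv : `|h| * normc v <= `|h| * (normc v + 1) by rewrite ler_wpM2l// lerDl.
  have := hd (z + (t + h)%:C * v); rewrite E nE mul0r subr0 => /(_ (le_lt_trans hv hh)) H.
  apply: (le_trans H); rewrite mulrAC -mulrA ler_wpM2l ?(ltW e0)//.
  by rewrite ler_pdivrMr.
have flat (p : R[i] -> R) : (forall u u', `|p u - p u'| <= normc (u - u')) -> p (q z) = p (q w).
  move=> pL; pose f t := p (q (z + t%:C * v)).
  have df (t : R) : 0 <= t <= 1 -> is_derive t (1 : R) f 0.
    move=> tt; apply: is_derive0 => e e0; have [d d0 hd] := small t tt e e0.
    by exists d => // h /hd; apply: le_trans; exact: pL.
  have cf : {within `[0, 1], continuous f}.
    apply: continuous_in_subspaceT => t; rewrite inE /= in_itv /= => tt.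
    apply: differentiable_continuous; apply/derivable1_diffP.
    by have [] := df t tt.
  have [|c _] := @MVT_segment R f (fun=> 0) 0 1 ler01 _ cf.
    by move=> t; rewrite in_itv /= => /andP[t0 t1]; apply: df; rewrite !ltW.
  rewrite mul0r => /subr0_eq; rewrite /f mul1r mul0r addr0.
  by rewrite /v addrC subrK => ->.
apply: eq_complexP.
  by apply: (flat (fun u => Re u)) => u u'; rewrite -ReN -ReD normc_Re.
by apply: (flat (fun u => Im u)) => u u'; rewrite -ImN -ImD normc_Im.
Qed.

End vanishing_derivative.

Section averages.
Context {R : realType}.
Local Notation leb := (@lebesgue_measure R).
Implicit Types (F : R[i] -> R[i]) (z w : R[i]).
Variable s0 : R[i].
Hypothesis Re_s0 : 0 <= Re s0.

Definition average F z : R[i] := sint (fun t => F (z + t%:C * s0)) 0 1.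

Lemma rcont_ray F z t : (forall w, 0 < Re w -> ccont F w) -> 0 < Re (z + t%:C * s0) ->
  rcont (fun t => F (z + t%:C * s0)) t.
Proof.
move=> cF zt e e0; have [d d0 hd] := cF _ zt e e0.
have s1 : 0 < normc s0 + 1 by rewrite ltr_wpDl ?normc_ge0.
exists (d / (normc s0 + 1)); first by rewrite divr_gt0.
move=> y; rewrite ltr_pdivlMr// => hy; apply: hd.
have -> : z + y%:C * s0 - (z + t%:C * s0) = (y - t)%:C * s0 by rewrite rmorphB /=; ring.
by rewrite normcM normc_real (le_lt_trans _ hy)// ler_wpM2l// lerDl.
Qed.

Lemma sint_small (phi : R -> R[i]) (a : R) : rcont phi a -> (forall t, a <= t -> rcont phi t) ->
  forall e, 0 < e -> exists2 d, 0 < d & forall h, 0 < h < d ->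
    normc (sint phi a (a + h) - phi a * h%:C) <= 2 * e * h.
Proof.
move=> ca ct e e0; have [d d0 hd] := ca e e0; exists d => // h /andP[h0 hdl].
have ah : a <= a + h by rewrite lerDl ltW.
have -> : phi a * h%:C = sint (fun=> phi a) a (a + h) by rewrite sint_cst// addrAC subrr add0r.
have mI : measurable (`[a, a + h]%classic : set (measurableTypeR R)) by exact: measurable_itv.
have i1 : cintegrable leb `[a, a + h] phi by apply: rcont_cintegrable => t /andP[/ct].
have i2 : cintegrable leb `[a, a + h] (fun=> phi a).
  by apply: rcont_cintegrable => t _ e' e0'; exists 1 => // y _; rewrite subrr ComplexField.Normc.normc0.
rewrite /sint -cintB//.
apply: (le_trans (normc_sint_le (M := e) ah (cintegrableB mI i1 i2) _)).
  move=> t /andP[t1 t2]; apply: ltW; apply: hd; rewrite ger0_norm ?subr_ge0//.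
  by apply: le_lt_trans hdl; rewrite lerBlDl.
by rewrite addrAC subrr add0r.
Qed.

(** The difference quotients of the average in the direction s0 are those of the
    two ends of the segment of integration. *)
Lemma cderiv_average F z D : (forall w, 0 < Re w -> ccont F w) -> 0 < Re z ->
  cderiv (average F) z D -> D * s0 = F (z + s0) - F z.
Proof.
move=> cF z0 dM; pose phi (t : R) := F (z + t%:C * s0).
have cphi t : 0 <= t -> rcont phi t.
  by move=> t0; apply: rcont_ray => //; rewrite ReD ReM /= mul0r subr0 ltr_wpDr// mulr_ge0.
have phi0 : phi 0 = F z by rewrite /phi mul0r addr0.
have phi1 : phi 1 = F (z + s0) by rewrite /phi mul1r.
apply/eqP; rewrite -subr_eq0 -normc_eq0 eq_le normc_ge0 andbT; apply/ler_addgt0Pr => e e0.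
rewrite add0r -phi0 -phi1.
have s1 : 0 < normc s0 + 1 by rewrite ltr_wpDl ?normc_ge0.
have e8 : 0 < e / 8 by rewrite divr_gt0.
have [d1 d10 h1] := sint_small (cphi _ ler01) (fun t t1 => cphi t (le_trans ler01 t1)) e8.
have [d2 d20 h2] := sint_small (cphi _ (lexx 0)) cphi e8.
have [d3 d30 h3] := dM (e / 2 / (normc s0 + 1)) ltac:(by rewrite !divr_gt0).
pose h := Num.min (Num.min d1 d2) (d3 / (normc s0 + 1)) / 2.
have m0 : 0 < Num.min (Num.min d1 d2) (d3 / (normc s0 + 1)) by rewrite !lt_min d10 d20 divr_gt0.
have h0 : 0 < h by rewrite divr_gt0.
have hm : h < Num.min (Num.min d1 d2) (d3 / (normc s0 + 1)) by rewrite /h; lra.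
move: (hm); rewrite !lt_min -andbA => /and3P[hd1 hd2]; rewrite ltr_pdivlMr// => hd3.
have {}h1 := h1 h ltac:(by rewrite h0 hd1); have {}h2 := h2 h ltac:(by rewrite h0 hd2).
have int a b : 0 <= a -> cintegrable leb `[a, b] phi.
  by move=> a0; apply: rcont_cintegrable => t /andP[ta _]; apply: cphi; rewrite (le_trans a0).
have shiftE : average F (z + h%:C * s0) - average F z = sint phi 1 (1 + h) - sint phi 0 (0 + h).
  have -> : average F (z + h%:C * s0) = sint (fun t => phi (t + h)) 0 1.
    by apply: eq_cint => t _; rewrite /phi rmorphD /=; congr (F _); ring.
  have h01 : h <= 1 + h by rewrite lerDr.
  have i0 : cintegrable leb `[0 + h, 1 + h] phi by apply: int; rewrite add0r ltW.
  rewrite (sint_translate i0) add0r.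
  have -> : average F z = sint phi 0 1 by [].
  have A := sint_split (ltW h0) h01 (int 0 (1 + h) (lexx 0)).
  have h11 : 1 <= 1 + h by rewrite lerDl ltW.
  have B := sint_split ler01 h11 (int 0 (1 + h) (lexx 0)).
  have lin (u v w t : R[i]) : u + v = w + t -> v - w = t - u.
    by move=> E; have -> : v = w + t - u by [rewrite -E addrAC subrr add0r]; ring.
  by apply: lin; rewrite -A.
have nh : normc (h%:C * s0) = h * normc s0 by rewrite normcM normc_real gtr0_norm.
have := h3 (z + h%:C * s0); rewrite [z + _ - z]addrAC subrr add0r nh.
have hs : h * normc s0 <= h * (normc s0 + 1) by rewrite ler_wpM2l ?(ltW h0)// lerDl.
move=> /(_ (le_lt_trans hs hd3)); rewrite shiftE => H3.
set A := sint phi 1 _ in h1 H3; set B := sint phi 0 _ in h2 H3.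
have key : (D * s0 - (phi 1 - phi 0)) * h%:C =
    (A - phi 1 * h%:C) - (B - phi 0 * h%:C) - (A - B - D * (h%:C * s0)) by ring.
have : normc (D * s0 - (phi 1 - phi 0)) * h <= e * h.
  rewrite -[X in _ * X <= _](gtr0_norm h0) -normc_real -normcM key.
  rewrite (_ : e * h = 2 * (e / 8) * h + 2 * (e / 8) * h + e / 2 * h); last by field.
  rewrite (le_trans (normcD _ _))// normcN; apply: lerD.
    by rewrite (le_trans (normcD _ _))// normcN; exact: lerD.
  apply: (le_trans H3); rewrite mulrAC ler_pdivrMr// -[leRHS]mulrA ler_wpM2l ?divr_ge0 ?(ltW e0)//.
by rewrite ler_pM2r.
Qed.

End averages.

Section segment_convolution.
Context {R : realType} (nu : zenMeasure R).
Local Notation leb := (@lebesgue_measure R).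
Local Notation M := (measurableTypeR R).
Variables (kap : R -> R[i]) (s0 : R[i]).
Hypothesis kap_cont : forall t, rcont kap t.
Hypothesis Re_s0 : 0 <= Re s0.

Definition cut_kernel (t : M) : R[i] := if t \in `[0%R, 1%R] then kap t else 0.
Definition ray (t : M) : R[i] := (Num.max t 0)%:C * s0.

Lemma measurable_cut (g : M -> R) : measurable_fun setT g ->
  measurable_fun setT (fun t : M => if t \in `[0%R, 1%R] then g t else 0).
Proof.
move=> mg; apply: measurable_fun_ifT => //.
by apply: (measurable_fun_bool true); rewrite setTI; exact: measurable_itv.
Qed.

Lemma measurable_cut_Re : measurable_fun setT (fun t => Re (cut_kernel t)).
Proof.
apply: eq_measurable_fun (measurable_cut (measurable_rcont kap_cont).1) => t _.
by rewrite /cut_kernel; case: ifP.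
Qed.

Lemma measurable_cut_Im : measurable_fun setT (fun t => Im (cut_kernel t)).
Proof.
apply: eq_measurable_fun (measurable_cut (measurable_rcont kap_cont).2) => t _.
by rewrite /cut_kernel; case: ifP.
Qed.

Lemma measurable_max0 : measurable_fun setT (fun t : M => Num.max t 0 : R).
Proof. by apply: measurable_maxr. Qed.

Lemma measurable_ray_Re : measurable_fun setT (fun t => Re (ray t)).
Proof.
apply: (eq_measurable_fun (fun t : M => Num.max t 0 * Re s0)).
  by move=> t _; rewrite ReM /= mul0r subr0.
exact: measurable_funM measurable_max0 (measurable_cst _).
Qed.

Lemma measurable_ray_Im : measurable_fun setT (fun t => Im (ray t)).
Proof.
apply: (eq_measurable_fun (fun t : M => Num.max t 0 * Im s0)).
  by move=> t _; rewrite ImM /= mul0r addr0.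
exact: measurable_funM measurable_max0 (measurable_cst _).
Qed.

Lemma ray_ge0 t : 0 <= Re (ray t).
Proof. by rewrite ReM /= mul0r subr0 mulr_ge0// le_max lexx orbT. Qed.

Lemma integrable_cut_kernel : leb.-integrable setT (EFin \o (fun t => normc (cut_kernel t))).
Proof.
have mI : measurable (`[0%R, 1%R]%classic : set M) by exact: measurable_itv.
have [K hK] := @rcont_bounded R kap 0 1 (fun t _ => kap_cont t).
have i1 := (integrable_mkcond _ mI).1 (integrable_cst_segment K 0 1).
apply: le_integrable i1 => //.
  have m : measurable_fun setT (fun t : M => normc (kap t)).
    by apply: continuous_measurable_fun => x; exact: rcont_normc.
  apply/measurable_EFinP; apply: eq_measurable_fun (measurable_cut m) => t _.
  by rewrite /cut_kernel; case: ifP => // _; rewrite ComplexField.Normc.normc0.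
move=> t _; rewrite /= patchE mem_setE /cut_kernel; case: ifPn => [t1|_].
  have KK : normc (kap t) <= K by apply: hK; move: t1; rewrite in_itv.
  by rewrite lee_fin (ger0_norm (normc_ge0 _)) (le_trans KK)// ler_norm.
by rewrite ComplexField.Normc.normc0 normr0 abse_ge0.
Qed.

Lemma segment_convolution (f : zenSpace nu) : exists H : zenSpace nu, forall z : R[i],
  0 < Re z -> ext0 H z = sint (fun t => kap t * ext0 f (z + t%:C * s0)) 0 1.
Proof.
exists (conv_op (mu := leb) measurable_cut_Re measurable_cut_Im measurable_ray_Re
  measurable_ray_Im ray_ge0 integrable_cut_kernel f) => z z0.
rewrite ext0_conv// /conv_at /sint /cint; congr (_ +i* _);
  rewrite [RHS]Rintegral_mkcond; apply: eq_Rintegral => t _;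
  rewrite patchE mem_setE /cut_kernel /ray;
  case: ifPn => [|_]; rewrite ?mul0r// in_itv /= => /andP[t0 _]; by rewrite max_l.
Qed.

End segment_convolution.

Section spiral_in_essential_spectrum.
Context {R : realType} (nu : zenMeasure R).
Implicit Types (z w : R[i]).

Section integrated_equation.
Variables (t0 : R) (s0 : R[i]).
Hypothesis Re_s0 : 0 <= Re s0.

Lemma rcontM (f g : R -> R[i]) x : rcont f x -> rcont g x -> rcont (fun t => f t * g t) x.
Proof.
move=> cf cg e e0; pose A := normc (f x) + 1; pose B := normc (g x) + 1.
have A0 : 0 < A by rewrite ltr_wpDl ?normc_ge0.
have B0 : 0 < B by rewrite ltr_wpDl ?normc_ge0.
have [d1 d10 h1] := cf (Num.min 1 (e / 2 / B)) ltac:(by rewrite lt_min ltr01 !divr_gt0).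
have [d2 d20 h2] := cg (e / 2 / A) ltac:(by rewrite !divr_gt0).
have [d3 d30 h3] := cg 1 ltr01.
exists (Num.min d1 (Num.min d2 d3)); first by rewrite !lt_min d10 d20.
move=> y; rewrite !lt_min => /and3P[/h1 + /h2 H2 /h3 H3]; rewrite lt_min => /andP[_ H1].
have -> : f y * g y - f x * g x = (f y - f x) * g y + f x * (g y - g x) by ring.
rewrite (le_lt_trans (normcD _ _))// [ltRHS]splitr !normcM; apply: ltr_leD.
  have gy : normc (g y) <= B by rewrite /B; have := normcBD (g y) (g x); lra.
  apply: (le_lt_trans (ler_wpM2l (normc_ge0 _) gy)).
  by rewrite -ltr_pdivlMr.
have fA : normc (f x) <= A by rewrite /A lerDl.
apply: (le_trans (ler_wpM2r (normc_ge0 _) fA)).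
by rewrite mulrC -ler_pdivlMr// ltW.
Qed.

Lemma rcont_exp_line (c : R[i]) t : rcont (fun t : R => cexp (t%:C * c)) t.
Proof.
move=> e e0; have [d d0 hd] := cderiv_ccont (cderiv_cexp (t%:C * c)) e0.
have s1 : 0 < normc c + 1 by rewrite ltr_wpDl ?normc_ge0.
exists (d / (normc c + 1)); first by rewrite divr_gt0.
move=> y; rewrite ltr_pdivlMr// => hy; apply: hd.
rewrite -mulrBl -rmorphB /= normcM normc_real (le_lt_trans _ hy)// ler_wpM2l//.
by rewrite lerDl.
Qed.

(** With Phi = e^(t0 s) F the equation F (s + s0) - l F = G reads
    Phi (s + s0) - Phi = e^(t0 s) G / l, so that averaging F along the segment
    from s to s + s0 integrates G. *)
Lemma integrated_equation (f : zenSpace nu) (G : R[i] -> R[i]) :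
  (forall z, 0 < Re z -> ext0 f (z + s0) - cexp (- s0 * t0%:C) * ext0 f z =
     cexp (- t0%:C * z) * G z) ->
  exists H : zenSpace nu, forall z, 0 < Re z -> exists D,
    cderiv (fun z => cexp (t0%:C * z) * ext0 H z) z D /\
    D * s0 = cexp (s0 * t0%:C) * G z.
Proof.
move=> eqn.
have [H hH] := segment_convolution (rcont_exp_line (t0%:C * s0)) Re_s0 f.
exists H => z z0; pose Phi w := cexp (t0%:C * w) * ext0 f w.
have dE w : cderiv (fun w => cexp (t0%:C * w)) w (cexp (t0%:C * w) * (t0%:C * 1)).
  exact: cderiv_comp (cderiv_cexp (t0%:C * w)) (cderivZ t0%:C (cderiv_id w)).
have cPhi w : 0 < Re w -> ccont Phi w.
  move=> w0; have [D hD] := holomorphic_holo (@zen_holo _ _ f) w0.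
  exact: cderiv_ccont (cderivM (dE w) hD).
have pos w t : 0 < Re w -> 0 <= t -> 0 < Re (w + t%:C * s0).
  by move=> w0 t1; rewrite ReD ReM /= mul0r subr0 ltr_wpDr// mulr_ge0.
have avE w : 0 < Re w -> cexp (t0%:C * w) * ext0 H w = average s0 Phi w.
  move=> w0; rewrite hH// /average /sint -cintZ; last 2 first.
  - exact: measurable_itv.
  - apply: rcont_cintegrable => t /andP[t1 _].
    have hF v : 0 < Re v -> ccont (ext0 f) v.
      by move=> /(holomorphic_holo (@zen_holo _ _ f))[D hD]; exact: cderiv_ccont hD.
    apply: rcontM; first exact: rcont_exp_line.
    exact: rcont_ray hF (pos _ _ w0 t1).
  apply: eq_cint => t _; rewrite /Phi mulrA -cexpD; congr (cexp _ * _).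
  by ring.
have [D1 h1] := holomorphic_holo (@zen_holo _ _ H) z0.
have dM := cderivM (dE z) h1.
eexists; split; first exact: dM.
have dA : cderiv (average s0 Phi) z (cexp (t0%:C * z) * (t0%:C * 1) * ext0 H z + cexp (t0%:C * z) * D1).
  apply: (eq_cderiv_near z0 _ dM) => w wz; apply: avE.
  by have := le_lt_trans (normc_Re _) wz; rewrite ReD ReN ltr_norml => /andP[]; lra.
rewrite (cderiv_average Re_s0 cPhi z0 dA) /Phi.
have : cexp (t0%:C * (z + s0)) * (ext0 f (z + s0) - cexp (- s0 * t0%:C) * ext0 f z) =
    cexp (t0%:C * (z + s0)) * (cexp (- t0%:C * z) * G z) by rewrite eqn.
rewrite mulrBr [_ * (_ * ext0 f z)]mulrA [_ * (_ * G z)]mulrA -!cexpD.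
rewrite (_ : t0%:C * (z + s0) + - s0 * t0%:C = t0%:C * z); last by ring.
by rewrite (_ : t0%:C * (z + s0) + - t0%:C * z = s0 * t0%:C); last by ring.
Qed.

End integrated_equation.

(** Infinitely many exponents gam j lie just above the threshold r. A combination of the
    damped powers in the range of T - l integrates to a combination of powers of
    exponents 1 - gam j, plus a constant, that is again a Zen function after damping;
    its dominant term would then be one too, although its exponent is beyond the
    threshold. The exponents avoid 1, whose primitive is a logarithm. *)
Lemma spiral_not_finite_codim (s0 : R[i]) (Re_s0 : 0 <= Re s0) (t0 : R) : s0 != 0 -> 0 <= t0 ->
  let T : {linear zenSpace nu -> zenSpace nu} := comp_translate Re_s0 (nu := nu) in
  ~ finite_codim (range (fun f => T f - cexp (- s0 * t0%:C) *: f)).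
Proof.
move=> sn0 t00 T fc; have [n [hr hn]] := in_zen_threshold nu t00.
pose r : R := n.+1%:R / 2; pose del (j : nat) : R := (j.+3%:R)^-1.
pose gam (j : nat) : R := r + del j.
have inv0 (j : nat) : 0 < del j by rewrite invr_gt0.
have inv3 (j : nat) : del j <= 3^-1.
  have h : 3%:R <= j.+3%:R :> R by rewrite ler_nat.
  by rewrite /del lef_pV2 ?posrE ?ltr0n.
have gz j : in_zen nu t0 (gam j).
  by apply: in_zen_upward hr; rewrite /gam lerDl ltW.
have gam_inj : injective gam.
  by move=> i j /addrI/invr_inj/eqP; rewrite eqr_nat => /eqP[].
have gam1 j : gam j != 1.
  rewrite /gam /r; case: n {hr hn r gam gz gam_inj} => [|[|n]].
  - by rewrite lt_eqF//; have := inv3 j; lra.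
  - by rewrite gt_eqF//; have := inv0 j; lra.
  - have : 3 <= n.+3%:R :> R by rewrite ler_nat.
    by move=> h; rewrite gt_eqF//; have := inv0 j; lra.
have [N [c [f [[i0 ci0] eqn]]]] := finite_codim_dependent (fun j => ZenSpace (gz j)) fc.
pose G z := \sum_(i < N.+1) c i * cpow (z + 1) (- gam i).
have [|H hH] := @integrated_equation t0 s0 Re_s0 f G.
  move=> z z0; have := congr1 (fun g : zenSpace nu => ext0 g z) eqn.
  rewrite ext0_zenB ext0_zenZ (ext0_comp_translate Re_s0 f z0) ext0_zen_sum => ->.
  rewrite /G mulr_sumr; apply: eq_bigr => i _; rewrite (ext0_on _ z0) /damped_power.
  by rewrite mulrCA.
pose b i := cexp (s0 * t0%:C) / s0 * c i / (1 - gam i)%:C.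
pose Q z := \sum_(i < N.+1) b i * cpow (z + 1) (1 - gam i).
pose E z := cexp (t0%:C * z) * ext0 H z.
have gamC i : (1 - gam i)%:C != 0 :> R[i].
  by rewrite -normc_gt0 normc_real normr_gt0 subr_eq0 eq_sym gam1.
have dQ z : 0 < Re z -> cderiv Q z (cexp (s0 * t0%:C) / s0 * G z).
  move=> z0; have d3 : cderiv (fun w => w + 1) z (1 + 0) := cderivD (cderiv_id z) (cderiv_cst 1 z).
  have d2 g := @cderiv_comp _ (cpow^~ g) _ z _ _ (cderiv_cpow g (Re_gt0D1 z0)) d3.
  have := cderiv_sum (index_enum 'I_N.+1) (fun i : 'I_N.+1 => cderivZ (b i) (d2 (1 - gam i))).
  rewrite /G mulr_sumr; congr (cderiv _ _ _); apply: eq_bigr => i _.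
  rewrite addr0 mulr1 (_ : 1 - gam i - 1 = - gam i); last by ring.
  by rewrite /b !mulrA divfK.
have dEQ z : 0 < Re z -> cderiv (fun z => E z - Q z) z 0.
  move=> z0; have [D [hD Ds]] := hH z z0; have := cderivB hD (dQ z z0).
  have -> : D - cexp (s0 * t0%:C) / s0 * G z = 0; last by [].
  apply: (mulIf sn0); rewrite mul0r mulrBl Ds [X in _ - X]mulrAC (divfK sn0).
  exact: subrr.
have one0 : 0 < Re (1 : R[i]) by rewrite /=.
pose kap := E 1 - Q 1.
have EQ z : 0 < Re z -> E z = kap + Q z.
  by move=> z0; rewrite /kap (cderiv0_constant dEQ one0 z0) subrK.
clear dEQ dQ hH eqn.
(* The index ord0 carries the constant of integration, with exponent 0. *)
pose b' (i : 'I_N.+2) := oapp b kap (unlift ord0 i).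
pose ex (k : nat) : R := if k is j.+1 then 1 - gam j else 0.
have ex0 : ex 0%N = 0 by [].
have exS k : ex k.+1 = 1 - gam k by [].
have ex_neq0 k : ex k.+1 <> 0.
  by rewrite exS => /subr0_eq/esym/eqP; rewrite (negPf (gam1 k)).
pose e' (i : 'I_N.+2) : R := ex (val i).
have e'_inj : injective e'.
  move=> i j h; apply: val_inj; move: h; rewrite /e'.
  case: (val i) (val j) => [|k] [|l]; rewrite ?ex0; [by []| | |].
  - by move=> /esym/ex_neq0.
  - by move=> /ex_neq0.
  - by rewrite !exS => /addrI/oppr_inj/gam_inj ->.
have b'0 : b' (lift ord0 i0) != 0.
  rewrite /b' liftK /= /b; apply: mulf_neq0; last by rewrite invr_eq0; exact: gamC.
  apply: mulf_neq0 ci0; apply: mulf_neq0; first exact: cexp_neq0.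
  by rewrite invr_eq0.
have [J [eJ [rho [B [rho1 B0 dom]]]]] := dominant_power e'_inj b'0.
have e'S (i : 'I_N.+1) : e' (lift ord0 i) = 1 - gam i by exact: exS.
have e'0 : e' ord0 = 0 by exact: ex0.
rewrite e'S in eJ.
have sumE z : \sum_(i < N.+2) b' i * cpow (z + 1) (e' i) = kap + Q z.
  rewrite big_ord_recl /b' unlift_none /=; congr (_ + _).
    by rewrite e'0 /cpow mul0r cexp0 mulr1.
  by apply: eq_bigr => i _; rewrite liftK e'S.
have rho0 : 0 < rho := lt_le_trans ltr01 rho1.
have reJ : 0 <= r + e' J by move: eJ; rewrite /gam; have := inv3 i0; lra.
have : in_zen nu t0 (- e' J).
  have hol := holomorphic_on (holo_damped_power t0 (- e' J)).
  have C20 : 0 <= expR ((r + e' J) * ln rho) by exact: expR_ge0.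
  pose P : zenSpace nu := ZenSpace hr.
  apply: (zen_dominated (g1 := H) (g2 := P) hol B0 C20).
  move=> z z0; have PE : ext0 P z = damped_power t0 r z by exact: ext0_on.
  rewrite PE (ext0_on _ z0) !normc_damped_power opprK.
  have w1 := normcD1_gt1 z0; have w0 : 0 < normc (z + 1) := lt_trans ltr01 w1.
  have [rw|wr] := leP rho (normc (z + 1)).
    have := dom _ rw; rewrite sumE -(EQ z z0) normc_cpow => h.
    apply: (@le_trans _ _ (B * normc (ext0 H z))); last first.
      by rewrite lerDl !mulr_ge0 ?expR_ge0.
    apply: (le_trans (ler_wpM2l (expR_ge0 _) h)).
    have -> : normc (E z) = expR (t0 * Re z) * normc (ext0 H z).
      by rewrite /E normcM normc_cexp ReM /= mul0r subr0.
    rewrite mulrCA; apply: (ler_wpM2l B0); rewrite mulrA -expRD mulNr addrC subrr expR0.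
    by rewrite mul1r lexx.
  apply: (@le_trans _ _ (expR ((r + e' J) * ln rho) *
      (expR (- t0 * Re z) * expR (- r * ln (normc (z + 1)))))); last first.
    rewrite lerDr; exact: mulr_ge0 B0 (normc_ge0 _).
  rewrite [leRHS]mulrCA; apply: (ler_wpM2l (expR_ge0 _)); rewrite -expRD ler_expR.
  have : (r + e' J) * ln (normc (z + 1)) <= (r + e' J) * ln rho.
    apply: (ler_wpM2l reJ); rewrite ler_ln; [exact: ltW|exact: w0|exact: rho0].
  by move: (ln _) (ln _) => u v; lra.
move=> hz; apply: hn; apply: in_zen_upward hz => //.
move: eJ; rewrite /gam /r -[n.+1]addn1 natrD; have := inv3 i0; lra.
Qed.

End spiral_in_essential_spectrum.

(** * The spectrum and the essential spectrum *)

Section assembly.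
Context {R : realType} (nu : zenMeasure R).
Implicit Types (l : R[i]).

Lemma norm1E l : (`|l| = 1) <-> (normc l = 1).
Proof.
rewrite Defs.normcE; split=> [/(congr1 (fun w : R[i] => Re w)) //|->].
by [].
Qed.

(** A nonconstant line of slope i winds around the circle for positive times. *)
Lemma circle_on_ray (s0 : R[i]) l : Re s0 = 0 -> s0 != 0 -> normc l = 1 ->
  exists2 t : R, 0 <= t & cexp (- s0 * t%:C) = l.
Proof.
move=> r0 sn0 l1; have l0 : l != 0 by rewrite -normc_gt0 l1.
have [w wl] := cexp_surj l0.
have w0 : Re w = 0 by apply: expR_inj; rewrite expR0 -normc_cexp wl.
have y0 : Im s0 != 0 by apply: contra_neq sn0 => i0; exact: eq_complexP.
have p0 : 0 < pi *+ 2 :> R by rewrite pmulrn_lgt0// pi_gt0.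
pose t (m : int) : R := - (Im w + m%:~R * (pi *+ 2)) / Im s0.
have tl m : cexp (- s0 * (t m)%:C) = l.
  have -> : - s0 * (t m)%:C = w + (0 +i* (m%:~R * (pi *+ 2))).
    apply: eq_complexP.
      by rewrite ReD ReM ReN ImN /= r0 w0 oppr0 mul0r mulr0 subr0 addr0.
    by rewrite ImD ImM ReN ImN /= r0 oppr0 mul0r add0r /t !mulNr mulrN opprK mulrCA divff// mulr1.
  by rewrite cexpD cexp_2pi mulr1.
pose N : int := (Num.floor (`|Im w| / (pi *+ 2)) + 1)%R.
have hN : `|Im w| <= N%:~R * (pi *+ 2).
  by rewrite -ler_pdivrMr// ltW// floorD1_gt.
move: hN; rewrite ler_norml => /andP[h1 h2].
have [y_lt|y_gt] := ltP (Im s0) 0.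
  exists (t N); last exact: tl.
  by rewrite /t mulr_le0// ?invr_le0 ?(ltW y_lt)// oppr_le0; lra.
exists (t (- N)); last exact: tl.
by rewrite /t mulr_ge0 ?invr_ge0// oppr_ge0 mulrNz; lra.
Qed.

End assembly.

Theorem proposition3p2 (R : realType) (nu : zenMeasure R) (s0 : R[i])
    (Re_s0 : 0 <= complex.Re s0) (s0_neq0 : s0 != 0) :
  let T : {linear zenSpace nu -> zenSpace nu} := comp_translate Re_s0 (nu := nu) in
  (complex.Re s0 = 0 ->
     spectrum T = [set z : R[i] | `|z| = 1] /\
     essential_spectrum T = [set z : R[i] | `|z| = 1]) /\
  (0 < complex.Re s0 ->
     spectrum T =
       [set cexp (- s0 * t%:C) | t in [set t : R | 0 <= t]] `|` [set 0] /\
     essential_spectrum T =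
       [set cexp (- s0 * t%:C) | t in [set t : R | 0 <= t]] `|` [set 0]).
Proof.
move=> T.
have sandwich (A : set R[i]) : spectrum T `<=` A -> A `<=` essential_spectrum T ->
    spectrum T = A /\ essential_spectrum T = A.
  move=> sA Ae; split; apply/seteqP; split => //.
    by apply: subset_trans Ae _; exact: essential_spectrum_sub.
  by apply: subset_trans sA; exact: essential_spectrum_sub.
have spiral (t : R) : 0 <= t -> essential_spectrum T (cexp (- s0 * t%:C)).
  by move=> t0 [_ _ fc]; exact: (spiral_not_finite_codim s0_neq0 t0 fc).
split=> Re0; apply: sandwich.
- move=> l sl; apply/norm1E/eqP; rewrite eq_le !leNgt; apply/andP; split; apply/negP => l1.
    exact: spectrum_le1 l1 sl.
  exact: spectrum_ge1 Re0 l1 sl.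
- by move=> l /norm1E l1; have [t t0 <-] := circle_on_ray Re0 s0_neq0 l1; exact: spiral.
- move=> l sl; apply: contrapT => nl; apply: (spectrum_off_spiral Re0 _ _ sl).
    by apply/eqP => l0; apply: nl; right.
  by move=> t t0; apply/eqP => tl; apply: nl; left; exists t.
- move=> l [[t t0 <-]|->]; first exact: spiral.
  by move=> [_ _ fc]; exact: (zero_not_finite_codim Re0 fc).
Qed.
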